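(* (i) The closed cone $\mathcal C^{7}_{\mathcal E}$ of flag vectors of Eulerian posets of rank $7$ is finitely generated, with exactly $24$ extreme rays. Twenty of the extreme rays are generated by the flag vectors of the doubled limit posets $DP(6,\mathcal I)$ for $\mathcal I$ even interval systems on $[1,6]$. (ii) The cone $\mathcal C^7_{\mathcal E}$ has exactly $23$ facets. Fifteen of the facets are determined by inequalities of type (A); four additional facets are determined by inequalities of type (B); the remaining four facets are determined by inequalities of type (C). Here, with $n=6$ and $P$ an Eulerian poset of rank $7$, the types are: (A) $(-1)^{|M|/2}\sum_{M\subseteq Q\subseteq V}L_Q(P)\ge0$ for an admissible pair $(M,V)$; (B) $(-1)^{|T|}\sum_{T\subseteq Q\subseteq V}L_Q(P)\ge0$, where $T\subseteq V\subseteq[1,6]$ and $|I\cap T|\le1$ for every $I\in\mathcal I[V]$; (C) $f_{\{i,k\}}(P)-2f_{\{i\}}(P)-2f_{\{k\}}(P)+2f_{\{j\}}(P)\ge0$, where $1\le i<j<k\le6$.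
   Context: $[a,b]=\{a,\dots,b\}$ for integers $a\le b$. For a finite set $S$ of integers, $\mathcal I[S]$ is the collection of maximal intervals (of consecutive integers) contained in $S$. Below $n=6$. A graded poset is a finite partially ordered set $P$ with a unique minimum $\hat 0$, a unique maximum $\hat 1$, and a rank function $\rho:P\to\mathbf{N}$ with $\rho(\hat 0)=0$ and $\rho(y)-\rho(x)=1$ whenever $y$ covers $x$; its rank is $\rho(\hat 1)$. For $P$ of rank $n+1$ and $S\subseteq[1,n]$, $f_S(P)$ is the number of chains $x_1<\cdots<x_{|S|}$ in $P$ with $\{\rho(x_1),\dots,\rho(x_{|S|})\}=S$; the flag vector is $(f_S(P):S\subseteq[1,n])\in\mathbf{R}^{2^n}$. $P$ is Eulerian if $\mu([x,y])=(-1)^{\rho(y)-\rho(x)}$ for every interval $[x,y]$ of $P$. The flag $L$-vector of $P$ is $L_S(P)=(-1)^{n-|S|}\sum_{T\supseteq[1,n]\setminus S}(-\tfrac12)^{|T|}f_T(P)$, $S\subseteq[1,n]$ (linear forms in the flag vector). $\mathcal{C}^{n+1}_{\mathcal E}$ is the closure of the convex cone generated by the flag vectors of all Eulerian posets of rank $n+1$. An inequality determines a facet if it is valid on the cone and equality defines a face of dimension one less than that of the cone. Admissible pairs: $(M,V)$ with $M\subseteq V\subseteq[1,n]$ is admissible if every $I\in\mathcal I[V]$ has cardinality at least $2$, every $I\in\mathcal I[[0,n+1]\setminus V]$ has cardinality at most $3$, and every $[a,b]\in\mathcal I[V]$ satisfies: (i) $M\cap[a,b]=\emptyset$, $[a,a+1]$,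 or $[b-1,b]$; (ii) if $a\notin M$ then $a-2\in\{-1\}\cup M$; (iii) if $b\notin M$ then $b+2\in\{n+2\}\cup M$. Limit posets: For an interval $I\subseteq[1,n]$ and a positive integer $N$, $D_I^N(P)$ is obtained from $P$ by replacing every $x\in P$ with $\rho(x)\in I$ by $N$ elements $x_1,\dots,x_N$, with: (i) if $\rho(x)\in I$, $\rho(y)\notin I$, then $x_i<y$ iff $x<y$ in $P$, and $y<x_i$ iff $y<x$ in $P$; (ii) if $\rho(x),\rho(y)\in I$, then $x_i<y_j$ iff $i=j$ and $x<y$ in $P$; other relations unchanged. An interval system on $[1,n]$ is a set of (nonempty) subintervals of $[1,n]$, none contained in another; it is even if $|I\cap J|$ is even for all $I,J\in\mathcal I$ (including $I=J$). $P(n,\mathcal I,N)$ is obtained from a chain of rank $n+1$ by applying $D_I^N$ for all $I\in\mathcal I$ (order irrelevant). The flag vector of the limit poset $P(n,\mathcal I)$ is $f_S(P(n,\mathcal I))=\lim_{N\to\infty}f_S(P(n,\mathcal I,N))/N^{|\mathcal I|}$, and the flag vector of the doubled limit poset is $f_S(DP(n,\mathcal I))=2^{|S|}f_S(P(n,\mathcal I))$. *)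

(* Defs.v *)
From HB Require Import structures.
From mathcomp Require Import all_boot all_order all_algebra.
From mathcomp Require Import all_classical all_reals all_analysis.

Set Implicit Arguments.
Unset Strict Implicit.
Unset Printing Implicit Defensive.

Import Order.TTheory GRing.Theory Num.Theory.
Import numFieldNormedType.Exports.

Local Open Scope ring_scope.

(* A set of ranks S included in [1, n] is encoded by S : {set 'I_n}, the
   ordinal i standing for the integer i + 1; [ranks S] lists these integers. *)
Definition ranks (n : nat) (S : {set 'I_n}) : seq nat :=
  [seq (nat_of_ord i).+1 | i <- enum S].

Definition nat_itv (n a b : nat) : {set 'I_n} :=
  [set i : 'I_n | (a <= i.+1 <= b)%N]%SET.

Definition max_itv (S : pred nat) (a b : nat) : Prop :=
  [/\ (a <= b)%N,
      forall k, (a <= k <= b)%N -> S k,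
      ~~ S b.+1 &
      forall c, c.+1 = a -> ~~ S c].

Definition is_rank_function (d : Order.disp_t) (P : finTBPOrderType d)
    (rho : P -> nat) : Prop :=
  rho \bot%O = 0%N /\
  forall x y : P, (x < y)%O -> (forall z : P, ~~ (x < z < y)%O) ->
    rho y = (rho x).+1.

(* The first argument bounds the recursion depth; it must be at least the
   length of a longest chain from x to y (see [mobius_lt]). *)
Fixpoint mobius_rec (d : Order.disp_t) (P : finPOrderType d) (k : nat)
    (x y : P) : int :=
  if x == y then 1
  else if k is k'.+1 then
    - \sum_(z : P | (x <= z < y)%O) mobius_rec k' x z
  else 0.

Definition mobius (d : Order.disp_t) (P : finPOrderType d) (x y : P) : int :=
  mobius_rec #|P| x y.

Lemma mobius_refl (d : Order.disp_t) (P : finPOrderType d) (x : P) :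
  mobius x x = 1.
Proof. by rewrite /mobius; case: #|P| => [|k] /=; rewrite eqxx. Qed.

Lemma mobius_rec_stable (d : Order.disp_t) (P : finPOrderType d) (x y : P)
    (k l : nat) :
  (#|[set z : P | (x <= z < y)%O]%SET| <= k)%N ->
  (#|[set z : P | (x <= z < y)%O]%SET| <= l)%N ->
  mobius_rec k x y = mobius_rec l x y.
Proof.
elim: k l y => [|k IHk] l y.
  rewrite leqn0 cards_eq0 => /eqP e _.
  case: l => //= l; case: eqP => // _.
  rewrite big_pred0 ?oppr0 // => z.
  by have /setP/(_ z) := e; rewrite !inE.
case: l => [_|l Hk Hl] /=.
  rewrite leqn0 cards_eq0 => /eqP e; case: eqP => // _.
  rewrite big_pred0 ?oppr0 // => z.
  by have /setP/(_ z) := e; rewrite !inE.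
case: eqP => // _; congr (- _); apply: eq_bigr => z /andP[xz zy].
have H : (#|[set t : P | (x <= t < z)%O]%SET| <
          #|[set t : P | (x <= t < y)%O]%SET|)%N.
  apply: proper_card; apply/properP; split.
    apply/fintype.subsetP => t; rewrite !inE => /andP[-> tz] /=.
    exact: lt_trans tz zy.
  by exists z; rewrite !inE ?xz ?zy // ltxx andbF.
by apply: IHk; rewrite -ltnS; apply: leq_trans H _.
Qed.

Lemma mobius_lt (d : Order.disp_t) (P : finPOrderType d) (x y : P) :
  (x < y)%O -> mobius x y = - \sum_(z : P | (x <= z < y)%O) mobius x z.
Proof.
move=> xy; rewrite /mobius.
rewrite (@mobius_rec_stable _ _ x y _ #|P|.+1) ?max_card //; last first.
  exact: leq_trans (max_card _) (leqnSn _).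
by rewrite /= lt_eqF.
Qed.

Definition is_Eulerian (d : Order.disp_t) (P : finTBPOrderType d)
    (rho : P -> nat) : Prop :=
  forall x y : P, (x <= y)%O -> mobius x y = (-1) ^+ (rho y - rho x).

(* Here t and S have the same number of elements, and S no repetition, so that
   [perm_eq] says that the set of ranks of t is S. *)
Definition flag_number (T : finType) (lt : rel T) (rho : T -> nat)
    (n : nat) (S : {set 'I_n}) : nat :=
  #|[set t : #|S|.-tuple T |
       sorted lt t && perm_eq [seq rho x | x <- t] (ranks S)]%SET|.

Definition to_flag (R : realType) (n : nat) (f : {set 'I_n} -> R) :
    'rV[R]_#|{set 'I_n}| :=
  \row_i f (enum_val i).

Definition flag_coord (R : realType) (n : nat) (v : 'rV[R]_#|{set 'I_n}|)
    (S : {set 'I_n}) : R :=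
  v 0 (enum_rank S).

Lemma to_flagK (R : realType) (n : nat) (f : {set 'I_n} -> R) S :
  flag_coord (to_flag f) S = f S.
Proof. by rewrite /flag_coord mxE enum_rankK. Qed.

Definition Eulerian_flag_vectors (R : realType) (n : nat) :
    set 'rV[R]_#|{set 'I_n}| :=
  [set v | exists (d : Order.disp_t) (P : finTBPOrderType d) (rho : P -> nat),
    [/\ is_rank_function rho,
        rho \top%O = n.+1,
        is_Eulerian rho &
        v = to_flag (fun S : {set 'I_n} =>
              (flag_number (fun x y : P => (x < y)%O) rho S)%:R)]]%classic.

Definition cone_hull (R : realType) (V : lmodType R) (X : set V) : set V :=
  [set v | exists (k : nat) (c : 'I_k -> R) (x : 'I_k -> V),
    [/\ forall i, 0 <= c i,
        forall i, X (x i) &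
        v = \sum_(i < k) c i *: x i]]%classic.

Definition Eulerian_cone (R : realType) (n : nat) :
    set 'rV[R]_#|{set 'I_n}| :=
  closure (cone_hull (@Eulerian_flag_vectors R n)).

Definition finitely_generated (R : realType) (V : lmodType R) (C : set V) :
    Prop :=
  exists s : seq V, C = cone_hull [set` s]%classic.

Definition ray (R : realType) (V : lmodType R) (v : V) : set V :=
  [set w | exists2 t : R, 0 <= t & w = t *: v]%classic.

Definition extreme_rays (R : realType) (V : lmodType R) (C : set V) :
    set (set V) :=
  [set r | exists v : V,
    [/\ v != 0, r = ray v, (r `<=` C)%classic &
        forall x y : V, C x -> C y -> r (x + y) -> r x /\ r y]]%classic.

(* Dimension of the linear hull of X; for a convex set X containing 0, such as
   a cone or one of its faces, this is the dimension of X. *)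
Definition has_dim (R : realType) (V : vectType R) (X : set V) (k : nat) :
    Prop :=
  exists U : {vspace V},
    [/\ forall v, X v -> v \in U,
        forall W : {vspace V}, (forall v, X v -> v \in W) -> (U <= W)%VS &
        \dim U = k].

(* F is the facet of C determined by the inequality l v >= 0. *)
Definition determines_facet (R : realType) (V : vectType R) (C : set V)
    (l : V -> R) (F : set V) : Prop :=
  [/\ forall v, C v -> 0 <= l v,
      F = (C `&` [set v | l v = 0])%classic &
      exists k, has_dim F k /\ has_dim C k.+1].

Definition facets_from (R : realType) (V : vectType R) (C : set V)
    (Q : (V -> R) -> Prop) : set (set V) :=
  [set F | exists2 l, Q l & determines_facet C l F]%classic.

Definition facets (R : realType) (V : vectType R) (C : set V) : set (set V) :=
  facets_from C (fun l => scalar l).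

Definition flag_L (R : realType) (n : nat) (S : {set 'I_n})
    (v : 'rV[R]_#|{set 'I_n}|) : R :=
  (-1) ^+ (n - #|S|) *
  \sum_(T : {set 'I_n} | ~: S \subset T) (- 2^-1) ^+ #|T| * flag_coord v T.

(* The conditions "a - 2 is -1 or in M" and "b + 2 is n + 2 or in M" are written
   without subtraction in nat. *)
Definition admissible (n : nat) (M V : {set 'I_n}) : Prop :=
  [/\ M \subset V,
      forall a b, max_itv [pred k | k \in ranks V] a b ->
        (2 <= b - a + 1)%N,
      forall a b, max_itv [pred k | (k <= n.+1)%N && (k \notin ranks V)] a b ->
        (b - a + 1 <= 3)%N &
      forall a b, max_itv [pred k | k \in ranks V] a b ->
        [/\ [\/ M :&: nat_itv n a b = finset.set0,
                M :&: nat_itv n a b = nat_itv n a a.+1 |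
                M :&: nat_itv n a b = nat_itv n b.-1 b],
            a \notin ranks M ->
              a = 1%N \/ (exists2 m, m \in ranks M & a = (m + 2)%N) &
            b \notin ranks M -> b = n \/ (b + 2)%N \in ranks M]].

Definition typeA (R : realType) (n : nat)
    (l : 'rV[R]_#|{set 'I_n}| -> R) : Prop :=
  exists M V : {set 'I_n},
    admissible M V /\
    l = fun v => (-1) ^+ (#|M| %/ 2) *
        \sum_(Q : {set 'I_n} | (M \subset Q) && (Q \subset V)) flag_L Q v.

Definition typeB (R : realType) (n : nat)
    (l : 'rV[R]_#|{set 'I_n}| -> R) : Prop :=
  exists T V : {set 'I_n},
    [/\ T \subset V,
        forall a b, max_itv [pred k | k \in ranks V] a b ->
          (#|nat_itv n a b :&: T| <= 1)%N &
        l = fun v => (-1) ^+ #|T| *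
          \sum_(Q : {set 'I_n} | (T \subset Q) && (Q \subset V)) flag_L Q v].

Definition typeC (R : realType) (n : nat)
    (l : 'rV[R]_#|{set 'I_n}| -> R) : Prop :=
  exists i j k : 'I_n,
    (i < j < k)%N /\
    l = fun v => flag_coord v [set i; k]%SET - 2 * flag_coord v [set i]%SET
                 - 2 * flag_coord v [set k]%SET + 2 * flag_coord v [set j]%SET.

(* Flag numbers only depend on the strict order and the rank function, so only
   these are kept for the posets obtained by replicating intervals of a chain. *)
Record ranked_rel := RankedRel {
  rr_sort : finType;
  rr_lt : rel rr_sort;
  rr_rank : rr_sort -> nat }.

Definition chain_poset (n : nat) : ranked_rel :=
  @RankedRel 'I_n.+1 (fun x y => (x < y)%N) (fun x => x).

(* An element of the new poset is a pair of x and the index of one of its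
   copies: N copies if the rank of x is in I, only one otherwise. *)
Definition replicate (n : nat) (I : {set 'I_n}) (N : nat) (P : ranked_rel) :
    ranked_rel :=
  let inI (x : rr_sort P) := rr_rank x \in ranks I in
  @RankedRel {x : rr_sort P & 'I_(if inI x then N else 1)}
    (fun u v => rr_lt (tag u) (tag v) &&
       (inI (tag u) && inI (tag v) ==>
          (nat_of_ord (tagged u) == nat_of_ord (tagged v))))
    (fun u => rr_rank (tag u)).

Definition iter_replicate (n : nat) (Is : {set {set 'I_n}}) (N : nat) :
    ranked_rel :=
  foldr (fun I P => replicate I N P) (chain_poset n.+1) (enum Is).

Definition is_rank_interval (n : nat) (I : {set 'I_n}) : bool :=
  (I != finset.set0) &&
  [forall i in I, forall k in I, forall j : 'I_n,
     (i <= j <= k)%N ==> (j \in I)].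

Definition interval_system (n : nat) (Is : {set {set 'I_n}}) : bool :=
  [forall I in Is, is_rank_interval I] &&
  [forall I in Is, forall J in Is, (I \subset J) ==> (I == J)].

Definition even_interval_system (n : nat) (Is : {set {set 'I_n}}) : bool :=
  interval_system Is &&
  [forall I in Is, forall J in Is, ~~ odd #|I :&: J|].

Definition limit_flag (R : realType) (n : nat) (Is : {set {set 'I_n}})
    (S : {set 'I_n}) : R :=
  limn (fun N : nat =>
    (flag_number (@rr_lt (iter_replicate Is N))
                 (@rr_rank (iter_replicate Is N)) S)%:R
      / N%:R ^+ #|Is| : R).

Definition doubled_limit_flag_vector (R : realType) (n : nat)
    (Is : {set {set 'I_n}}) : 'rV[R]_#|{set 'I_n}| :=
  to_flag (fun S : {set 'I_n} => 2 ^+ #|S| * limit_flag R Is S).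

Definition doubled_limit_rays (R : realType) (n : nat) :
    set (set 'rV[R]_#|{set 'I_n}|) :=
  [set r | exists2 Is : {set {set 'I_n}}, even_interval_system Is &
             r = ray (doubled_limit_flag_vector R Is)]%classic.

Arguments Eulerian_cone R n : clear implicits.
Arguments doubled_limit_rays R n : clear implicits.

(* Main.v *)
(* In terms of the flag L-vector, which determines the flag vector
   (flag_coordE), the generalized Dehn-Sommerville relations say that L_S = 0
   for every S of [1,6] except the 13 sets whose maximal intervals all have even
   cardinality, so the cone lies in a space of dimension 13.

   Upper bound: 23 linear inequalities hold for Eulerian posets. Up to the
   Dehn-Sommerville relations, those in L_Q expand as sums over chains of
   products of factors (number of elements of some rank strictly between two
   chain elements) - 2, and these numbers are at least 2. The four of type (C)
   come from covering the comparability graph between ranks i and k by the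
   complete bipartite graphs that the elements of rank j induce.

   Lower bound: 24 rays are limits of flag vectors of Eulerian posets, obtained
   by replicating the elements of small ranked posets along shared coordinates
   and then doubling them. For twenty of them the small poset is a chain, which
   gives the doubled limit posets; the other four were found by hand.

   An execution of the double description method shows that the cone cut out by
   the 23 inequalities is generated by the 24 rays. Extreme rays and facets are
   then read off the table of the values of the inequalities on the rays. *)

(* Validity is proved in the forms (B) and (C) only. On Eulerian posets [L_Q] vanishes unless all
   maximal intervals of [Q] are even, so an element of [T] at an end of a maximal interval of [V]
   forces its neighbour there into [Q]. Completing [T] to [M] in this way makes fifteen forms of
   type (B) agree with forms of type (A). The counts of facets by type are exact because a face is
   known by the rays it contains: all pairs of subsets of [1,6] allowed in (A) or (B) are run
   through, and the zero pattern of each form on the 24 rays is compared with those of the facets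
   that the type must miss. The finite checks run on lists of ranks and binary integers, and [zr]
   carries their results to the reals, where only linear algebra and limits remain. *)
From HB Require Import structures.
From Stdlib Require Import ZArith.
Require Import Defs.
From mathcomp Require Import all_boot all_order all_algebra.
From mathcomp Require Import ssrZ zify lra ring.

Set Implicit Arguments.
Unset Strict Implicit.
Unset Printing Implicit Defensive.

Import Order.TTheory GRing.Theory Num.Theory.

(* [%Z] is taken by MathComp's integers. *)
Delimit Scope Z_scope with BZ.

(** * Chains with given ranks *)

Section Chains.
Variables (T : finType) (lt : rel T) (rho : T -> nat).

Fixpoint chains (x : T) (l : seq nat) : nat :=
  if l is s :: l' then \sum_(y | lt x y && (rho y == s)) chains y l' else 1.

Definition chains0 (l : seq nat) : nat :=
  if l is s :: l' then \sum_(y | rho y == s) chains y l' else 1.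

Lemma sum_tuple_cons (k : nat) (F : k.+1.-tuple T -> nat) :
  \sum_t F t = \sum_x \sum_(t : k.-tuple T) F [tuple of x :: t].
Proof.
rewrite pair_big /= (reindex (fun p : T * k.-tuple T => [tuple of p.1 :: p.2])) //=.
exists (fun t : k.+1.-tuple T => (thead t, [tuple of behead t])) => [[x t]|t] _ /=.
  by rewrite theadE; congr pair; apply: val_inj.
by rewrite -tuple_eta.
Qed.

Lemma chainsE (x : T) (l : seq nat) (k : nat) : k = size l ->
  \sum_(t : k.-tuple T) (path lt x t && (map rho t == l) : nat) = chains x l.
Proof.
elim: l x k => [|s l IHl] x k -> /=.
  rewrite (eq_bigr (fun=> 1)) => [|t _]; last by rewrite (tuple0 t).
  by rewrite sum1_card card_tuple expn0.
rewrite sum_tuple_cons [RHS]big_mkcond; apply: eq_bigr => y _ /=.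
case: ifP => [/andP[xy /eqP ry]|/negP xy].
  rewrite -(IHl y _ erefl); apply: eq_bigr => t _.
  by rewrite xy eqseq_cons ry eqxx.
rewrite big1 // => t _; rewrite eqseq_cons.
by case: (lt x y) xy => //=; case: (rho y == s) => //= _; rewrite andbF.
Qed.

Lemma chains0E (l : seq nat) (k : nat) : k = size l ->
  \sum_(t : k.-tuple T) (sorted lt t && (map rho t == l) : nat) = chains0 l.
Proof.
case: l => [|s l] -> /=.
  rewrite (eq_bigr (fun=> 1)) => [|t _]; last by rewrite (tuple0 t).
  by rewrite sum1_card card_tuple expn0.
rewrite sum_tuple_cons [RHS]big_mkcond; apply: eq_bigr => y _ /=.
case: ifP => ry.
  rewrite -(chainsE y erefl); apply: eq_bigr => t _.
  by rewrite eqseq_cons ry.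
by rewrite big1 // => t _; rewrite eqseq_cons ry andbF.
Qed.

Hypothesis lt_rho : forall x y, lt x y -> (rho x < rho y)%N.

Lemma ranks_sorted n (S : {set 'I_n}) : sorted ltn (ranks S).
Proof.
rewrite /ranks sorted_map /=.
have : sorted ltn (map val (enum 'I_n)) by rewrite val_enum_ord iota_ltn_sorted.
rewrite sorted_map enumT => H.
have -> : enum S = [seq i <- Finite.enum 'I_n | i \in S].
  by rewrite {1}/enum_mem.
by apply: sorted_filter => // a b c; apply: ltn_trans.
Qed.

Lemma size_ranks n (S : {set 'I_n}) : size (ranks S) = #|S|.
Proof. by rewrite size_map -cardE. Qed.

(** The ranks along a chain are strictly increasing, and sorted lists without repetition that are
    permutations of each other are equal. Flag numbers thus become computable by recursion on a list
    of ranks. *)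
Lemma flag_numberE n (S : {set 'I_n}) :
  flag_number lt rho S = chains0 (ranks S).
Proof.
rewrite -(chains0E (esym (size_ranks S))) /flag_number -sum1_card.
rewrite big_mkcond /=; apply: eq_bigr => t _.
rewrite !inE; case st: (sorted lt t) => //=.
have sr : sorted ltn (map rho t).
  by rewrite sorted_map; apply: sub_sorted st => x y; apply: lt_rho.
have -> : perm_eq (map rho t) (ranks S) = (map rho t == ranks S).
  apply/idP/eqP => [p|->] //.
  exact: (irr_sorted_eq ltn_trans ltnn sr (ranks_sorted S) (perm_mem p)).
by case: eqP.
Qed.

End Chains.

(** * Coverings of a bipartite graph by complete bipartite graphs *)

(** In the four [gain] lemmas a complete bipartite graph is added to a partial cover: [u] and [w]
    count its old and new vertices on one side, [u'] and [w'] on the other. The products on the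
    right count its edges with a new end, and the added constant is the [k] of [excess_step]: the
    excess changes by at least [2 - k]. *)
Lemma gain_ge2 (u w u' w' : nat) : 2 <= u -> 2 <= u' + w' ->
  2 * w + 2 * w' <= w * (u' + w') + w' * u.
Proof.
move=> hu hb; have := leq_mul (leqnn w) hb; have := leq_mul (leqnn w') hu.
lia.
Qed.

Lemma gain_ge0 (u w u' w' : nat) : 1 <= u -> 2 <= u + w -> 2 <= u' + w' ->
  2 * w + 2 * w' <= w * (u' + w') + w' * u + 2.
Proof.
move=> hu ha hb; have [u2|u1] := leqP 2 u; first by have := gain_ge2 w u2 hb; lia.
have -> : u = 1 by lia.
have : 1 * (u' + w' - 2) <= w * (u' + w' - 2) by apply: leq_mul => //; lia.
by rewrite !mulnBr; have := leq_mul (leqnn w) hb; lia.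
Qed.

Lemma gain_ge1 (u w u' w' : nat) : 1 <= u -> 1 <= u' ->
    2 <= u + w -> 2 <= u' + w' ->
  2 * w + 2 * w' <= w * (u' + w') + w' * u + 1.
Proof.
move=> hu hu' ha hb; have [u2|u1] := leqP 2 u.
  by have := gain_ge2 w u2 hb; lia.
have -> : u = 1 by lia.
have : 1 * (u' + w' - 2) <= w * (u' + w' - 2) by apply: leq_mul => //; lia.
by rewrite !mulnBr; have := leq_mul (leqnn w) hb; lia.
Qed.

Lemma gain_new (w w' : nat) : 2 <= w -> 2 <= w' ->
  2 * w + 2 * w' <= w * w' + 4.
Proof. by case: w => [|[|w]] // _; case: w' => [|[|w']] // _; lia. Qed.

(* The points j of J are added one at a time, and the excess of
   #edges + 2 #J over twice the number of vertices is tracked. A point that meets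
   what is already covered never decreases it. A point j that meets nothing may
   decrease it by 2, but then the one or two further points provided by [thick]
   make up for the loss. *)
Section BipartiteCover.
Variables (X Y T : finType) (J : {set T}) (A : T -> {set X}) (B : T -> {set Y}).

Let VA (K : {set T}) := \bigcup_(j in K) A j.
Let VB (K : {set T}) := \bigcup_(j in K) B j.
Let E (K : {set T}) := \bigcup_(j in K) setX (A j) (B j).
Let excess (K : {set T}) : int :=
  (#|E K|%:Z + 2 * #|K|%:Z - 2 * #|VA K|%:Z - 2 * #|VB K|%:Z)%R.

Lemma excess_step (K : {set T}) (j : T) (k : nat) : j \notin K ->
  2 * #|A j :\: VA K| + 2 * #|B j :\: VB K| <=
    #|A j :\: VA K| * (#|B j :&: VB K| + #|B j :\: VB K|)
    + #|B j :\: VB K| * #|A j :&: VA K| + k ->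
  (excess K + 2 - k%:Z <= excess (j |: K))%R.
Proof.
move=> jK gain.
have hA : #|VA (j |: K)| = #|VA K| + #|A j :\: VA K|.
  rewrite /VA bigcup_setU big_set1 setUC -cardsUI.
  rewrite (_ : _ :&: (_ :\: _) = set0) ?cards0 ?addn0; last first.
    by apply/setP=> x; rewrite !inE; case: (x \in _); rewrite ?andbF.
  by congr #|pred_of_set _|; apply/setP=> x; rewrite !inE; case: (x \in _).
have hB : #|VB (j |: K)| = #|VB K| + #|B j :\: VB K|.
  rewrite /VB bigcup_setU big_set1 setUC -cardsUI.
  rewrite (_ : _ :&: (_ :\: _) = set0) ?cards0 ?addn0; last first.
    by apply/setP=> x; rewrite !inE; case: (x \in _); rewrite ?andbF.
  by congr #|pred_of_set _|; apply/setP=> x; rewrite !inE; case: (x \in _).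
have hK : #|j |: K| = #|K|.+1 by rewrite cardsU1 jK.
(* [E1] and [E2] split the edges of [j] that have a new end. None lies in [E K], whose edges have
   both ends covered. *)
set E1 := setX (A j :\: VA K) (B j); set E2 := setX (A j :&: VA K) (B j :\: VB K).
have sE : E K :|: (E1 :|: E2) \subset E (j |: K).
  rewrite /E bigcup_setU big_set1; apply/subsetP=> [[x y]]; rewrite !inE /=.
  case/orP=> [->|]; first by rewrite orbT.
  by case/orP=> [/andP[/andP[_ ->] ->]|/andP[/andP[-> _] /andP[_ ->]]].
have dE : E K :&: (E1 :|: E2) = set0.
  apply/setP=> [[x y]]; rewrite !inE /=; apply/negP=> /andP[/bigcupP[i iK]].
  rewrite !inE => /andP[/= xi yi].
  have xV : x \in VA K by apply/bigcupP; exists i.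
  have yV : y \in VB K by apply/bigcupP; exists i.
  by rewrite xV yV /= !andbF.
have d12 : E1 :&: E2 = set0.
  by apply/setP=> [[x y]]; rewrite !inE /=; case: (x \in VA K); rewrite ?andbF.
have cE : #|E K| + (#|A j :\: VA K| * #|B j| + #|A j :&: VA K| * #|B j :\: VB K|)
    <= #|E (j |: K)|.
  apply: leq_trans (subset_leq_card sE).
  have := cardsUI (E K) (E1 :|: E2); rewrite dE cards0 addn0 => ->.
  by have := cardsUI E1 E2; rewrite d12 cards0 addn0 => ->; rewrite !cardsX.
rewrite /excess hA hB hK; move: cE gain; rewrite -(cardsID (VB K) (B j)).
by clear; lia.
Qed.

Hypothesis A2 : forall j, j \in J -> 2 <= #|A j|.
Hypothesis B2 : forall j, j \in J -> 2 <= #|B j|.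
Hypothesis thick : forall j x y, j \in J -> x \in A j -> y \in B j ->
  exists2 j', j' \in J & [&& j' != j, x \in A j' & y \in B j'].

Lemma excess_ge0 : (0 <= excess J)%R.
Proof.
have [n] := ubnP #|J :\: set0|; have : (0 <= excess set0)%R.
  by rewrite /excess /E /VA /VB !big_set0 !cards0.
have : set0 \subset J by exact: sub0set.
elim: n set0 => // n IH K sK eK nK.
have [JK|[j jJ jK]] : J = K \/ exists2 j, j \in J & j \notin K.
- case: (set_0Vmem (J :\: K)) => [/eqP|[j]].
    by rewrite setD_eq0 => JK; left; apply/eqP; rewrite eqEsubset JK.
  by rewrite inE => /andP[jK jJ]; right; exists j.
- by rewrite JK.
have grow (L : {set T}) i : K \subset L -> L \subset J -> i \in J -> i \notin K ->
    (0 <= excess (i |: L))%R -> (0 <= excess J)%R.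
  move=> KL LJ iJ iK e; apply: (IH (i |: L)) => //.
    by rewrite subUset sub1set iJ LJ.
  rewrite -ltnS; apply: leq_trans nK; rewrite ltnS; apply: proper_card.
  apply/properP; split.
    by apply: setDS; apply: subset_trans KL _; apply: subsetUr.
  by exists i; rewrite !inE ?iJ ?iK // eqxx.
have memI (Z : finType) (S V : {set Z}) z : z \in S -> z \in V -> 0 < #|S :&: V|.
  by move=> zS zV; apply/card_gt0P; exists z; rewrite inE zS.
case: (boolP [exists i in J, (i \notin K) &&
        ((0 < #|A i :&: VA K|) || (0 < #|B i :&: VB K|))]).
  case/exists_inP=> i iJ /andP[iK hi]; apply: (grow K i) => //.
  have a2 := A2 iJ; have b2 := B2 iJ.
  rewrite -(cardsID (VA K)) in a2; rewrite -(cardsID (VB K)) in b2.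
  suff gain : 2 * #|A i :\: VA K| + 2 * #|B i :\: VB K| <=
      #|A i :\: VA K| * (#|B i :&: VB K| + #|B i :\: VB K|)
      + #|B i :\: VB K| * #|A i :&: VA K| + 2.
    by apply: le_trans (excess_step iK gain); rewrite addrK.
  case/orP: hi => hi; first exact: gain_ge0.
  have := gain_ge0 hi b2 a2; clear; lia.
rewrite negb_exists_in => /forall_inP dis.
have {}dis i : i \in J -> i \notin K -> A i :&: VA K = set0 /\ B i :&: VB K = set0.
  move=> iJ iK; have := dis i iJ; rewrite iK /= negb_or -!eqn0Ngt !cards_eq0.
  by case/andP=> /eqP-> /eqP->.
have notK i x y : x \in A i -> y \in B i -> x \notin VA K -> i \notin K.
  by move=> xi yi; apply: contra => iK; apply/bigcupP; exists i.
have [x xA] : exists x, x \in A j by apply/card_gt0P; apply: ltnW (A2 jJ).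
have [y yB] : exists y, y \in B j by apply/card_gt0P; apply: ltnW (B2 jJ).
have [dA dB] := dis j jJ jK.
have xV : x \notin VA K.
  by apply/negP=> xV; have := memI _ _ _ _ xA xV; rewrite dA cards0.
have [j1 j1J /and3P[j1j xA1 yB1]] := thick jJ xA yB.
have j1K := notK _ _ _ xA1 yB1 xV.
set K1 := j |: K.
(* Here [j] meets nothing covered and may cost 2; other points through its vertex [x] repay this
   debt. *)
have e1 : (-2 <= excess K1)%R.
  have a2 := A2 jJ; have b2 := B2 jJ.
  rewrite -(cardsID (VA K)) dA cards0 add0n in a2.
  rewrite -(cardsID (VB K)) dB cards0 add0n in b2.
  apply: le_trans (excess_step (k := 4) jK _).
    by move: (excess K) eK; clear; lia.
  by rewrite dA dB !cards0 muln0 addn0 add0n gain_new.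
have j1K1 : j1 \notin K1 by rewrite !inE negb_or j1j.
have VAK1 : x \in VA K1 by apply/bigcupP; exists j; rewrite ?setU11.
have VBK1 z : z \in B j -> z \in VB K1.
  by move=> zB; apply/bigcupP; exists j; rewrite ?setU11.
have := memI _ _ _ _ xA1 VAK1; have := memI _ _ _ _ yB1 (VBK1 y yB) => yI xI.
have a2 := A2 j1J; have b2 := B2 j1J.
rewrite -(cardsID (VA K1)) in a2; rewrite -(cardsID (VB K1)) in b2.
(* The point [j1] shares the edge from [x] to [y] with [j]. With two old vertices on the second side
   it repays the whole debt ([k = 0]), with a single one it repays half ([k = 1]). *)
have [e2|[e2 I1]] : (0 <= excess (j1 |: K1))%R \/
    (-1 <= excess (j1 |: K1))%R /\ #|B j1 :&: VB K1| <= 1.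
- have [u2|u1] := leqP #|B j1 :&: VB K1| 1; [right|left].
    split=> //; apply: le_trans (excess_step (k := 1) j1K1 _).
      by move: (excess K1) e1; clear; lia.
    exact: gain_ge1.
  apply: le_trans (excess_step (k := 0) j1K1 _).
    by move: (excess K1) e1; clear; lia.
  by have := gain_ge2 #|B j1 :\: VB K1| u1 a2; clear; lia.
- apply: (grow K1 j1) => //; first exact: subsetUr.
  by rewrite subUset sub1set jJ.
(* A second vertex [y'] of [j] gives a point [j2] through [x] and [y']. It differs from [j1], which
   has only one old vertex on that side, and it repays the rest. *)
have [y' y'B y'y] : exists2 y', y' \in B j & y' != y.
  have : 0 < #|B j :\ y| by have := B2 jJ; rewrite (cardsD1 y) yB.
  by case/card_gt0P=> y'; rewrite !inE => /andP[? ?]; exists y'.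
have [j2 j2J /and3P[j2j xA2 yB2]] := thick jJ xA y'B.
have j2K := notK _ _ _ xA2 yB2 xV.
have j21 : j2 != j1.
  apply/eqP=> j21; rewrite j21 in yB2.
  have : #|[set y; y']| <= #|B j1 :&: VB K1|.
    apply: subset_leq_card; apply/subsetP=> z; rewrite !inE.
    by case/orP=> /eqP->; rewrite ?yB1 ?yB2 VBK1.
  by rewrite cards2 eq_sym y'y => /leq_trans/(_ I1).
set K2 := j1 |: K1 in e2.
have j2K2 : j2 \notin K2 by rewrite !inE !negb_or j21 j2j.
apply: (grow K2 j2) => //.
- by apply: subset_trans (subsetUr _ _); apply: subsetUr.
- by rewrite !subUset !sub1set j1J jJ.
have sV : x \in VA K2 by apply/bigcupP; exists j; rewrite ?inE ?eqxx ?orbT.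
have sW : y' \in VB K2 by apply/bigcupP; exists j; rewrite ?inE ?eqxx ?orbT.
have := memI _ _ _ _ xA2 sV; have := memI _ _ _ _ yB2 sW => yI2 xI2.
apply: le_trans (excess_step (k := 1) j2K2 _).
  by move: (excess K2) e2; clear; lia.
by apply: gain_ge1 => //; rewrite cardsID ?A2 ?B2.
Qed.

Lemma bipartite_cover :
  2 * (#|\bigcup_(j in J) A j| + #|\bigcup_(j in J) B j|) <=
  #|\bigcup_(j in J) setX (A j) (B j)| + 2 * #|J|.
Proof. by have := excess_ge0; rewrite /excess /E /VA /VB; clear; lia. Qed.

End BipartiteCover.

(** * Eulerian posets *)

Section EulerianPoset.
Variables (d : Order.disp_t) (P : finTBPOrderType d) (rho : P -> nat).
Hypothesis rank : is_rank_function rho.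
Hypothesis eul : is_Eulerian rho.

Local Notation chn := (chains (fun x y : P => (x < y)%O) rho).

Definition between (x y : P) (t : nat) : nat := #|[set z | (x < z < y)%O & rho z == t]|.

Lemma open_sub (x z y : P) : (x < z < y)%O ->
  #|[set t | (x < t < z)%O]| < #|[set t | (x < t < y)%O]| /\
  #|[set t | (z < t < y)%O]| < #|[set t | (x < t < y)%O]|.
Proof.
case/andP=> xz zy; split; apply: proper_card; apply/properP; split;
  try by exists z; rewrite !inE ?xz ?zy ?ltxx ?andbF.
- by apply/subsetP=> t; rewrite !inE => /andP[-> tz]; apply: lt_trans tz zy.
- by apply/subsetP=> t; rewrite !inE => /andP[zt ->]; rewrite (lt_trans xz zt).
Qed.

Lemma rank_lt (x y : P) : (x < y)%O -> rho x < rho y.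
Proof.
have [n] := ubnP #|[set z | (x < z < y)%O]|.
elim: n x y => // n IH x y; rewrite ltnS => c xy.
case: (pickP (fun z => x < z < y)%O) => [z xzy|no].
  have [c1 c2] := open_sub xzy; case/andP: xzy => xz zy.
  apply: ltn_trans (IH z y _ zy); last exact: leq_trans c2 c.
  by apply: (IH x z _ xz); apply: leq_trans c1 c.
by case: rank => _ /(_ x y xy) -> // z; rewrite no.
Qed.

Lemma rank_between (x y : P) (t : nat) : (x < y)%O -> rho x < t < rho y ->
  exists2 z, (x < z < y)%O & rho z = t.
Proof.
have [n] := ubnP #|[set z | (x < z < y)%O]|.
elim: n x y => // n IH x y; rewrite ltnS => c xy t_in.
case: (pickP (fun z => x < z < y)%O) => [z xzy|no]; last first.
  have r : rho y = (rho x).+1 by case: rank => _ /(_ x y xy) -> // z; rewrite no.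
  by move: t_in; lia.
have [c1 c2] := open_sub xzy; have /andP[xz zy] := xzy.
have [tz|zt|tz] := ltngtP t (rho z); last by exists z.
  have [|w /andP[xw wz] rw] := IH x z (leq_trans c1 c) xz.
    by rewrite tz; case/andP: t_in => ->.
  by exists w; rewrite // xw (lt_trans wz zy).
have [|w /andP[zw wy] rw] := IH z y (leq_trans c2 c) zy.
  by rewrite zt; case/andP: t_in => _ ->.
by exists w; rewrite // wy (lt_trans xz zw).
Qed.

Lemma rank_top_eq (x : P) : rho x = rho \top%O -> x = \top%O.
Proof.
move=> rx; apply/eqP; have := lex1 x; rewrite le_eqVlt => /orP[//|/rank_lt].
by rewrite rx ltnn.
Qed.

Lemma euler_open (x y : P) : (x < y)%O ->
  (\sum_(z | (x < z < y)%O) (-1) ^+ (rho z - rho x) =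
    - (1 + (-1) ^+ (rho y - rho x)) :> int)%R.
Proof.
move=> xy; have := eul (ltW xy); rewrite mobius_lt //.
rewrite (bigD1 x) /= ?lexx ?xy // mobius_refl => <-.
rewrite opprD opprK addrA subrr add0r; apply: eq_big => [z|z /andP[xz zy]].
  by rewrite lt_neqAle eq_sym; case: (z != x); case: (x <= z)%O; rewrite ?andbF ?andbT.
by rewrite eul // ltW.
Qed.

Lemma between_alternating (x y : P) : (x < y)%O ->
  (\sum_((rho x).+1 <= j < rho y) (-1) ^+ (j - rho x) * (between x y j)%:R =
    - (1 + (-1) ^+ (rho y - rho x)) :> int)%R.
Proof.
move=> xy; rewrite -euler_open //.
under eq_bigr => j _ do
  rewrite /between -sum1_card natr_sum mulr_sumr.
under eq_bigr => j _ do under eq_bigl => z do rewrite inE.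
under eq_bigr => j _ do rewrite big_mkcondr /=.
rewrite exchange_big /=; apply: eq_bigr => z /andP[/rank_lt xz /rank_lt zy].
rewrite (bigD1_seq (rho z)) ?iota_uniq ?mem_index_iota ?xz //= eqxx mulr1.
by rewrite big1 ?addr0 // => j; rewrite eq_sym => /negPf->.
Qed.

Lemma between_rank2 (x y : P) : (x < y)%O -> rho y = (rho x).+2 ->
  between x y (rho x).+1 = 2.
Proof.
move=> xy r; have := between_alternating xy; rewrite r big_nat1.
by rewrite subSnn -addn2 addKn expr1 sqrrN expr1n natz; lia.
Qed.

(** An interval of rank 2 with middle rank [t] fits between [x] and [y], and Euler's relation gives
    it exactly two middle elements. *)
Lemma between_ge2 (x y : P) (t : nat) : (x < y)%O -> rho x < t < rho y ->
  2 <= between x y t.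
Proof.
move=> xy t_in.
have [z [xz zy rz]] : exists z, [/\ (x <= z)%O, (z < y)%O & rho z = t.-1].
  have [e|ne] := eqVneq (rho x) t.-1; first by exists x.
  have [|z /andP[xz zy] rz] := @rank_between x y t.-1 xy; first by move: t_in ne; lia.
  by exists z; split=> //; apply: ltW.
have [w [zw wy rw]] : exists w, [/\ (z < w)%O, (w <= y)%O & rho w = t.+1].
  have [e|ne] := eqVneq (rho y) t.+1; first by exists y.
  have [|w /andP[zw wy] rw] := @rank_between z y t.+1 zy.
    by rewrite rz; move: t_in ne; lia.
  by exists w; split=> //; apply: ltW.
have rzt : (rho z).+1 = t by rewrite rz; move: t_in; lia.
have : between z w (rho z).+1 = 2 by apply: between_rank2; rewrite // rw -rzt.
rewrite rzt => <-; apply: subset_leq_card; apply/subsetP=> u; rewrite !inE.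
case/andP=> /andP[zu uw] ->; rewrite andbT.
by rewrite (le_lt_trans xz zu) (lt_le_trans uw wy).
Qed.

Lemma chains_insert (x : P) (t s : nat) (l : seq nat) :
  chn x (t :: s :: l) = \sum_(y | (x < y)%O && (rho y == s)) between x y t * chn y l.
Proof.
rewrite /=; under eq_bigr => z _ do rewrite big_mkcond.
rewrite exchange_big [RHS]big_mkcond; apply: eq_bigr => y _ /=.
rewrite -big_mkcondr /between; case: ifP => [/andP[xy rs]|no].
  rewrite -sum1_card big_distrl /=; apply: eq_big => [z|z _]; last by rewrite mul1n.
  by rewrite inE rs andbT -andbA [RHS]andbAC andbA.
rewrite big_pred0 // => z; apply/negP=> /andP[/andP[xz _] /andP[zy ry]].
by rewrite ry (lt_trans xz zy) in no.
Qed.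

End EulerianPoset.

(** * Linear combinations of flag numbers *)

Arguments Z.add : simpl never.
Arguments Z.mul : simpl never.

(* Coefficients are computed in the binary integers [Z] and transferred to R. *)
Definition zr (R : numDomainType) (z : Z) : R := ((int_of_Z z)%:~R)%R.
Arguments zr : clear implicits.

Section ZR.
Variable R : numDomainType.
Local Open Scope ring_scope.

Lemma zrD x y : zr R (x + y)%BZ = zr R x + zr R y.
Proof. by rewrite /zr -intrD; congr (_%:~R); lia. Qed.

Lemma zrM x y : zr R (x * y)%BZ = zr R x * zr R y.
Proof. by rewrite /zr -intrM; congr (_%:~R); lia. Qed.

Lemma zrN x : zr R (- x)%BZ = - zr R x.
Proof. by rewrite /zr -intrN; congr (_%:~R); lia. Qed.

Lemma zrB x y : zr R (x - y)%BZ = zr R x - zr R y.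
Proof. by rewrite zrD zrN. Qed.

Lemma zr0 : zr R 0%BZ = 0. Proof. by []. Qed.

Lemma zr1 : zr R 1%BZ = 1. Proof. by []. Qed.

Lemma zr_ge0 z : (0 <= zr R z) = (0 <=? z)%BZ.
Proof. by rewrite /zr ler0z; lia. Qed.

Lemma zr_gt0 z : (0 < zr R z) = (0 <? z)%BZ.
Proof. by rewrite /zr ltr0z; lia. Qed.

Lemma zr_eq0 z : (zr R z == 0) = (z =? 0)%BZ.
Proof. by rewrite /zr intr_eq0; lia. Qed.

Lemma zr_nat n : zr R (Z.of_nat n) = n%:R.
Proof. by rewrite /zr pmulrn; congr (_%:~R); lia. Qed.

Lemma zrX x n : zr R (x ^ Z.of_nat n)%BZ = zr R x ^+ n.
Proof.
elim: n => [|n IH]; first by rewrite expr0.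
by rewrite Nat2Z.inj_succ Z.pow_succ_r ?zrM ?IH ?exprS //; lia.
Qed.

Lemma zr_sum (I : Type) (s : seq I) (F : I -> Z) :
  zr R (foldr Z.add 0%BZ (map F s)) = \sum_(i <- s) zr R (F i).
Proof. by elim: s => [|i s IH]; rewrite ?big_nil //= big_cons zrD IH. Qed.

End ZR.

Definition comb := seq (Z * seq nat).

Definition sgZ (k : nat) : Z := if odd k then (-1)%BZ else 1%BZ.

Lemma zr_sgZ (R : numDomainType) k : zr R (sgZ k) = ((-1) ^+ k)%R.
Proof. by rewrite /sgZ -signr_odd; case: (odd k); rewrite ?expr1 ?expr0. Qed.

Section Combinations.
Variable R : numDomainType.
Local Open Scope ring_scope.
Implicit Types (h : seq nat -> R) (c : comb).

Definition ev h c : R := \sum_(p <- c) zr R p.1 * h p.2.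

Definition scale (z : Z) c : comb := [seq (z * p.1, p.2)%BZ | p <- c].

Lemma ev_cat h c1 c2 : ev h (c1 ++ c2) = ev h c1 + ev h c2.
Proof. by rewrite /ev big_cat. Qed.

Lemma ev_scale h z c : ev h (scale z c) = zr R z * ev h c.
Proof.
by rewrite /ev big_map mulr_sumr; apply: eq_bigr => p _ /=; rewrite zrM mulrA.
Qed.

Definition coef c (l : seq nat) : Z :=
  foldr Z.add 0%BZ [seq p.1 | p <- c & p.2 == l].

Lemma ev_coef (keys : seq (seq nat)) h c : uniq keys ->
  all (fun p => p.2 \in keys) c ->
  ev h c = \sum_(l <- keys) zr R (coef c l) * h l.
Proof.
move=> uk ck; rewrite /ev.
under [RHS]eq_bigr => l _ do rewrite zr_sum big_filter mulr_suml big_mkcond /=.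
rewrite exchange_big /=.
rewrite big_seq [RHS]big_seq; apply: eq_bigr => p pc.
have pk : p.2 \in keys by exact: (allP ck).
rewrite (bigD1_seq p.2) //= eqxx big1 ?addr0 // => l.
by rewrite eq_sym => /negPf->.
Qed.

End Combinations.

(* The generalized Dehn-Sommerville relation between the chains whose rank set
   is pre ++ l with at most one more rank inserted between pre and l. *)
Definition gds (top : nat) (pre l : seq nat) : comb :=
  let r := last 0 pre in let s := head top l in
  rcons [seq (sgZ (j - r), pre ++ j :: l) | j <- iota r.+1 (s - r.+1)]
        ((1 + sgZ (s - r))%BZ, pre ++ l).

(* The formal product over st of the factors k, for (true, k), and k - 2, for
   (false, k); a product of ranks stands for the rank set of chains. *)
Fixpoint unfold_steps (st : seq (bool * nat)) : comb :=
  if st is (must, k) :: st' then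
    let e := unfold_steps st' in
    let e1 := [seq (p.1, k :: p.2) | p <- e] in
    if must then e1 else e1 ++ scale (-2)%BZ e
  else [:: (1%BZ, [::])].

(* Between two factors k - 2 there must be a rank that every chain contains. *)
Fixpoint steps_ok (r top : nat) (st : seq (bool * nat)) : bool :=
  match st with
  | [::] => true
  | (true, k) :: st' => steps_ok k top st'
  | [:: (false, t)] => r < t < top
  | (false, t) :: ((true, k) :: st' as st0) => (r < t < k) && steps_ok k top st'
  | _ => false
  end.

Section EulerianFlags.
Variables (R : realDomainType) (d : Order.disp_t) (P : finTBPOrderType d)
  (rho : P -> nat) (top : nat).
Hypothesis rank : is_rank_function rho.
Hypothesis rank_top : rho \top%O = top.
Hypothesis eul : is_Eulerian rho.

Local Notation chn := (chains (fun x y : P => (x < y)%O) rho).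
Local Open Scope ring_scope.

Definition flagsP (l : seq nat) : R := (chn \bot%O (rcons l top))%:R.

Let ch (x : P) (l : seq nat) : R := (chn x l)%:R.

Lemma chR_cons x s l : ch x (s :: l) = \sum_(y | (x < y)%O && (rho y == s)) ch y l.
Proof. by rewrite /ch /= natr_sum. Qed.

(** The extra rank is inserted between consecutive chain elements [x < y]. Once the sums are
    exchanged, each such pair contributes Euler's relation of its interval, [between_alternating]. A
    nonempty [pre] only moves the starting element. *)
Lemma gds_from (x : P) (pre l : seq nat) :
  let r := last (rho x) pre in
  \sum_(r.+1 <= j < head top l) (-1) ^+ (j - r) * ch x (pre ++ j :: rcons l top)
    + (1 + (-1) ^+ (head top l - r)) * ch x (pre ++ rcons l top) = 0.
Proof.
elim: pre x => [|p pre IH] x /=; last first.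
  rewrite chR_cons mulr_sumr.
  under eq_bigr => j _ do rewrite chR_cons mulr_sumr.
  rewrite exchange_big -big_split /=; apply: big1 => y /andP[_ /eqP <-].
  exact: IH.
have -> : rcons l top = head top l :: behead (rcons l top) by case: l.
set s := head top l; set l' := behead _.
under eq_bigr => j _ do rewrite /ch (chains_insert rho) natr_sum mulr_sumr.
rewrite exchange_big chR_cons mulr_sumr -big_split /=.
apply: big1 => y /andP[xy /eqP ys].
have := congr1 (fun z : int => z%:~R : R) (between_alternating rank eul xy).
rewrite ys rmorph_sum rmorphN rmorphD rmorph1 rmorphXn rmorphN1 /= => e.
under eq_bigr => j _ do rewrite natrM mulrA.
rewrite -mulr_suml -mulrDl.
have -> : \sum_((rho x).+1 <= i < s) (-1) ^+ (i - rho x) * (between rho x y i)%:R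
          = - (1 + (-1) ^+ (s - rho x)) :> R.
  rewrite -e; apply: eq_bigr => j _.
  by rewrite rmorphM rmorphXn rmorphN1 /= natz -pmulrn.
by rewrite addNr mul0r.
Qed.

Lemma gds0 (pre l : seq nat) : ev flagsP (gds top pre l) = 0.
Proof.
rewrite /ev /gds -cats1 big_cat big_seq1 big_map /=.
rewrite -[RHS](gds_from \bot%O pre l) (proj1 rank) /index_iota.
rewrite zrD zr_sgZ zr1 /flagsP /ch rcons_cat; congr (_ + _).
by apply: eq_bigr => j _ /=; rewrite zr_sgZ rcons_cat.
Qed.

Lemma chain_to_top (x : P) : (rho x < top)%N -> ch x [:: top] = 1.
Proof.
move=> xt; rewrite chR_cons (bigD1 \top%O) /=.
  rewrite big_pred0 ?addr0 // => y; apply/negP=> /andP[/andP[_ /eqP ry]] /eqP[].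
  by apply: (rank_top_eq rank); rewrite rank_top.
rewrite rank_top eqxx andbT lt_neqAle lex1 andbT.
by apply: contraTneq xt => ->; rewrite rank_top ltnn.
Qed.

Lemma gap_sum (x : P) (t s : nat) (F : P -> R) : (rho x < t < s)%N ->
  (forall y, rho y = s -> 0 <= F y) ->
  2 * (\sum_(y | (x < y)%O && (rho y == s)) F y) <=
  \sum_(z | (x < z)%O && (rho z == t)) \sum_(y | (z < y)%O && (rho y == s)) F y.
Proof.
move=> ts F0; have -> : \sum_(z | (x < z)%O && (rho z == t))
      \sum_(y | (z < y)%O && (rho y == s)) F y =
    \sum_(y | (x < y)%O && (rho y == s)) (between rho x y t)%:R * F y.
  under eq_bigr => z _ do rewrite big_mkcond.
  rewrite exchange_big [RHS]big_mkcond; apply: eq_bigr => y _ /=.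
  rewrite -big_mkcondr /between; case: ifP => [/andP[xy rs]|no].
    rewrite -sum1_card natr_sum mulr_suml; apply: eq_big => [z|z _].
      by rewrite inE rs andbT -andbA [RHS]andbAC andbA.
    by rewrite mul1r.
  rewrite big_pred0 // => z; apply/negP=> /andP[/andP[xz _] /andP[zy ry]].
  by rewrite ry (lt_trans xz zy) in no.
rewrite mulr_sumr; apply: ler_sum => y /andP[xy /eqP ys].
apply: ler_wpM2r; first exact: F0.
rewrite ler_nat; apply: between_ge2 => //.
by rewrite ys.
Qed.

Let evx (x : P) (st : seq (bool * nat)) : R :=
  ev (fun l => ch x (rcons l top)) (unfold_steps st).

Lemma evx_map (x : P) (k : nat) (c : comb) :
  ev (fun l => ch x (rcons l top)) [seq (p.1, k :: p.2) | p <- c] =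
  \sum_(y | (x < y)%O && (rho y == k)) ev (fun l => ch y (rcons l top)) c.
Proof.
rewrite /ev big_map exchange_big /=; apply: eq_bigr => p _.
by rewrite chR_cons mulr_sumr.
Qed.

(** A factor [k - 2] is treated together with the next compulsory rank: by [gap_sum] every chain
    element of that rank has at least two elements of rank [k] below it and above [x], and the
    factors that follow are nonnegative by induction. *)
Lemma expand_ge0 (st : seq (bool * nat)) (x : P) :
  steps_ok (rho x) top st -> 0 <= evx x st.
Proof.
have [n] := ubnP (size st); elim: n st x => // n IH [|[[] k] st] x.
- by rewrite /evx /ev big_seq1 /= zr1 mul1r ler0n.
- rewrite /= ltnS /evx /= evx_map => sz ok.
  by apply: sumr_ge0 => y /andP[_ /eqP yk]; apply: IH; rewrite ?yk.
- have m2 : zr R (-2)%BZ = - 2 by [].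
  rewrite /evx /= ev_cat ev_scale evx_map -/(evx x st) m2 mulNr subr_ge0.
  (* At the end of the list the maximum of the poset plays the part of the compulsory rank. *)
  case: st => [_ /= t_in|[[] s] st //=].
    under eq_bigr do rewrite /ev big_seq1 /= zr1 mul1r chR_cons.
    rewrite /evx /ev big_seq1 /= zr1 mul1r chR_cons.
    by apply: gap_sum => // y _; apply: ler0n.
  rewrite ltnS => sz /andP[t_in ok].
  under eq_bigr do rewrite evx_map.
  have sz' : (size st < n)%N by apply: leq_trans sz.
  rewrite /evx /= evx_map; apply: gap_sum => // y ys.
  by apply: IH; rewrite ?ys.
Qed.

Lemma flags_expand_ge0 (st : seq (bool * nat)) :
  steps_ok 0 top st -> 0 <= ev flagsP (unfold_steps st).
Proof. by move=> ok; apply: (@expand_ge0 st \bot%O); rewrite (proj1 rank). Qed.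

Lemma flags1 (t : nat) : (0 < t < top)%N ->
  flagsP [:: t] = #|[set x | rho x == t]|%:R.
Proof.
case/andP=> t0 tt; rewrite -[LHS]/(ch \bot%O [:: t; top]) chR_cons -sum1_card natr_sum.
apply: eq_big => [x|x /andP[_ /eqP xt]].
  rewrite inE lt0x; have [xt|] := eqVneq (rho x) t; rewrite ?andbF // andbT.
  by apply: contraTneq t0 => x0; rewrite -xt x0 (proj1 rank).
by rewrite chain_to_top ?xt.
Qed.

Lemma flags2 (i k : nat) : (0 < i)%N -> (i < k)%N -> (k < top)%N ->
  flagsP [:: i; k] = #|[set p : P * P |
    [&& (p.1 < p.2)%O, rho p.1 == i & rho p.2 == k]]|%:R.
Proof.
move=> i0 ik kt.
rewrite -[LHS]/(ch \bot%O [:: i; k; top]) chR_cons -sum1_card natr_sum.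
have -> : \sum_(y | (\bot%O < y)%O && (rho y == i)) ch y [:: k; top] =
    \sum_(y : P) \sum_(z : P | (y < z)%O && (rho y == i) && (rho z == k)) 1.
  rewrite big_mkcond; apply: eq_bigr => y _; case: ifP => [/andP[_ yi]|no].
    rewrite chR_cons; apply: eq_big => [z|z /andP[_ /eqP zk]]; first by rewrite yi andbT.
    by rewrite chain_to_top ?zk.
  rewrite big_pred0 // => z; apply/negP=> /andP[/andP[_ yi] _].
  move: no; rewrite yi andbT lt0x => /negbFE /eqP y0.
  by move: i0; rewrite -(eqP yi) y0 (proj1 rank).
rewrite pair_big_dep /=; apply: eq_bigl => p.
by rewrite inE andbA.
Qed.

Lemma typeC_flags (i j k : nat) : (0 < i)%N -> (i < j)%N -> (j < k)%N -> (k < top)%N ->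
  0 <= flagsP [:: i; k] - 2 * flagsP [:: i] - 2 * flagsP [:: k] + 2 * flagsP [:: j].
Proof.
move=> i0 ij jk kt.
have j0 : (0 < j)%N by apply: leq_trans ij.
have k0 : (0 < k)%N by apply: leq_trans jk.
have jt := ltn_trans jk kt; have it := ltn_trans ij jt.
have bt (x : P) : (0 < rho x)%N -> (\bot < x)%O.
  by move=> x0; rewrite lt0x; apply: contraTneq x0 => ->; rewrite (proj1 rank).
have tp (x : P) : (rho x < top)%N -> (x < \top)%O.
  move=> x0; rewrite lt_neqAle lex1 andbT.
  by apply: contraTneq x0 => ->; rewrite rank_top ltnn.
pose J := [set x | rho x == j].
pose A (x : P) := [set y | (\bot < y < x)%O & rho y == i].
pose B (x : P) := [set y | (x < y < \top)%O & rho y == k].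
have UA : \bigcup_(x in J) A x = [set x | rho x == i].
  apply/setP=> x; rewrite inE; apply/bigcupP/eqP => [[y _]|xi].
    by rewrite inE => /andP[_ /eqP].
  have xt : (rho x < top)%N by rewrite xi.
  have [|y /andP[xy _] yj] := rank_between rank (tp x xt) (t := j).
    by rewrite xi rank_top ij.
  by exists y; rewrite !inE ?yj // bt ?xi ?xy ?eqxx.
have UB : \bigcup_(x in J) B x = [set x | rho x == k].
  apply/setP=> x; rewrite inE; apply/bigcupP/eqP => [[y _]|xk].
    by rewrite inE => /andP[_ /eqP].
  have x0 : (0 < rho x)%N by rewrite xk.
  have [|y /andP[_ yx] yj] := rank_between rank (bt x x0) (t := j).
    by rewrite xk (proj1 rank) j0.
  by exists y; rewrite !inE ?yj // yx tp ?xk ?eqxx.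
have UE : \bigcup_(x in J) setX (A x) (B x) = [set p : P * P |
    [&& (p.1 < p.2)%O, rho p.1 == i & rho p.2 == k]].
  apply/setP=> [[x y]]; rewrite inE /=; apply/bigcupP/and3P => [[z _]|[xy /eqP xi /eqP yk]].
    rewrite !inE /= => /andP[/andP[/andP[_ xz] ->] /andP[/andP[zy _] ->]].
    by rewrite (lt_trans xz zy).
  have [|z /andP[xz zy] zj] := rank_between rank xy (t := j).
    by rewrite xi yk ij.
  by exists z; rewrite !inE ?zj // xz zy bt ?tp ?xi ?yk ?eqxx.
have := @bipartite_cover P P P J A B.
rewrite UA UB UE => H.
rewrite !flags1 ?flags2 ?i0 ?j0 ?k0 //; last exact: ltn_trans jk.
suff : (2 * (#|[set x | rho x == i]| + #|[set x | rho x == k]|) <=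
    #|[set p : P * P | [&& (p.1 < p.2)%O, rho p.1 == i & rho p.2 == k]]|
     + 2 * #|J|)%N.
  by rewrite -(ler_nat R) !(natrM, natrD) -/J; lra.
apply: H => [x|x|x y z].
- rewrite inE => /eqP xj; apply: (between_ge2 rank eul).
    by rewrite bt ?xj.
  by rewrite xj (proj1 rank) i0.
- rewrite inE => /eqP xj; apply: (between_ge2 rank eul).
    by rewrite tp ?xj.
  by rewrite xj rank_top jk.
(* Thickness: the interval from [y] to [z] has at least two elements of rank [j], hence one besides
   [x]. *)
rewrite !inE => /eqP xj /andP[/andP[_ yx] /eqP yi] /andP[/andP[xz _] /eqP zk].
have yz := lt_trans yx xz.
have : (2 <= between rho y z j)%N.
  by apply: (between_ge2 rank eul) => //; rewrite yi zk ij.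
rewrite /between (cardsD1 x) inE yx xz xj eqxx /= ltnS => /card_gt0P[w].
rewrite !inE => /and3P[wx /andP[yw wz] wj].
by exists w; rewrite !inE ?wj // wx yw wz yi zk bt ?tp ?yi ?zk ?eqxx.
Qed.

End EulerianFlags.

(** * Skeletons, inequalities and the double description *)

Fixpoint sublists (s : seq nat) : seq (seq nat) :=
  if s is k :: s' then map (cons k) (sublists s') ++ sublists s' else [:: [::]].

Definition sumZ (s : seq Z) : Z := foldr Z.add 0%BZ s.

(** The sets come in decreasing binary order, 6 being the most significant digit. Each relation in
    [pivots] then eliminates its first set in favour of later ones, so one pass of [reduce] in this
    order is enough. *)
Definition S6 : seq (seq nat) := map rev (sublists (rev (iota 1 6))).

Definition inclb (s t : seq nat) : bool := all (mem t) s.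
Definition disj (s t : seq nat) : bool := all (fun k => k \notin t) s.
Definition compl6 (q : seq nat) : seq nat := [seq k <- iota 1 6 | k \notin q].

(* The sets S for which L_S does not vanish on Eulerian posets. *)
Definition E13 : seq (seq nat) := [:: [::]; [:: 1; 2]; [:: 2; 3]; [:: 3; 4];
  [:: 4; 5]; [:: 5; 6]; [:: 1; 2; 3; 4]; [:: 1; 2; 4; 5]; [:: 1; 2; 5; 6];
  [:: 2; 3; 4; 5]; [:: 2; 3; 5; 6]; [:: 3; 4; 5; 6]; [:: 1; 2; 3; 4; 5; 6]].

(* A skeleton is a list of maximal chains without their bounds; an element is
   given by its rank (its position in the chain) and a list of coordinates. For
   each N it describes a poset whose elements, besides the bounds, are triples
   (u, b, p): a node u, a boolean b (the doubling), and p giving a value in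
   [0, N] to each coordinate of u. Elements are comparable when their nodes are
   and they agree on the common coordinates. *)
Definition skeleton := seq (seq (seq nat)).

Definition node := (nat * seq nat)%type.

Definition nlt (sk : skeleton) (u v : node) : bool :=
  (u.1 < v.1 < 8) && has (fun c => let c' := [::] :: rcons c [::] in
    (nth [::] c' u.1 == u.2) && (nth [::] c' v.1 == v.2)) sk.

Definition nodes (sk : skeleton) : seq node :=
  undup ((0, [::]) :: (7, [::]) :: flatten [seq zip (iota 1 6) c | c <- sk]).

Definition ncoords (sk : skeleton) : nat :=
  size (undup (flatten (flatten sk))).

(* The exponents e of the monomials (N + 1)^e in the number of chains of rank set l
   above an element over the node u, up to the factor 2^|l| due to doubling. *)
Fixpoint paths (sk : skeleton) (u : node) (l : seq nat) : seq nat :=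
  if l is s :: l' then
    flatten [seq [seq size [seq k <- v.2 | k \notin u.2] + e | e <- paths sk v l']
            | v <- nodes sk & nlt sk u v && (v.1 == s)]
  else [:: 0].

(* The leading coefficient: the value at l of the limit of normalized flag
   vectors. *)
Definition half_count (sk : skeleton) (l : seq nat) : nat :=
  count_mem (ncoords sk) (paths sk (0, [::]) l).

(* The condition on coordinates makes agreement on common ones transitive. *)
Definition convex (sk : skeleton) : bool :=
  all (fun v => all (fun u => nlt sk u v ==> all (fun w => nlt sk v w ==>
    (nlt sk u w && all (fun k => (k \in w.2) ==> (k \in v.2)) u.2))
    (nodes sk)) (nodes sk)) (nodes sk).

Definition graded (sk : skeleton) : bool :=
  all (fun u => all (fun v => nlt sk u v && (u.1.+1 < v.1) ==>
    has (fun w => nlt sk u w && nlt sk w v) (nodes sk)) (nodes sk)) (nodes sk).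

Definition mid (sk : skeleton) (u v : node) : seq (nat * Z) :=
  [seq (size [seq k <- w.2 | (k \notin u.2) && (k \notin v.2)], sgZ (w.1 - u.1))
  | w <- nodes sk & nlt sk u w && nlt sk w v].

(* Euler's relation on all intervals, as an identity between polynomials in the
   number of values of a coordinate; the factor 2 comes from doubling. *)
Definition half_eulerian (sk : skeleton) : bool :=
  all (fun u => all (fun v => nlt sk u v ==>
    (let m := mid sk u v in
    all (fun e => Z.eqb (Z.mul 2 (sumZ [seq p.2 | p <- m & p.1 == e]))
                        (if e == 0%N then - (1 + sgZ (v.1 - u.1)) else 0)%BZ) (iota 0 (ncoords sk).+1)))
    (nodes sk)) (nodes sk).

Definition itv_chain (Is : seq (nat * nat)) : seq (seq nat) :=
  [seq [seq k <- iota 0 (size Is) | (nth (0,0) Is k).1 <= m <= (nth (0,0) Is k).2]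
  | m <- iota 1 6].

Definition even_itvs : seq (nat * nat) :=
  [:: (1,2); (2,3); (3,4); (4,5); (5,6); (1,4); (2,5); (3,6); (1,6)].

Definition itv_compat (I J : nat * nat) : bool :=
  [&& ~~ ((I.1 <= J.1) && (J.2 <= I.2)), ~~ ((J.1 <= I.1) && (I.2 <= J.2)) &
      ~~ odd ((minn I.2 J.2).+1 - maxn I.1 J.1)].

Fixpoint systems (s : seq (nat * nat)) : seq (seq (nat * nat)) :=
  if s is J :: s' then
    let r := systems s' in [seq J :: Js | Js <- r & all (itv_compat J) Js] ++ r
  else [:: [::]].

(** The order of coordinates inside a node serves as a label: at rank 3, [[:: 2; 1; 0]] and
    [[:: 0; 1; 2]] are two different nodes with the same coordinates. *)
Definition extra1 : skeleton :=
  [:: [:: [:: 0]; [:: 0; 1; 2; 3]; [:: 1; 2; 3]; [:: 1; 2; 3]; [:: 3]; [:: 3]];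
      [:: [:: 0]; [:: 0; 1]; [:: 0; 1; 2]; [:: 0; 2]; [:: 3]; [:: 3]];
      [:: [:: 0]; [:: 0; 1]; [:: 0; 1]; [:: 0]; [:: 3]; [:: 3]];
      [:: [:: 0]; [:: 0]; [:: 0; 2]; [:: 0; 2]; [:: 3]; [:: 3]];
      [:: [:: 0]; [:: 0]; [:: 0]; [:: 0]; [:: 3]; [:: 3]];
      [:: [:: 0]; [:: 0; 1; 2]; [:: 2; 1; 0]; [:: 0; 1; 2]; [:: 0; 1; 2; 3]; [:: 3]]].
Definition extra2 : skeleton :=
  [:: [:: [:: 0]; [:: 0; 1; 2]; [:: 1; 2]; [:: 1; 2]; [:: 2]; [:: 2]];
      [:: [:: 0]; [:: 0]; [:: 0; 1]; [:: 1; 2]; [:: 2]; [:: 2]];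
      [:: [:: 0]; [:: 0]; [:: 0; 1]; [:: 0; 1]; [:: 0; 1; 2]; [:: 2]]].
Definition extra3 : skeleton :=
  [:: [:: [:: 0]; [:: 0; 1]; [:: 1]; [:: 1]; [:: 1]; [:: 1]];
      [:: [:: 0]; [:: 0]; [:: 0]; [:: 0]; [:: 0; 1]; [:: 1]]].

(** Reversing the chains gives the dual poset. [extra2] and [extra3] are self-dual up to renaming
    coordinates, so only [extra1] brings a second ray by duality. *)
Definition skeletons : seq skeleton :=
  [seq [:: itv_chain Is] | Is <- systems even_itvs]
  ++ [:: extra1; map rev extra1; extra2; extra3].

(* The linear form of type (B) given by (T, V), and a quarter of the one of type
   (C) given by (i, j, k). *)
Inductive ineq := FB of seq nat & seq nat | FC of nat & nat & nat.

Definition lam (f : ineq) (q : seq nat) : Z :=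
  match f with
  | FB T V => if inclb T q && inclb q V then sgZ (size T) else 0%BZ
  | FC i j k => let d l := if disj l q then 1%BZ else 0%BZ in
     (d [:: i; k] - d [:: i] - d [:: k] + d [:: j])%BZ
  end.

(* The order keeps the intermediate cones of the double description small. *)
Definition ineqs : seq ineq := [::
 FC 1 3 6; FB [:: 5] [:: 1; 2; 3; 4; 5]; FB [:: 1] [:: 1; 2; 3; 4; 5];
 FC 2 4 5; FC 1 4 6; FB [:: 1] [:: 1; 2; 4; 5; 6]; FB [:: 2] [:: 2; 3; 4; 5; 6];
 FB [:: 5] [:: 1; 2; 3; 5; 6]; FB [:: 4] [:: 1; 2; 3; 4; 5; 6];
 FB [:: 2] [:: 2; 3; 5; 6]; FB [:: 4] [:: 1; 2; 3; 4];
 FB [:: 1; 5] [:: 1; 2; 5; 6]; FB [:: 6] [:: 2; 3; 4; 5; 6];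
 FB [:: 1; 4] [:: 1; 2; 4; 5]; FB [:: 3] [:: 3; 4; 5; 6];
 FB [:: 6] [:: 1; 2; 3; 4; 5; 6]; FB [:: 4] [:: 1; 2; 4; 5]; FB [:: 3] [:: 3; 4];
 FB [::] [:: 1; 2; 3; 4; 5; 6]; FC 2 3 5; FB [:: 3] [:: 1; 2; 3; 4; 5; 6];
 FB [:: 1] [:: 1; 2; 3; 4; 5; 6]; FB [:: 2; 5] [:: 2; 3; 5; 6]].

Definition zdot (l x : seq Z) : Z := sumZ [seq p.1 * p.2 | p <- zip l x]%BZ.

Definition phis : seq (seq Z) := [seq [seq lam f q | q <- E13] | f <- ineqs].

Definition LLof (g : seq nat -> nat) (q : seq nat) : Z :=
  sumZ [seq sgZ (6 - size q + size t) * Z.of_nat (g t) | t <- S6 & inclb (compl6 q) t]%BZ.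

(* The flag L-vectors of the skeletons, tabulated to share the counts. *)
Definition LLtab : seq (seq Z) :=
  [seq (let tab := [seq (t, half_count sk t) | t <- S6] in
     let g t := nth 0 (unzip2 tab) (index t (unzip1 tab)) in [seq LLof g q | q <- S6]) | sk <- skeletons].

Definition lcomb (a b : Z) (x y : seq Z) : seq Z := [seq a * p.1 + b * p.2 | p <- zip x y]%BZ.

(* The pair (B, G) represents the cone spanned by G and the lines through B; the
   half-space where l is nonnegative is intersected with it. *)
Definition dd_step (l : seq Z) (BG : seq (seq Z) * seq (seq Z)) : seq (seq Z) * seq (seq Z) :=
  let: (B, G) := BG in
  let k := find (fun b => ~~ Z.eqb (zdot l b) 0) B in
  if k < size B then
    let b0 := nth [::] B k in
    let b := if Z.ltb (zdot l b0) 0 then map Z.opp b0 else b0 in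
    let lb := zdot l b in
    let pr g := lcomb lb (- zdot l g) g b in
    (map pr (take k B ++ drop k.+1 B), b :: map pr G)
  else
    let pos := [seq g <- G | Z.ltb 0 (zdot l g)] in
    let neg := [seq g <- G | Z.ltb (zdot l g) 0] in
    (B, [seq g <- G | Z.leb 0 (zdot l g)] ++
        [seq lcomb (zdot l p) (- zdot l q) q p | p <- pos, q <- neg]).

Definition unit_vecs : seq (seq Z) :=
  [seq [seq if i == j then 1%BZ else 0%BZ | j <- iota 0 13] | i <- iota 0 13].

Definition ddr := foldl (fun BG l => dd_step l BG) (unit_vecs, [::]) phis.

Definition gens13 (LL : seq (seq Z)) : seq (seq Z) :=
  [seq [seq nth 0%BZ L (index q S6) | q <- E13] | L <- LL].

Definition Zeq0 (z : Z) := Z.eqb z 0.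

(* Writes cur as a combination of gens, subtracting at each step the largest
   multiple of some generator that stays in the cone; the coefficients are
   cs / d. Only the result is checked, in [in_cone]. *)
Fixpoint greedy (gens : seq (seq Z)) (sl : seq (seq Z)) (fuel : nat) (cur : seq Z) (d : Z) (cs : seq Z) : Z * seq Z :=
  if fuel is f.+1 then
    if all Zeq0 cur then (d, cs) else
    let sc := [seq zdot l cur | l <- phis] in
    let j := find (fun s => all (fun p => Zeq0 p.1 ==> Zeq0 p.2) (zip sc s)) sl in
    let nm := foldr (fun p b => if Z.ltb 0 p.2 then
                 if Zeq0 b.2 || Z.ltb (p.1 * b.2) (b.1 * p.2) then p else b else b)
                 (0%BZ, 0%BZ) (zip sc (nth [::] sl j)) in
    greedy gens sl f (lcomb nm.2 (- nm.1) cur (nth [::] gens j)) (nm.2 * d)%BZ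
      [seq (nm.2 * p.1 + (if p.2 == j then nm.1 else 0))%BZ | p <- zip cs (iota 0 (size cs))]
  else (d, cs).

(** Each greedy step makes a further inequality tight and so moves to a smaller face; in dimension
    13, fuel 14 is enough. *)
Definition in_cone (gens sl : seq (seq Z)) (u : seq Z) : bool :=
  let: (d, cs) := greedy gens sl 14 u 1%BZ (nseq (size gens) 0%BZ) in
  [&& Z.ltb 0 d, all (Z.leb 0) cs &
     all Zeq0 (foldr (fun p acc => lcomb (- p.1) 1 p.2 acc) (map (Z.mul d) u) (zip cs gens))].

(** This is [2 ^ 6] times the form [L_q], a multiple with integral coefficients. *)
Definition Lcomb (q : seq nat) : comb :=
  [seq ((sgZ (6 - size q + size t) * 2 ^ Z.of_nat (6 - size t))%BZ, t)
  | t <- S6 & inclb (compl6 q) t].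

Definition coefs (c : comb) : seq Z := [seq coef c l | l <- S6].

(* For each t that contains some b together with b + 1, or that contains 6, a
   relation [gds] that eliminates t. *)
Definition pivots : seq (nat * Z * seq Z) :=
  flatten [seq (let b := find (fun b => (b \in t) && ((b.+1 \in t) || (b == 6))) (iota 0 7) in
    if b < 7 then
    let pre := [seq k <- t | k < b] in let l := [seq k <- t | b < k] in
    [:: (index t S6, sgZ (b - last 0 pre), coefs (gds 7 pre l))] else [::]) | t <- S6].

Definition reduce (v : seq Z) : seq Z :=
  foldl (fun v p => let k := nth 0%BZ v p.1.1 in
     if Zeq0 k then v else lcomb 1 (- (k * p.1.2)) v p.2) v pivots.

(** The sets without pivot are those that contain neither 6 nor two consecutive ranks; there are 13
    of them, as many as in [E13]. A zero normal form shows that [L_q = 0] follows from the relations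
    [gds]. *)
Definition gds_ok : bool :=
  all (fun q => (q \in E13) || all Zeq0 (reduce (coefs (Lcomb q)))) S6.

(** * The posets of a skeleton *)

Section StrictPoset.
Variables (T : finType) (lt : rel T) (irr : irreflexive lt) (tr : transitive lt)
  (b t : T) (hb : forall x, (b == x) || lt b x) (ht : forall x, (x == t) || lt x t).

(** The proofs are made arguments of the type so that the instances declared on it can recover
    them. *)
Definition strict_poset : Type :=
  let _ := irr in let _ := tr in let _ := hb in let _ := ht in T.

HB.instance Definition _ := Finite.on strict_poset.
HB.instance Definition _ :=
  @Order.Lt_isPOrder.Build (Order.Disp tt tt) strict_poset lt irr tr.
HB.instance Definition _ :=
  @Order.hasBottom.Build (Order.Disp tt tt) strict_poset b hb.
HB.instance Definition _ :=
  @Order.hasTop.Build (Order.Disp tt tt) strict_poset t ht.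

Definition strict_finTB : finTBPOrderType (Order.Disp tt tt) := strict_poset.

End StrictPoset.

(** Induction on the size of the open interval: the recursion for the Möbius function only involves
    elements where its value is already known to be the sign. *)
Lemma Eulerian_of_open (d : Order.disp_t) (P : finTBPOrderType d) (rho : P -> nat) :
  (forall x y : P, (x < y)%O ->
     (\sum_(z | (x < z < y)%O) (-1) ^+ (rho z - rho x) =
      - (1 + (-1) ^+ (rho y - rho x)) :> int)%R) ->
  is_Eulerian rho.
Proof.
move=> H x y; have [n] := ubnP #|[set z | (x < z < y)%O]|.
elim: n y => // n IH y; rewrite ltnS => c; rewrite le_eqVlt => /predU1P[<-|xy].
  by rewrite mobius_refl subnn expr0.
rewrite mobius_lt // (bigD1 x) /= ?lexx ?xy // mobius_refl.
have -> : (\sum_(z | (x <= z < y)%O && (z != x)) mobius x z =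
    \sum_(z | (x < z < y)%O) (-1) ^+ (rho z - rho x))%R.
  apply: eq_big => [z|z /andP[/andP[xz zy] zx]].
    by rewrite [(x < z)%O]lt_neqAle [x == z]eq_sym; case: (z == x); rewrite ?andbF ?andbT.
  have xz' : (x < z)%O by rewrite lt_neqAle eq_sym zx.
  apply: IH => //; apply: leq_trans c.
  by apply: (proj1 (@open_sub _ _ x z y _)); rewrite xz'.
by rewrite H // opprD opprK addrA addNr add0r.
Qed.

Lemma card_seq_ord (k : nat) (s : seq nat) (Q : pred nat) : uniq s ->
  all (fun i => i < k) s ->
  #|[pred i : 'I_k | (val i \in s) && Q (val i)]| = size [seq i <- s | Q i].
Proof.
move=> us sk; rewrite cardE -(size_map val); apply: perm_size; apply: uniq_perm.
- by rewrite map_inj_uniq ?enum_uniq //; apply: val_inj.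
- exact: filter_uniq.
move=> i; rewrite mem_filter; apply/mapP/andP => [[j]|[Qi si]].
  by rewrite mem_enum inE => /andP[sj Qj] ->.
have ik := allP sk i si; exists (Ordinal ik) => //.
by rewrite mem_enum inE /= si Qi.
Qed.

(** [K] stands for the coordinates of a node, outside which values are normalized to 0, and [C] for
    the coordinates whose value [c] is imposed by comparable elements. Only those in [K] and not in
    [C] are free. *)
Lemma card_partial (k M : nat) (K C : pred 'I_k) (c : 'I_k -> 'I_M.+1) :
  #|[pred p : {ffun 'I_k -> 'I_M.+1} | [forall i,
      (K i || (p i == ord0)) && (K i && C i ==> (p i == c i))]]| =
  M.+1 ^ #|[pred i | K i && ~~ C i]|.
Proof.
pose F (i : 'I_k) : pred 'I_M.+1 := fun y =>
  (K i || (y == ord0)) && (K i && C i ==> (y == c i)).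
have -> : #|[pred p : {ffun 'I_k -> 'I_M.+1} | [forall i,
      (K i || (p i == ord0)) && (K i && C i ==> (p i == c i))]]| = #|family F|.
  by apply: eq_card.
rewrite card_family foldrE big_map big_enum /=.
rewrite -prod_nat_const [RHS]big_mkcond; apply: eq_bigr => i _; rewrite inE.
case Ki : (K i) => /=; last first.
  rewrite -(card1 (ord0 : 'I_M.+1)); apply: eq_card => y.
  by rewrite [LHS]unfold_in /F Ki inE andbT.
case Ci : (C i) => /=.
  rewrite -(card1 (c i)); apply: eq_card => y.
  by rewrite [LHS]unfold_in /F Ki Ci !inE ?andbT ?eqxx.
rewrite -[RHS](card_ord M.+1); apply: eq_card => y.
by rewrite [LHS]unfold_in /F Ki Ci !inE ?andbT ?eqxx.
Qed.

Definition wf_skeleton (sk : skeleton) : bool :=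
  all (fun u : node => [&& u.1 < 8, uniq u.2, all (fun i => i < ncoords sk) u.2,
    (u == (0, [::])) || nlt sk (0, [::]) u & (u == (7, [::])) || nlt sk u (7, [::])])
  (nodes sk).

Definition good_skeleton (sk : skeleton) : bool :=
  [&& wf_skeleton sk, convex sk, graded sk & half_eulerian sk].

Section SkeletonPoset.
Variables (sk : skeleton) (good : good_skeleton sk) (N : nat).
Let k := ncoords sk.
Let ns := nodes sk.

Definition proper_node (u : node) : bool := 0 < u.1 < 7.

Definition pre_elt : finType := (seq_sub ns * bool * {ffun 'I_k -> 'I_N.+1})%type.

Definition pnode (x : pre_elt) : node := val x.1.1.

(** A normal form that gives each element one representative: the bounds are not doubled, and
    coordinates foreign to the node take the value 0. *)
Definition valid (x : pre_elt) : bool :=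
  (proper_node (pnode x) || ~~ x.1.2) &&
  [forall i : 'I_k, (val i \in (pnode x).2) || (x.2 i == ord0)].

Definition elt : finType := {x : pre_elt | valid x}.

Definition agree (x y : pre_elt) : bool :=
  [forall i : 'I_k, (val i \in (pnode x).2) && (val i \in (pnode y).2) ==>
     (x.2 i == y.2 i)].

Definition elt_lt (x y : elt) : bool :=
  nlt sk (pnode (val x)) (pnode (val y)) && agree (val x) (val y).

Definition elt_rank (x : elt) : nat := (pnode (val x)).1.

Lemma pnodeP (x : pre_elt) : pnode x \in ns. Proof. exact: valP. Qed.

Lemma nlt_rank u v : nlt sk u v -> u.1 < v.1.
Proof. by case/andP=> /andP[]. Qed.

Lemma elt_lt_irr : irreflexive elt_lt.
Proof. by move=> x; apply/negP=> /andP[/nlt_rank]; rewrite ltnn. Qed.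

Lemma nodeP u : u \in ns -> [&& u.1 < 8, uniq u.2, all (fun i => i < k) u.2,
    (u == (0, [::])) || nlt sk (0, [::]) u & (u == (7, [::])) || nlt sk u (7, [::])].
Proof. by case/and4P: good => /allP H _ _ _ /H. Qed.

Lemma nlt_trans u v w : u \in ns -> v \in ns -> w \in ns ->
  nlt sk u v -> nlt sk v w ->
  nlt sk u w /\ (forall i, i \in u.2 -> i \in w.2 -> i \in v.2).
Proof.
move=> un vn wn uv vw; case/and4P: good => _ /allP/(_ v vn)/allP/(_ u un) + _ _.
rewrite uv /= => /allP/(_ w wn); rewrite vw /= => /andP[-> /allP H]; split=> // i iu iw.
by have := H i iu; rewrite iw.
Qed.

Lemma elt_lt_trans : transitive elt_lt.
Proof.
move=> y x z /andP[xy /forallP axy] /andP[yz /forallP ayz].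
have [xz conv] := nlt_trans (pnodeP _) (pnodeP _) (pnodeP _) xy yz.
rewrite /elt_lt xz; apply/forallP=> i; apply/implyP=> /andP[ix iz].
have iy := conv _ ix iz.
have /implyP/(_ _)/eqP -> := axy i; last by rewrite ix.
by have /implyP/(_ _)/eqP -> := ayz i; rewrite ?iy.
Qed.

Lemma bot_in : (0, [::]) \in ns.
Proof. by rewrite mem_undup inE. Qed.

Lemma top_in : (7, [::]) \in ns.
Proof. by rewrite mem_undup !inE eqxx orbT. Qed.

Definition const_elt (u : seq_sub ns) : pre_elt := (u, false, [ffun=> ord0]).

Lemma const_valid u : valid (const_elt u).
Proof. by rewrite /valid orbT; apply/forallP=> i; rewrite ffunE eqxx orbT. Qed.

Definition elt_bot : elt := exist _ (const_elt (SeqSub bot_in)) (const_valid _).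
Definition elt_top : elt := exist _ (const_elt (SeqSub top_in)) (const_valid _).

Lemma elt_const (x : elt) (u : node) (un : u \in ns) :
  ~~ proper_node u -> u.2 = [::] -> pnode (val x) = u ->
  x = exist _ (const_elt (SeqSub un)) (const_valid _).
Proof.
move=> pu u2 xu; apply: val_inj => /=.
case: x xu => [[[v c] p] vx] /= vu; have := vx.
rewrite /valid vu (negPf pu) u2 /= => /andP[/negPf -> /forallP p0].
rewrite /const_elt; congr (_, _, _); first exact: val_inj.
by apply/ffunP=> i; rewrite ffunE; apply/eqP; apply: p0.
Qed.

Lemma elt_hb x : (elt_bot == x) || elt_lt elt_bot x.
Proof.
have /and5P[_ _ _ + _] := nodeP (pnodeP (val x)); case/orP => [/eqP xb|bx].
  by rewrite /elt_bot -(elt_const bot_in _ _ xb) ?eqxx.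
by apply/orP; right; rewrite /elt_lt bx; apply/forallP=> i.
Qed.

Lemma elt_ht x : (x == elt_top) || elt_lt x elt_top.
Proof.
have /and5P[_ _ _ _] := nodeP (pnodeP (val x)); case/orP => [/eqP xt|tx].
  by rewrite /elt_top -(elt_const top_in _ _ xt) ?eqxx.
apply/orP; right; rewrite /elt_lt tx; apply/forallP=> i.
by rewrite andbF.
Qed.

Definition skeleton_poset : finTBPOrderType (Order.Disp tt tt) :=
  strict_finTB elt_lt_irr elt_lt_trans elt_hb elt_ht.

Lemma card_node_elts (w : node) (C : pred 'I_k) (c : 'I_k -> 'I_N.+1) : w \in ns ->
  #|[pred z : elt | (pnode (val z) == w) &&
      [forall i, (val i \in w.2) && C i ==> ((val z).2 i == c i)]]| =
  (proper_node w).+1 * N.+1 ^ #|[pred i : 'I_k | (val i \in w.2) && ~~ C i]|.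
Proof.
move=> wn.
pose A (x : pre_elt) := (pnode x == w) &&
  [forall i, (val i \in w.2) && C i ==> (x.2 i == c i)].
have -> : #|[pred z : elt | A (val z)]| = #|[pred x : pre_elt | valid x && A x]|.
  rewrite -(card_image (f := val)) //; last exact: val_inj.
  apply: eq_card => x; rewrite inE; apply/imageP/andP => [[z + ->]|[vx Ax]].
    by rewrite inE; split=> //; apply: valP.
  by exists (exist _ x vx).
rewrite -sum1_card big_mkcond /= -(pair_bigA _ (fun vc p =>
  if (vc, p) \in [pred x | valid x && A x] then 1 else 0)) /=.
rewrite -(pair_bigA _ (fun v b => \sum_p
  if ((v, b), p) \in [pred x | valid x && A x] then 1 else 0)) /=.
rewrite (bigD1 (SeqSub wn)) //= [X in _ + X]big1 ?addn0; last first.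
  move=> v vw; rewrite big1 // => b _; rewrite big1 // => p _.
  rewrite inE /A /pnode /=; case: ifP => // /andP[_ /andP[/eqP e _]].
  by case/eqP: vw; apply: val_inj.
rewrite -(card_partial (fun i : 'I_k => val i \in w.2) C c).
have H b : \sum_p (if ((SeqSub wn, b), p) \in [pred x | valid x && A x] then 1 else 0) =
    (proper_node w || ~~ b) * #|[pred p : {ffun 'I_k -> 'I_N.+1} | [forall i,
      ((val i \in w.2) || (p i == ord0)) && ((val i \in w.2) && C i ==> (p i == c i))]]|.
  rewrite -sum1_card big_distrr /= [RHS]big_mkcond; apply: eq_bigr => p _.
  rewrite !inE /valid /A /pnode /= eqxx /= -andbA.
  have -> : [forall i : 'I_k, (val i \in w.2) || (p i == ord0)] &&
      [forall i, (val i \in w.2) && C i ==> (p i == c i)] =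
      [forall i, ((val i \in w.2) || (p i == ord0)) && ((val i \in w.2) && C i ==> (p i == c i))].
    apply/andP/forallP => [[/forallP p0 /forallP pc] i|pp]; first by rewrite p0 pc.
    by split; apply/forallP=> i; have /andP[] := pp i.
  by case: (_ || _); case: [forall i, _].
rewrite big_bool !H /= orbT orbF mul1n -mulSnr.
by case: (proper_node w).
Qed.

Lemma sum_by_node (R : nmodType) (F : node -> R) (Q : pred elt) :
  (\sum_(z | Q z) F (pnode (val z)) =
   \sum_(w <- ns) F w *+ #|[pred z | Q z && (pnode (val z) == w)]|)%R.
Proof.
rewrite (eq_bigr (fun z => \sum_(w <- ns | pnode (val z) == w) F w)%R); last first.
  move=> z _; rewrite -big_filter (eq_big_seq (fun=> F (pnode (val z)))); last first.
    by move=> w; rewrite mem_filter => /andP[/eqP->].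
  have -> : [seq w <- ns | pnode (val z) == w] = [:: pnode (val z)].
    apply: etrans (filter_pred1_uniq (undup_uniq _) (pnodeP (val z))).
    by apply: eq_filter => w; rewrite /= eq_sym.
  by rewrite big_seq1.
rewrite (exchange_big_dep xpredT) //=; apply: eq_bigr => w _.
by rewrite -sumr_const; apply: eq_bigl => z; rewrite !inE.
Qed.

Lemma card_between (x y : elt) (w : node) : w \in ns -> elt_lt x y ->
  let u := pnode (val x) in let v := pnode (val y) in
  #|[pred z | elt_lt x z && elt_lt z y && (pnode (val z) == w)]| =
  (nlt sk u w && nlt sk w v) *
    (2 * N.+1 ^ size [seq i <- w.2 | (i \notin u.2) && (i \notin v.2)]).
Proof.
move=> wn /andP[uv /forallP axy] u v.
have [/andP[uw wv]|/negPf no] := boolP (nlt sk u w && nlt sk w v); last first.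
  rewrite mul0n; apply: eq_card0 => z; rewrite !inE.
  by apply/negP=> /andP[/andP[/andP[xz _] /andP[zy _]] /eqP zw]; rewrite -zw /u /v xz zy in no.
have pw : proper_node w.
  have := nlt_rank uw; have := nlt_rank wv.
  have /and5P[v8 _ _ _ _] := nodeP (pnodeP (val y)).
  rewrite /proper_node => wv1 uw1; rewrite (leq_ltn_trans _ uw1) //=.
  by rewrite -ltnS; apply: leq_trans v8; rewrite ltnS.
have /and5P[_ uw2 kw2 _ _] := nodeP wn.
rewrite mul1n -(card_seq_ord _ uw2 kw2).
(* A coordinate of [w] shared with [x] or [y] is imposed. If it is shared with both, the two values
   agree because [x] and [y] are comparable. *)
pose C (i : 'I_k) := (val i \in u.2) || (val i \in v.2).
pose c (i : 'I_k) := if val i \in u.2 then (val x).2 i else (val y).2 i.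
have -> : #|[pred i : 'I_k | (val i \in w.2) && ((val i \notin u.2) && (val i \notin v.2))]|
   = #|[pred i : 'I_k | (val i \in w.2) && ~~ C i]|.
  by apply: eq_card => i; rewrite !inE /C negb_or.
have := card_node_elts C c wn; rewrite pw => <-.
apply: eq_card => z; rewrite !inE andbC; case: eqP => //= zw.
rewrite /elt_lt zw -/u -/v uw wv /= /agree zw -/u -/v.
apply/andP/forallP => [[/forallP xz /forallP zy] i|H].
  apply/implyP=> /andP[iw]; rewrite /C /c; case: ifP => iu /= iv.
    by have := xz i; rewrite iu iw /= eq_sym.
  by have := zy i; rewrite iv iw.
split; apply/forallP=> i; apply/implyP=> /andP[i1 i2].
  by have := H i; rewrite /C /c i1 i2 /= eq_sym.
have := H i; rewrite /C /c i1 i2 orbT /=; case: ifP => // iu /eqP->.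
by have := axy i; rewrite -/u -/v iu i2.
Qed.

Lemma card_above (x : elt) (w : node) (s : nat) : w \in ns ->
  let u := pnode (val x) in
  #|[pred z | elt_lt x z && (elt_rank z == s) && (pnode (val z) == w)]| =
  (nlt sk u w && (w.1 == s)) *
    ((proper_node w).+1 * N.+1 ^ size [seq i <- w.2 | i \notin u.2]).
Proof.
move=> wn u.
have [/andP[uw ws]|/negPf no] := boolP (nlt sk u w && (w.1 == s)); last first.
  rewrite mul0n; apply: eq_card0 => z; rewrite !inE /elt_rank.
  by apply/negP=> /andP[/andP[/andP[xz _] zs] /eqP zw]; rewrite -zw /u xz zs in no.
have /and5P[_ uw2 kw2 _ _] := nodeP wn.
rewrite mul1n -(card_seq_ord _ uw2 kw2).
pose C (i : 'I_k) := val i \in u.2.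
rewrite -(card_node_elts C (fun i => (val x).2 i) wn).
apply: eq_card => z; rewrite !inE andbC; case: eqP => //= zw.
rewrite /elt_lt /elt_rank zw -/u uw ws /= andbT /agree zw -/u.
by apply: eq_forallb => i; rewrite /C andbC eq_sym.
Qed.

End SkeletonPoset.

Lemma chains0_bot (d : Order.disp_t) (P : finTBPOrderType d) (rho : P -> nat)
    (l : seq nat) : rho \bot%O = 0 -> 0 \notin l ->
  chains0 (fun x y : P => (x < y)%O) rho l =
  chains (fun x y : P => (x < y)%O) rho \bot%O l.
Proof.
case: l => //= s l r0; rewrite inE negb_or eq_sym => /andP[s0 _].
apply: eq_bigl => y; rewrite lt0x.
have [ys|] := eqVneq (rho y) s; last by rewrite andbF.
by have [y0|] := eqVneq y \bot%O; rewrite // -ys y0 r0 eqxx in s0.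
Qed.

Lemma sum_by_exponent (m M : nat) (s : seq (nat * Z)) :
  all (fun p => p.1 < m) s ->
  (\sum_(p <- s) zr int p.2 * M%:R ^+ p.1 =
   \sum_(e < m) zr int (sumZ [seq p.2 | p <- s & p.1 == val e]) * M%:R ^+ e)%R.
Proof.
move=> sm; under [RHS]eq_bigr => e _ do
  rewrite /sumZ zr_sum big_filter mulr_suml big_mkcond /=.
rewrite exchange_big /=; apply: eq_big_seq => p ps.
have pm := allP sm p ps.
rewrite (bigD1 (Ordinal pm)) //= eqxx big1 ?addr0 // => e ne.
by rewrite ifN //; apply: contraNneq ne => e'; apply/eqP/val_inj.
Qed.

Section SkeletonEulerian.
Variables (sk : skeleton) (good : good_skeleton sk) (N : nat).
Local Notation P := (skeleton_poset good N).
Local Notation rho := (@elt_rank sk N : P -> nat).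
Local Notation nd x := (pnode (val (x : elt sk N))).

Lemma skel_ltE (x y : P) : (x < y)%O = elt_lt (x : elt sk N) y.
Proof. by []. Qed.

Lemma skel_exists_between (x y : P) : (x < y)%O -> (rho x).+1 < rho y ->
  exists z : P, (x < z < y)%O.
Proof.
rewrite skel_ltE => xy r; have /andP[uv _] := xy.
case/and4P: (good) => _ _ /allP/(_ _ (pnodeP (val (x : elt sk N)))).
move=> /allP/(_ _ (pnodeP (val (y : elt sk N)))); rewrite uv r /= => /hasP[w wn wb] _.
have := @card_between sk good N x y w wn xy; rewrite /= wb mul1n.
have [z|e] := pickP [pred z | elt_lt (x : elt sk N) z && elt_lt z y && (pnode (val z) == w)].
  by rewrite inE => /andP[xzy _] _; exists z.
by rewrite eq_card0 // => /esym/eqP; rewrite muln_eq0 expn_eq0.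
Qed.

Lemma skel_rank : is_rank_function rho.
Proof.
split=> // x y xy no; apply/eqP; rewrite eqn_leq.
have -> : rho x < rho y by move: xy; rewrite skel_ltE => /andP[/nlt_rank].
rewrite andbT leqNgt; apply/negP=> r.
by have [z] := skel_exists_between xy r; apply/negP; apply: no.
Qed.

Lemma skel_Eulerian : is_Eulerian rho.
Proof.
apply: Eulerian_of_open => x y; rewrite skel_ltE => xy.
set u := nd x; set v := nd y.
pose F (w : node) : int := ((-1) ^+ (w.1 - u.1))%R.
rewrite (eq_bigr (fun z : elt sk N => F (pnode (val z)))) //.
rewrite (sum_by_node F (fun z => elt_lt (x : elt sk N) z && elt_lt z y)) /=.
rewrite big_seq (eq_bigr (fun w => if nlt sk u w && nlt sk w v then
   zr int (sgZ (w.1 - u.1)) * (2 * N.+1%:R ^+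
     size [seq i <- w.2 | (i \notin u.2) && (i \notin v.2)]) else 0)%R); last first.
  move=> w wn; rewrite card_between // -/u -/v; case: ifP => _; last by rewrite mul0n mulr0n.
  by rewrite mul1n zr_sgZ -[LHS]mulr_natr natrM natrX.
rewrite -big_seq -big_mkcond -big_filter /=.
have -> : (\sum_(w <- [seq w <- nodes sk | nlt sk u w && nlt sk w v])
    zr int (sgZ (w.1 - u.1)) * (2 * N.+1%:R ^+
     size [seq i <- w.2 | (i \notin u.2) && (i \notin v.2)]) =
   2 * \sum_(p <- mid sk u v) zr int p.2 * N.+1%:R ^+ p.1)%R.
  rewrite /mid big_map mulr_sumr; apply: eq_bigr => w _ /=.
  by rewrite mulrCA.
have /and4P[_ _ _ /allP/(_ _ (pnodeP (val (x : elt sk N))))] := good.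
move=> /allP/(_ _ (pnodeP (val (y : elt sk N)))); have /andP[uv _] := xy.
rewrite uv implyTb -/u -/v => /allP he.
rewrite (@sum_by_exponent (ncoords sk).+1); last first.
  apply/allP=> p /mapP[w]; rewrite mem_filter => /andP[_ wn] -> /=.
  have /and5P[_ uw kw _ _] := nodeP good wn.
  rewrite ltnS -(card_seq_ord _ uw kw).
  by apply: leq_trans (max_card _) _; rewrite card_ord.
(* Euler's relation is a polynomial identity in [N + 1], known coefficient by coefficient from
   [half_eulerian]; all coefficients of positive exponent vanish. *)
have {}he e : e < (ncoords sk).+1 -> (2 * zr int (sumZ [seq p.2 | p <- mid sk u v & p.1 == e]) =
   if e == 0 then - (1 + (-1) ^+ (v.1 - u.1)) else 0)%R.
  move=> ek; have := he e; rewrite mem_iota add0n ek => /(_ isT) /Z.eqb_eq.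
  move/(congr1 (zr int)); rewrite zrM => -> ; case: eqP => // _.
  by rewrite zrN zrD zr_sgZ.
rewrite big_ord_recl mulrDr big1 ?addr0; last first.
  move=> e _; apply/eqP; have := he (lift ord0 e) (ltn_ord _).
  by move/eqP; rewrite mulf_eq0 /= => /eqP ->; rewrite mul0r.
by rewrite /= expr0 mulr1 he.
Qed.

Lemma skel_chains (x : P) (l : seq nat) : all (fun s => 0 < s < 7) l ->
  chains (fun x y : P => (x < y)%O) rho x l =
  2 ^ size l * \sum_(e <- paths sk (nd x) l) N.+1 ^ e.
Proof.
elim: l x => [|s l IH] x; first by rewrite /= big_seq1.
case/andP=> s7 l7 /=.
rewrite (eq_bigr (fun y : elt sk N => 2 ^ size l * \sum_(e <- paths sk (pnode (val y)) l) N.+1 ^ e));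
  last by move=> y _; apply: IH.
rewrite (sum_by_node (fun w => 2 ^ size l * \sum_(e <- paths sk w l) N.+1 ^ e)
  (fun y => elt_lt (x : elt sk N) y && (elt_rank y == s))).
rewrite big_flatten big_map big_filter big_distrr [RHS]big_mkcond /=.
rewrite big_seq [RHS]big_seq; apply: eq_bigr => w wn.
rewrite (@card_above sk good N x w s wn).
case: ifP => [/andP[_ /eqP ws]|_]; last by rewrite mul0n.
rewrite mul1n big_map /proper_node ws s7.
under [in RHS]eq_bigr => e _ do rewrite expnD.
rewrite -big_distrr /= expnS; move: (\sum_(e <- _) _) => t.
rewrite -mulr_natr natn; lia.
Qed.

Lemma skel_flag_number (S : {set 'I_6}) :
  flag_number (fun x y : P => (x < y)%O) rho S =
  2 ^ #|S| * \sum_(e <- paths sk (0, [::]) (ranks S)) N.+1 ^ e.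
Proof.
rewrite flag_numberE; last by move=> x y; rewrite skel_ltE => /andP[/nlt_rank].
have rS : all (fun s => 0 < s < 7) (ranks S).
  by apply/allP=> s /mapP[i _ ->]; rewrite /= ltnS ltn_ord.
rewrite chains0_bot //; last by apply/negP=> /(allP rS).
by rewrite skel_chains // size_ranks.
Qed.

End SkeletonEulerian.

Local Open Scope ring_scope.

(** * Soundness of the double description *)

Section Cones.
Variables (R : realFieldType) (V : lmodType R).
Implicit Types (P Q : V -> Prop) (x y : V).

Inductive cone P : V -> Prop :=
| cone0 : cone P 0
| coneD c g x : 0 <= c -> P g -> cone P x -> cone P (c *: g + x).

Lemma cone_gen P g : P g -> cone P g.
Proof.
by move=> Pg; rewrite -[g]addr0 -[g]scale1r; apply: coneD => //; apply: cone0.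
Qed.

Lemma cone_add P x y : cone P x -> cone P y -> cone P (x + y).
Proof.
move=> + Py; elim=> [|c g z c0 Pg _ IH]; first by rewrite add0r.
by rewrite -addrA; apply: coneD.
Qed.

Lemma cone_scale P c x : 0 <= c -> cone P x -> cone P (c *: x).
Proof.
move=> c0; elim=> [|e g z e0 Pg _ IH]; first by rewrite scaler0; apply: cone0.
by rewrite scalerDr scalerA; apply: coneD => //; apply: mulr_ge0.
Qed.

Lemma cone_sub P Q x : (forall g, P g -> cone Q g) -> cone P x -> cone Q x.
Proof.
move=> PQ; elim=> [|c g z c0 Pg _ IH]; first exact: cone0.
by apply: cone_add => //; apply: cone_scale => //; apply: PQ.
Qed.

Lemma cone_sum (m : nat) (F : nat -> V) x :
  cone (fun v => exists2 j, (j < m)%N & v = F j) x ->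
  exists2 c : nat -> R, (forall j, 0 <= c j) & x = \sum_(j < m) c j *: F j.
Proof.
elim=> [|c g z c0 [j jm ->] _ [e e0 ->]].
  by exists (fun=> 0) => //; rewrite big1 // => j _; rewrite scale0r.
exists (fun i => (if i == j then c else 0) + e i) => [i|].
  by apply: addr_ge0 => //; case: ifP.
under [RHS]eq_bigr => i _ do rewrite scalerDl.
rewrite big_split /=; congr (_ + _); rewrite (bigD1 (Ordinal jm)) //= eqxx.
rewrite big1 ?addr0 // => i ij.
by rewrite ifN ?scale0r //; apply: contraNneq ij => ij; apply/eqP/val_inj.
Qed.

Variable l : {scalar V}.

Definition cut P (v : V) : Prop :=
  (P v /\ 0 <= l v) \/
  exists p q, [/\ P p, P q, 0 < l p, l q < 0 & v = l p *: q - l q *: p].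

(** Positive and negative generators are cancelled against each other, at the expense of vectors
    [l p *: q - l q *: p] in the kernel of [l], until a single sign is left; [0 <= l x] then
    excludes the negative one. *)
Lemma cone_cut P x : cone P x -> 0 <= l x -> cone (cut P) x.
Proof.
pose pos v := P v /\ 0 < l v; pose neg v := P v /\ l v < 0.
pose zer v := cut P v /\ l v = 0.
(* The largest possible multiple of the kernel vector is split off, which kills one of the two
   coefficients and leaves the other nonnegative. *)
have merge_pn p q : pos p -> neg q -> forall a b, 0 <= a -> 0 <= b ->
    exists a' b' c, [/\ 0 <= a', 0 <= b', 0 <= c, a' = 0 \/ b' = 0 &
      a *: p + b *: q = a' *: p + b' *: q + c *: (l p *: q - l q *: p)].
  move=> [Pp lp] [Pq lq] a b a0 b0.
  have lq' : 0 < - l q by rewrite oppr_gt0.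
  have [h|h] := leP (b * - l q) (a * l p).
    exists (a - b * - l q / l p), 0, (b / l p).
    rewrite subr_ge0 ler_pdivrMr // h lexx divr_ge0 ?(ltW lp) //; split=> //; first by right.
    rewrite scalerBr !scalerA scale0r addr0 scalerBl mulfVK ?gt_eqF //.
    rewrite mulrN mulNr scaleNr opprK mulrAC -!addrA; congr (_ + _).
    by rewrite [RHS]addrCA subrr addr0.
  exists 0, (b - a * l p / - l q), (a / - l q).
  rewrite subr_ge0 ler_pdivrMr // (ltW h) lexx divr_ge0 ?(ltW lq') //; split=> //; first by left.
  rewrite scalerBr !scalerA scale0r add0r scalerBl.
  have -> : a / - l q * l q = - a by rewrite invrN mulrN mulNr mulfVK ?lt_eqF.
  by rewrite scaleNr opprK mulrAC addrA subrK addrC.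
have zpn p q : pos p -> neg q -> zer (l p *: q - l q *: p).
  move=> [Pp lp] [Pq lq]; split; first by right; exists p, q.
  by rewrite linearB !linearZ /= mulrC subrr.
(* One negative generator is cancelled against the positive ones in turn, until it or all of them
   are used up. *)
have absorb q : neg q -> forall y, cone pos y -> forall b, 0 <= b ->
    exists z y' b', [/\ cone zer z, cone pos y', 0 <= b', y' = 0 \/ b' = 0 &
      y + b *: q = z + y' + b' *: q].
  move=> nq y; elim=> [|c p y0 c0 Pp Cy IH] b b0.
    by exists 0, 0, b; split=> //; try exact: cone0; [left|rewrite !add0r].
  have [a' [b' [e [a0' b0' e0 ab E]]]] := merge_pn p q Pp nq c b c0 b0.
  case: ab => [a'0|b'0]; last first.
    exists (e *: (l p *: q - l q *: p)), (a' *: p + y0), 0; split=> //.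
    - by apply: cone_scale => //; apply: cone_gen; apply: zpn.
    - exact: coneD.
    - by right.
    rewrite addrAC E b'0 scale0r addr0 addr0 [RHS]addrA; congr (_ + _).
    by rewrite addrC.
  have [z [y' [b1 [Cz Cy' b10 yb E']]]] := IH b' b0'.
  exists (e *: (l p *: q - l q *: p) + z), y', b1; split=> //.
    by apply: coneD => //; apply: zpn.
  rewrite addrAC E a'0 scale0r add0r addrAC [b' *: q + _]addrC E'.
  by rewrite addrC !addrA.
have absorb' p : pos p -> forall y, cone neg y -> forall a, 0 <= a ->
    exists z y' a', [/\ cone zer z, cone neg y', 0 <= a', y' = 0 \/ a' = 0 &
      y + a *: p = z + y' + a' *: p].
  move=> pp y; elim=> [|c q y0 c0 Nq Cy IH] a a0.
    by exists 0, 0, a; split=> //; try exact: cone0; [left|rewrite !add0r].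
  have [a' [b' [e [a0' b0' e0 ab E]]]] := merge_pn p q pp Nq a c a0 c0.
  case: ab => [a'0|b'0].
    exists (e *: (l p *: q - l q *: p)), (b' *: q + y0), 0; split=> //.
    - by apply: cone_scale => //; apply: cone_gen; apply: zpn.
    - exact: coneD.
    - by right.
    rewrite addrAC [c *: q + _]addrC E a'0 scale0r add0r addr0 [RHS]addrA.
    by congr (_ + _); rewrite addrC.
  have [z [y' [b1 [Cz Cy' b10 yb E']]]] := IH a' a0'.
  exists (e *: (l p *: q - l q *: p) + z), y', b1; split=> //.
    by apply: coneD => //; apply: zpn.
  rewrite addrAC [c *: q + _]addrC E b'0 scale0r addr0 addrAC [a' *: p + _]addrC E'.
  by rewrite addrC !addrA.
move=> Cx lx.
have [z [y [Cz Cy E]]] : exists z y,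
    [/\ cone zer z, cone pos y \/ cone neg y & x = z + y].
  elim: Cx {lx} => [|c g x0 c0 Pg _ [z [y [Cz Cy ->]]]].
    by exists 0, 0; split; [exact: cone0|left; exact: cone0|rewrite addr0].
  have [lg|lg|lg] := ltgtP (l g) 0; last first.
  - exists (c *: g + z), y; split=> //; last by rewrite addrA.
    by apply: coneD => //; split=> //; left; rewrite lg.
  - case: Cy => Cy.
      exists z, (c *: g + y); split=> //; first by left; apply: coneD.
      by rewrite addrCA.
    have [z' [y' [a' [Cz' Cy' a0' ya E]]]] := absorb' g (conj Pg lg) y Cy c c0.
    exists (z + z'), (y' + a' *: g); split; first exact: cone_add.
      case: ya => [->|->]; last by right; rewrite scale0r addr0.
      by left; rewrite add0r; apply: cone_scale => //; apply: cone_gen.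
    by rewrite addrC -addrA E !addrA.
  case: Cy => Cy; last first.
    exists z, (c *: g + y); split=> //; first by right; apply: coneD.
    by rewrite addrCA.
  have [z' [y' [a' [Cz' Cy' a0' ya E]]]] := absorb g (conj Pg lg) y Cy c c0.
  exists (z + z'), (y' + a' *: g); split; first exact: cone_add.
    case: ya => [->|->]; last by left; rewrite scale0r addr0.
    by right; rewrite add0r; apply: cone_scale => //; apply: cone_gen.
  by rewrite addrC -addrA E !addrA.
have lz : l z = 0.
  elim: Cz => [|c g z0 _ [_ lg] _ IH]; first by rewrite linear0.
  by rewrite linearD linearZ /= lg IH mulr0 addr0.
have Cz' : cone (cut P) z by apply: cone_sub Cz => g [Cg _]; apply: cone_gen.
rewrite E; apply: cone_add => //; case: Cy => Cy.
  by apply: cone_sub Cy => g [Pg lg]; apply: cone_gen; left; split=> //; apply: ltW.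
(* A nonzero combination of negative generators would make [l x] negative. *)
suff -> : y = 0 by apply: cone0.
move: lx; rewrite E linearD /= lz add0r.
suff [ly|->//] : l y < 0 \/ y = 0 by move=> /(lt_le_trans ly); rewrite ltxx.
elim: Cy => [|c g y0 c0 [_ lg] _ IH]; first by right.
have [->|cn] := eqVneq c 0; first by rewrite scale0r add0r.
left; rewrite linearD linearZ /=.
have cg : c * l g < 0 by rewrite nmulr_llt0 // lt0r cn.
by case: IH => [ly|->]; [apply: ltr_wnDr => //; apply: ltW|rewrite linear0 addr0].
Qed.

(** The case of a line that crosses the hyperplane [l = 0]. All generators are projected along [b]
    to the kernel of [l], so that [x = t *: b + y] with [l y = 0], and the sign of [l x] is that of
    [t]. *)
Lemma cone_project P b x : 0 < l b ->
  cone (fun v => P v \/ v = b \/ v = - b) x -> 0 <= l x ->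
  cone (fun v => v = b \/ exists2 g, P g & v = l b *: g - l g *: b) x.
Proof.
move=> lb Cx lx; set Q := (X in cone X _).
have [t [y [Cy ly E]]] : exists t y, [/\ cone Q y, l y = 0 & x = t *: b + y].
  elim: Cx {lx} => [|c g x0 c0 Pg _ [t [y [Cy ly ->]]]].
    by exists 0, 0; rewrite scale0r addr0 linear0; split=> //; apply: cone0.
  case: Pg => [Pg|[->|->]].
  - exists (t + c * l g / l b), ((c / l b) *: (l b *: g - l g *: b) + y); split.
    + apply: coneD => //; first by rewrite divr_ge0 // ltW.
      by right; exists g.
    + by rewrite linearD linearZ /= linearB !linearZ /= ly [l g * _]mulrC subrr mulr0 addr0.
    + rewrite scalerBr !scalerA mulfVK ?gt_eqF // scalerDl.
      rewrite [c / l b * l g]mulrAC [RHS]addrA [in RHS]addrACA subrr addr0.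
      by rewrite addrA [c *: g + _]addrC.
  - by exists (t + c), y; rewrite scalerDl addrA [c *: b + _]addrC; split.
  - by exists (t - c), y; rewrite scalerBl scalerN addrA [- _ + _]addrC; split.
rewrite E; apply: coneD => //; last by left.
by move: lx; rewrite E linearD linearZ /= ly addr0 pmulr_lge0.
Qed.

End Cones.

(** The tables are stored as literals, so that later computations do not evaluate them again; [LLE],
    [gensE] and [slacksE] link them to what they tabulate. *)
Definition LL : seq (seq Z) := Eval vm_compute in LLtab.
Definition gens : seq (seq Z) := Eval vm_compute in gens13 LL.
Definition slacks : seq (seq Z) :=
  Eval vm_compute in [seq [seq zdot l g | l <- phis] | g <- gens].

Lemma LLE : LLtab = LL. Proof. by vm_compute. Qed.

Lemma gensE : gens13 LL = gens. Proof. by vm_compute. Qed.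

Lemma slacksE : [seq [seq zdot l g | l <- phis] | g <- gens] = slacks.
Proof. by vm_compute. Qed.

Definition dims_ok (s : seq (seq Z)) : bool := all (fun g => size g == 13) s.

Lemma phis_dims : dims_ok phis. Proof. by vm_compute. Qed.

Lemma gens_dims : dims_ok gens. Proof. by vm_compute. Qed.

(** As [dd_step] combines all pairs of opposite signs, its output may be redundant; every vector of
    it is certified to lie in the cone of the 24 generators. That no line is left is part of the
    check. *)
Lemma dd_gens :
  let: (B, G) := ddr in nilp B && all (in_cone gens slacks) G.
Proof. by vm_compute. Qed.

Section Vectors.
Variable R : realFieldType.
Local Notation V := 'rV[R]_13.

Definition zv (g : seq Z) : V := \row_i zr R (nth 0%BZ g i).

Definition lf (l : seq Z) (x : V) : R := \sum_(i < 13) zr R (nth 0%BZ l i) * x 0 i.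

Lemma lf_linear l : scalar (lf l).
Proof.
move=> a x y; rewrite /lf /= mulr_sumr -big_split; apply: eq_bigr => i _.
by rewrite !mxE mulrDr mulrCA.
Qed.

HB.instance Definition _ l :=
  GRing.isLinear.Build R V R _ (lf l) (lf_linear l).

Lemma lf_zv (a b : seq Z) : size a = 13 -> size b = 13 ->
  lf a (zv b) = zr R (zdot a b).
Proof.
move=> sa sb; rewrite /lf /zdot /sumZ zr_sum.
rewrite (big_nth (0%BZ, 0%BZ)) big_mkord size_zip sa sb.
by apply: eq_bigr => i _; rewrite mxE nth_zip ?sa ?sb // zrM.
Qed.

Lemma size_lcomb a b (x y : seq Z) : size x = 13 -> size y = 13 ->
  size (lcomb a b x y) = 13.
Proof. by move=> sx sy; rewrite size_map size_zip sx sy. Qed.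

Lemma zv_lcomb a b (x y : seq Z) : size x = 13 -> size y = 13 ->
  zv (lcomb a b x y) = zr R a *: zv x + zr R b *: zv y.
Proof.
move=> sx sy; apply/rowP=> i; rewrite !mxE.
rewrite (nth_map (0%BZ, 0%BZ)) ?size_zip ?sx ?sy //.
by rewrite nth_zip ?sx ?sy // zrD !zrM.
Qed.

Definition gen_by (G : seq (seq Z)) (v : V) : Prop := exists2 g, g \in G & v = zv g.

(** A line is entered as two opposite generators, which lets the lemmas on [cone] apply. *)
Definition dd_gen (BG : seq (seq Z) * seq (seq Z)) (v : V) : Prop :=
  gen_by BG.2 v \/ gen_by BG.1 v \/ gen_by BG.1 (- v).

Lemma zv_opp (b : seq Z) : zv (map Z.opp b) = - zv b.
Proof.
apply/rowP=> i; rewrite !mxE; have [ib|ib] := ltnP i (size b).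
  by rewrite (nth_map 0%BZ) // zrN.
by rewrite !nth_default ?size_map // zr0 oppr0.
Qed.

Lemma dims_step l BG : size l = 13 -> dims_ok BG.1 -> dims_ok BG.2 ->
  dims_ok (dd_step l BG).1 /\ dims_ok (dd_step l BG).2.
Proof.
case: BG => B G sl /= dB dG; rewrite /dd_step; case: ifP => kB /=.
  have sb : size (nth [::] B (find (fun b => ~~ Z.eqb (zdot l b) 0) B)) = 13.
    by apply/eqP; apply: (allP dB); apply: mem_nth.
  set b := (if _ then _ else _).
  have {}sb : size b = 13 by rewrite /b; case: ifP => _; rewrite ?size_map.
  rewrite /dims_ok /= sb eqxx !all_map; split; apply/allP=> g gB /=; apply/eqP;
    rewrite size_lcomb //; apply/eqP.
    apply: (allP dB); move: gB; rewrite mem_cat.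
    by case/orP=> [/mem_take|/mem_drop].
  exact: (allP dG).
split=> //; rewrite /dims_ok all_cat; apply/andP; split.
  by apply/allP=> g; rewrite mem_filter => /andP[_ /(allP dG)].
apply/allP=> g /allpairsP[[p q] [/= pG qG ->]].
move: pG qG; rewrite !mem_filter => /andP[_ /(allP dG)/eqP sp].
by move=> /andP[_ /(allP dG)/eqP sq]; rewrite size_lcomb.
Qed.

Lemma dd_step_sound l BG x : size l = 13 -> dims_ok BG.1 -> dims_ok BG.2 ->
  cone (dd_gen BG) x -> 0 <= lf l x -> cone (dd_gen (dd_step l BG)) x.
Proof.
case: BG => B G sl /= dB dG Cx lx; rewrite /dd_step.
set k := find _ B; case: ifP => kB.
  set b0 := nth _ _ _; set b := (if _ then _ else _).
  have b0B : b0 \in B by apply: mem_nth.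
  have sb0 : size b0 = 13 by apply/eqP; apply: (allP dB).
  have sb : size b = 13 by rewrite /b; case: ifP => _; rewrite ?size_map.
  have zb : zv b = zv b0 \/ zv b = - zv b0.
    by rewrite /b; case: ifP => _; rewrite ?zv_opp; [right|left].
  have lb : 0 < lf l (zv b).
    have := @nth_find _ [::] (fun b => ~~ Z.eqb (zdot l b) 0) B.
    rewrite has_find => /(_ kB); rewrite -/k -/b0 /b.
    case: ifP => neg nz; rewrite ?zv_opp ?linearN /= lf_zv // ?oppr_gt0.
      by rewrite -oppr_gt0 -zrN zr_gt0; move: neg; clear; lia.
    by rewrite zr_gt0; move: neg nz; clear; lia.
  set Q := fun v => gen_by G v \/ gen_by (take k B ++ drop k.+1 B) v
                     \/ gen_by (take k B ++ drop k.+1 B) (- v).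
  have Cx' : cone (fun v => Q v \/ v = zv b \/ v = - zv b) x.
    have inB g : g \in B -> g = b0 \/ g \in take k B ++ drop k.+1 B.
      rewrite -{1}[B](cat_take_drop k) (drop_nth [::] kB) mem_cat inE -/b0.
      rewrite mem_cat; case/or3P=> [->|/eqP->|->]; rewrite ?orbT; auto.
    apply: cone_sub Cx => v; case=> [gv|[[g /inB gB]|[g /inB gB]]].
    - by apply: cone_gen; left; left.
    - move=> vg; apply: cone_gen; case: gB => [gb|gB].
        by right; rewrite vg gb; case: zb => ->; rewrite ?opprK; auto.
      by left; right; left; exists g.
    - move=> vg; apply: cone_gen; case: gB => [gb|gB].
        by right; rewrite -[v]opprK vg gb; case: zb => ->; rewrite ?opprK; auto.
      by left; right; right; exists g.
  have := cone_project lb Cx' lx; apply: cone_sub => v [->|[g Qg ->]]; apply: cone_gen.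
    by left; exists b; rewrite ?inE ?eqxx.
  rewrite /= lf_zv //; case: Qg => [[h hG gh]|[[h hB gh]|[h hB gh]]].
  - have sh : size h = 13 by apply/eqP; apply: (allP dG).
    left; exists (lcomb (zdot l b) (- zdot l h) h b).
      by rewrite inE; apply/orP; right; apply/mapP; exists h.
    by rewrite zv_lcomb // zrN gh lf_zv // scaleNr.
  - have sh : size h = 13.
      apply/eqP; apply: (allP dB); move: hB; rewrite mem_cat.
      by case/orP=> [/mem_take|/mem_drop].
    right; left; exists (lcomb (zdot l b) (- zdot l h) h b).
      by apply/mapP; exists h.
    by rewrite zv_lcomb // zrN gh lf_zv // scaleNr.
  - have sh : size h = 13.
      apply/eqP; apply: (allP dB); move: hB; rewrite mem_cat.
      by case/orP=> [/mem_take|/mem_drop].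
    right; right; exists (lcomb (zdot l b) (- zdot l h) h b).
      by apply/mapP; exists h.
    rewrite zv_lcomb // zrN -(lf_zv sl sh) -gh.
    rewrite [lf l (- g)]linearN /= opprK.
    by rewrite scalerN opprB addrC.
(* Now [l] vanishes on all lines, so the generators combined by [cone_cut] all come from [G]. *)
have lB b : b \in B -> lf l (zv b) = 0.
  move=> bB; have sb : size b = 13 by apply/eqP; apply: (allP dB).
  move/negbT: kB; rewrite -leqNgt leqNgt -has_find -all_predC => /allP/(_ b bB) /=.
  by rewrite negbK lf_zv // => /Z.eqb_eq ->.
have sG g : g \in G -> size g = 13 by move=> gG; apply/eqP; apply: (allP dG).
have lGP v : dd_gen (B, G) v -> lf l v != 0 -> gen_by G v.
  case=> [//|[[b bB ->]|[b bB vb]]]; first by rewrite lB // eqxx.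
  by rewrite -[v]opprK vb linearN /= lB // oppr0 eqxx.
apply: cone_sub (cone_cut Cx lx) => v [[Pv lv]|[p [q [Pp Pq lp lq ->]]]]; apply: cone_gen.
  case: Pv => [[g gG vg]|]; last by right.
  left; exists g => //; rewrite mem_cat mem_filter gG andbT.
  by rewrite -(zr_ge0 R) -(lf_zv (sl) (sG g gG)) -vg lv.
have [g gG pg] := lGP p Pp (lt0r_neq0 lp).
have [h hG qh] : gen_by G q by apply: lGP => //; rewrite lt_eqF.
left; exists (lcomb (zdot l g) (- zdot l h) h g).
  rewrite mem_cat; apply/orP; right; apply/allpairsP; exists (g, h).
  rewrite !mem_filter gG hG !andbT; split=> //=.
    by rewrite -(zr_gt0 R) -lf_zv // ?sG // -pg.
  have : 0 < zr R (- zdot l h) by rewrite zrN oppr_gt0 -(lf_zv sl (sG h hG)) -qh.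
  by rewrite zr_gt0; clear; lia.
have sg := sG g gG; have sh := sG h hG.
by rewrite zv_lcomb // zrN /= pg qh !lf_zv // scaleNr.
Qed.

Lemma in_cone_sound G S u : size u = 13 -> dims_ok G -> in_cone G S u ->
  cone (gen_by G) (zv u).
Proof.
move=> su dG; rewrite /in_cone; case: greedy => d cs /and3P[d0 cs0 z].
suff : cone (gen_by G) (zr R d *: zv u).
  have d0' : 0 < zr R d by rewrite zr_gt0.
  move=> C; have := cone_scale (ltW (etrans (invr_gt0 _) d0')) C.
  by rewrite scalerA mulVf ?gt_eqF // scale1r.
have : forall H, {subset H <= G} -> exists2 y, cone (gen_by G) y &
    zr R d *: zv u =
    y + zv (foldr (fun p acc => lcomb (- p.1) 1 p.2 acc) (map (Z.mul d) u) (zip cs H)).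
  have dM : zr R d *: zv u = zv (map (Z.mul d) u).
    by apply/rowP=> i; rewrite !mxE (nth_map 0%BZ) ?su // zrM.
  have sz K c : dims_ok K -> size (foldr (fun p acc => lcomb (- p.1) 1 p.2 acc)
      (map (Z.mul d) u) (zip c K)) = 13.
    elim: K c => [|g K IH] [|c cl] /=; try by rewrite size_map.
    by case/andP=> /eqP sg dK; rewrite size_lcomb // IH.
  have sub_dims K : {subset K <= G} -> dims_ok K.
    by move=> KG; apply/allP=> g /KG /(allP dG).
  move=> H; elim: H cs cs0 {z} => [|g H IH] [|c cs] /= cs0 HG;
    try by exists 0; [exact: cone0|rewrite add0r dM].
  case/andP: cs0 => c0 cs0.
  have HG' : {subset H <= G} by move=> h hH; apply: HG; rewrite inE hH orbT.
  have gG : g \in G by apply: HG; rewrite inE eqxx.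
  have [y Cy E] := IH cs cs0 HG'.
  exists (zr R c *: zv g + y).
    by apply: coneD => //; [rewrite zr_ge0|exists g].
  have sg : size g = 13 by apply/eqP; apply: (allP dG).
  rewrite zv_lcomb ?sz ?sub_dims //.
  by rewrite zrN zr1 scale1r E scaleNr addrACA subrr add0r.
case/(_ G (fun _ h => h)) => y Cy ->; set r := foldr _ _ _ in z *.
have -> : zv r = 0; last by rewrite addr0.
apply/rowP=> i; rewrite !mxE; have [ir|ir] := ltnP i (size r).
  by have /Z.eqb_eq -> := allP z _ (mem_nth 0%BZ ir).
by rewrite nth_default.
Qed.

Lemma dd_sound (x : V) : (forall l, l \in phis -> 0 <= lf l x) ->
  cone (gen_by gens) x.
Proof.
move=> lx.
have dU : dims_ok unit_vecs by vm_compute.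
(* The start is the whole space, spanned by the lines through the unit vectors. *)
have init : cone (dd_gen (unit_vecs, [::])) x.
  have -> : x = \sum_(i < 13) x 0 i *: zv (nth [::] unit_vecs i).
    apply/rowP=> j; rewrite summxE (bigD1 j) //= big1 ?addr0 => [|i ij].
      rewrite !mxE /unit_vecs (nth_map 0) ?size_iota // (nth_map 0) ?size_iota //.
      by rewrite !nth_iota // eqxx zr1 mulr1.
    rewrite !mxE /unit_vecs (nth_map 0) ?size_iota // (nth_map 0) ?size_iota //.
    by rewrite !nth_iota // !add0n ifN ?zr0 ?mulr0 //.
  elim/big_ind: _ => [|y z|i _]; [exact: cone0|exact: cone_add|].
  have iU : nth [::] unit_vecs i \in unit_vecs by rewrite mem_nth.
  have [c0|c0] := leP 0 (x 0 i).
    by apply: cone_scale => //; apply: cone_gen; right; left; exists (nth [::] unit_vecs i).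
  rewrite -[_ *: _]opprK -scaleNr -scalerN; apply: cone_scale; first by rewrite oppr_ge0 ltW.
  by apply: cone_gen; right; right; exists (nth [::] unit_vecs i); rewrite ?opprK.
have run s BG : {subset s <= phis} -> dims_ok BG.1 -> dims_ok BG.2 -> cone (dd_gen BG) x ->
    let BG' := foldl (fun BG l => dd_step l BG) BG s in
    cone (dd_gen BG') x /\ dims_ok BG'.2.
  elim: s BG => [|l s IH] BG sub d1 d2 C //=.
  have lp : l \in phis by apply: sub; rewrite inE eqxx.
  have sl : size l = 13 by apply/eqP; apply: (allP phis_dims).
  have [d1' d2'] := dims_step sl d1 d2.
  apply: IH => //; first by move=> h hs; apply: sub; rewrite inE hs orbT.
  by apply: dd_step_sound => //; apply: lx.
have := run phis (unit_vecs, [::]) (fun _ h => h) dU isT init.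
have := dd_gens; rewrite -/ddr; case: ddr => B G /andP[/nilP -> /allP inG] [C dG].
apply: cone_sub C => v [[g gG ->]|[[g //]|[g //]]].
by apply: (@in_cone_sound _ slacks); [apply/eqP; apply: (allP dG)|exact: gens_dims|exact: inG].
Qed.

End Vectors.

(* Not imported earlier because the notations for finite sets and for classical
   sets clash. *)
From mathcomp Require Import all_classical all_reals all_analysis.
Import Order.TTheory GRing.Theory Num.Theory.
Import numFieldNormedType.Exports.

(** * Inversion of the flag L-vector *)

Section Inversion.
Variables (R : realType) (n : nat).
Implicit Types (S T U Q : {set 'I_n}) (v : 'rV[R]_#|{set 'I_n}|).

(** If [S] is properly contained in [T], toggling an element of the difference cancels the terms in
    pairs. *)
Lemma sum_sign_between S T :
  \sum_(U : {set 'I_n} | (S \subset U) && (U \subset T)) (-1) ^+ #|U| =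
    (if S == T then (-1) ^+ #|S| else 0) :> R.
Proof.
case: eqP => [<-|/eqP nST].
  rewrite (bigD1 S) ?subxx //= big_pred0 ?addr0 // => U.
  by rewrite -finset.eqEsubset eq_sym; case: eqP.
have [ST|nS] := boolP (S \subset T); last first.
  rewrite big_pred0 // => U; apply/negP=> /andP[SU UT].
  by rewrite (fintype.subset_trans SU UT) in nS.
have [x] : exists x, x \in (T :\: S)%SET.
  apply/finset.set0Pn; apply: contraNneq nST => /eqP; rewrite finset.setD_eq0 => TS.
  by rewrite finset.eqEsubset ST TS.
rewrite inE => /andP[xS xT].
rewrite (bigID (fun U => x \in U)) /= (reindex_onto (fun U => x |: U)%SET (fun U => U :\ x)%SET).
  rewrite addrC; apply/eqP; rewrite addr_eq0 -sumrN; apply/eqP; apply: eq_big => [U|U].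
    rewrite finset.setU11 andbT; have [xU|xU] := boolP (x \in U).
      rewrite andbF; apply/esym/negP=> /andP[_ /eqP e].
      by move: xU; rewrite -e !inE eqxx.
    rewrite finset.setU1K // eqxx andbT andbT finset.subUset finset.sub1set xT /=.
    congr (_ && _); apply/idP/idP => [SU|/fintype.subsetP SU].
      by apply: fintype.subset_trans SU _; apply: finset.subsetUr.
    apply/fintype.subsetP=> y yS; have := SU y yS; rewrite !inE => /orP[/eqP yx|//].
    by rewrite -yx yS in xS.
  by case/andP=> _ xU; rewrite cardsU1 xU exprD expr1 mulN1r opprK.
by move=> U /andP[_ xU]; rewrite finset.setD1K.
Qed.

(** Up to signs and powers of 2, the flag L-vector is a sum of flag numbers over supersets; this is
    Möbius inversion on the lattice of rank sets. *)
Lemma flag_coordE v S :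
  flag_coord v S = 2 ^+ #|S| * \sum_(Q : {set 'I_n} | [disjoint Q & S]) flag_L Q v.
Proof.
rewrite (reindex_inj (inv_inj (@finset.setCK _))) /= /flag_L.
have cC Q : (n - #|~: Q|)%N = #|Q|.
  by rewrite [RHS]finset.cardsCs card_ord.
under eq_bigr => Q _ do rewrite cC finset.setCK mulr_sumr.
under eq_bigl => Q do rewrite disjoint_sym finset.disjoints_subset finset.setCK.
rewrite (exchange_big_dep (fun T => S \subset T)) /=; last first.
  by move=> Q T SQ QT; apply: fintype.subset_trans QT.
under eq_bigr => T _ do rewrite -mulr_suml sum_sign_between.
rewrite (bigD1 S) //= eqxx big1 ?addr0; last first.
  by move=> T /andP[_ TS]; rewrite eq_sym (negPf TS) mul0r.
have e : 2 ^+ #|S| * (-1) ^+ #|S| * (- 2^-1) ^+ #|S| = 1 :> R.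
  by rewrite -!exprMn mulrN1 mulrNN mulfV ?pnatr_eq0 // expr1n.
by rewrite !mulrA e mul1r.
Qed.

End Inversion.

(** * Rank sets as sorted lists *)

Definition rset (n : nat) (l : seq nat) : {set 'I_n} :=
  [set i : 'I_n | i.+1 \in l]%SET.
Arguments rset : clear implicits.

Lemma mem_ranks n (S : {set 'I_n}) k : (k \in ranks S) = [exists i in S, k == i.+1].
Proof.
apply/mapP/exists_inP => [[i iS ->]|[i iS /eqP->]]; exists i => //.
  by rewrite mem_enum in iS.
by rewrite mem_enum.
Qed.

Lemma mem_ranksS n (S : {set 'I_n}) (i : 'I_n) : (i.+1 \in ranks S) = (i \in S).
Proof.
rewrite mem_ranks; apply/exists_inP/idP => [[j jS /eqP[/val_inj->]] //|iS].
by exists i.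
Qed.

Lemma ranks_le n (S : {set 'I_n}) k : k \in ranks S -> (0 < k <= n)%N.
Proof. by case/mapP=> i _ ->; rewrite /= ltn_ord. Qed.

Lemma ranksE n (S : {set 'I_n}) : ranks S = [seq k <- iota 1 n | k \in ranks S].
Proof.
apply: (irr_sorted_eq ltn_trans ltnn (ranks_sorted S)).
  by apply: sorted_filter; [exact: ltn_trans|exact: iota_ltn_sorted].
move=> k; rewrite mem_filter mem_iota; case: (boolP (k \in ranks S)) => // /ranks_le.
by rewrite add1n ltnS => ->.
Qed.

Lemma rset_ranks n (S : {set 'I_n}) : rset n (ranks S) = S.
Proof. by apply/setP=> i; rewrite inE mem_ranksS. Qed.

Lemma mem_sublists (a : pred nat) (s : seq nat) : [seq k <- s | a k] \in sublists s.
Proof.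
elim: s => //= k s IH; rewrite mem_cat; case: ifP => _; last by rewrite IH orbT.
by apply/orP; left; apply/mapP; exists [seq k <- s | a k].
Qed.

Lemma ranks_S6 (S : {set 'I_6}) : ranks S \in S6.
Proof.
rewrite ranksE; apply/mapP; exists [seq k <- rev (iota 1 6) | k \in ranks S].
  exact: mem_sublists.
by rewrite filter_rev revK.
Qed.

Lemma S6_filter : all (fun t : seq nat => t == [seq k <- iota 1 6 | k \in t]) S6.
Proof. by vm_compute. Qed.

Lemma S6_uniq : uniq S6. Proof. by vm_compute. Qed.

Lemma S6E (t : seq nat) : t \in S6 -> t = [seq k <- iota 1 6 | k \in t].
Proof. by move=> /(allP S6_filter)/eqP. Qed.

Lemma ranks_rset (t : seq nat) : t \in S6 -> ranks (rset 6 t) = t.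
Proof.
move=> tS; rewrite ranksE [RHS]S6E //; apply: eq_in_filter => k.
rewrite mem_iota => /andP[k0 k6]; rewrite mem_ranks.
apply/exists_inP/idP => [[i + /eqP->]|kt]; first by rewrite inE.
have k6' : (k.-1 < 6)%N by rewrite prednK.
by exists (Ordinal k6'); rewrite ?inE /= ?prednK.
Qed.

Lemma card_rset (t : seq nat) : t \in S6 -> #|rset 6 t| = size t.
Proof. by move=> tS; rewrite -size_ranks ranks_rset. Qed.

Lemma big_S6 (R : nmodType) (F : {set 'I_6} -> R) (P : pred {set 'I_6}) :
  \sum_(Q | P Q) F Q = \sum_(q <- S6 | P (rset 6 q)) F (rset 6 q).
Proof.
rewrite big_mkcond [RHS]big_mkcond -(big_map (rset 6) xpredT (fun Q => if P Q then F Q else 0)).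
have uS : uniq (map (rset 6) S6).
  rewrite map_inj_in_uniq ?S6_uniq // => s t sS tS e.
  by rewrite -(ranks_rset sS) e ranks_rset.
rewrite (big_uniq _ uS); apply: eq_bigl => Q.
by apply/esym/mapP; exists (ranks Q); rewrite ?ranks_S6 ?rset_ranks.
Qed.

Lemma S6_sub (t : seq nat) k : t \in S6 -> k \in t -> (0 < k <= 6)%N.
Proof. by move=> /S6E ->; rewrite mem_filter mem_iota add1n ltnS => /andP[]. Qed.

Lemma mem_rset (t : seq nat) (i : 'I_6) : (i \in rset 6 t) = (i.+1 \in t).
Proof. by rewrite inE. Qed.

Lemma sub_rset (s t : seq nat) : s \in S6 -> (rset 6 s \subset rset 6 t) = inclb s t.
Proof.
move=> sS; apply/fintype.subsetP/allP => [H k ks|H i]; last first.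
  by rewrite !mem_rset => /H.
have /andP[k0 k6] := S6_sub sS ks.
have k6' : (k.-1 < 6)%N by rewrite prednK.
by have := H (Ordinal k6'); rewrite !mem_rset /= prednK //; apply.
Qed.

Lemma rsetC (q : seq nat) : ~: rset 6 q = rset 6 (compl6 q).
Proof.
apply/setP=> i; rewrite finset.in_setC !mem_rset mem_filter mem_iota /=.
by rewrite add1n ltnS ltn_ord andbT.
Qed.

Lemma compl6_S6 (q : seq nat) : compl6 q \in S6.
Proof.
apply/mapP; exists [seq k <- rev (iota 1 6) | k \notin q]; first exact: mem_sublists.
by rewrite filter_rev revK.
Qed.

Lemma disj_rset (s t : seq nat) : s \in S6 -> [disjoint rset 6 s & rset 6 t] = disj t s.
Proof.
move=> sS; rewrite finset.disjoints_subset rsetC sub_rset //.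
apply/allP/allP => H k kt.
  apply/negP=> ks; have := H k ks; rewrite /= mem_filter => /andP[].
  by rewrite kt.
rewrite /= mem_filter mem_iota add1n ltnS (S6_sub sS kt) andbT.
by apply/negP=> /H; rewrite kt.
Qed.

Section Coordinates.
Variable R : realType.
Implicit Type v : 'rV[R]_#|{set 'I_6}|.

Definition fl v (l : seq nat) : R := flag_coord v (rset 6 l).
Definition Lq v (q : seq nat) : R := flag_L (rset 6 q) v.

Lemma LqE v q : q \in S6 -> Lq v q =
  (-1) ^+ (6 - size q) * \sum_(t <- S6 | inclb (compl6 q) t) (- 2^-1) ^+ size t * fl v t.
Proof.
move=> qS; rewrite /Lq /flag_L card_rset //; congr (_ * _).
rewrite big_S6 rsetC; rewrite big_seq_cond [RHS]big_seq_cond.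
apply: eq_big => [t|t /andP[tS _]]; last by rewrite card_rset.
by rewrite sub_rset ?compl6_S6.
Qed.

Lemma S6_size (t : seq nat) : t \in S6 -> (size t <= 6)%N.
Proof.
by move=> /S6E ->; rewrite size_filter (leq_trans (count_size _ _)) ?size_iota.
Qed.

Lemma ev_Lcomb v q : q \in S6 -> ev (fl v) (Lcomb q) = 2 ^+ 6 * Lq v q.
Proof.
move=> qS; rewrite LqE // /ev /Lcomb big_map big_filter mulrCA !mulr_sumr.
rewrite big_seq_cond [RHS]big_seq_cond; apply: eq_bigr => t /andP[tS _] /=.
have key : (-1) ^+ size t * 2 ^+ (6 - size t) = 2 ^+ 6 * (- 2^-1) ^+ size t :> R.
  rewrite -{2}(subnK (S6_size tS)) exprD -mulrA -exprMn mulrN mulfV ?pnatr_eq0 //.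
  by rewrite mulrC.
rewrite zrM zr_sgZ zrX exprD; have -> : zr R 2%BZ = 2 by [].
by rewrite -!mulrA [_ * (_ * fl v t)]mulrA key !mulrA; congr (_ * _ * _); rewrite mulrC.
Qed.

Lemma flE v t : t \in S6 -> fl v t = 2 ^+ size t * \sum_(q <- S6 | disj t q) Lq v q.
Proof.
move=> tS; rewrite /fl flag_coordE card_rset //; congr (_ * _).
rewrite big_S6 big_seq_cond [RHS]big_seq_cond; apply: eq_bigl => q.
by case: (boolP (q \in S6)) => //= qS; rewrite disj_rset.
Qed.

Lemma Lq_inj v w : (forall q, q \in S6 -> Lq v q = Lq w q) -> v = w.
Proof.
move=> e; apply/rowP=> i.
have : fl v (ranks (enum_val i)) = fl w (ranks (enum_val i)).
  rewrite !flE ?ranks_S6 //; congr (_ * _).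
  by rewrite big_seq_cond [RHS]big_seq_cond; apply: eq_bigr => q /andP[/e].
by rewrite /fl rset_ranks /flag_coord enum_valK.
Qed.

Lemma flag_L_linear n (Q : {set 'I_n}) : scalar (@flag_L R n Q).
Proof.
move=> a v w; rewrite /flag_L [X in _ = X + _]mulrCA -mulrDr; congr (_ * _).
rewrite mulr_sumr -big_split /=; apply: eq_bigr => T _.
by rewrite /flag_coord !mxE mulrDr mulrCA.
Qed.

HB.instance Definition _ n (Q : {set 'I_n}) :=
  GRing.isLinear.Build R _ R _ (@flag_L R n Q) (@flag_L_linear n Q).

End Coordinates.

Local Close Scope ring_scope.

(** * Limit posets *)

Lemma card_match (a b : nat) (i : 'I_a) (c : bool) : (c -> i < b) ->
  #|[pred j : 'I_b | c ==> (i == j :> nat)]| = if c then 1 else b.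
Proof.
case: c => /= [/(_ isT) ib|_]; last first.
  by rewrite -[RHS](card_ord b); apply: eq_card.
by rewrite -(card1 (Ordinal ib)); apply: eq_card => j; rewrite !inE eq_sym.
Qed.

Section Replicate.
Variables (n : nat) (I : {set 'I_n}) (N : nat) (P : ranked_rel).
Hypothesis itv : is_rank_interval I.
Hypothesis N0 : 0 < N.

Local Notation RP := (replicate I N P).
Local Notation chP := (chains (@rr_lt P) (@rr_rank P)).
Local Notation chR := (chains (@rr_lt RP) (@rr_rank RP)).
Let meets (l : seq nat) := has (mem (ranks I)) l.

Lemma rank_interval_convex a b c : a < b < c ->
  a \in ranks I -> c \in ranks I -> b \in ranks I.
Proof.
case/andP=> ab bc; rewrite !mem_ranks => /exists_inP[i iI /eqP ai] /exists_inP[k kI /eqP ck].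
have bn : b.-1 < n by have := ltn_ord k; lia.
have /andP[_ /forallP/(_ i)/implyP/(_ iI)/forallP/(_ k)/implyP/(_ kI)] := itv.
move=> /forallP/(_ (Ordinal bn))/implyP /= H; apply/exists_inP; exists (Ordinal bn); last by rewrite /=; lia.
by apply: H; lia.
Qed.

Let fam (x : rr_sort P) : finType := 'I_(if rr_rank x \in ranks I then N else 1).
Let mk (y : rr_sort P) (j : fam y) : rr_sort RP := Tagged (fun x => fam x : Type) j.

Lemma mk_lt x y (i : fam x) (j : fam y) : @rr_lt RP (mk i) (mk j) =
  rr_lt x y && ((rr_rank x \in ranks I) && (rr_rank y \in ranks I) ==> (i == j :> nat)).
Proof. by []. Qed.

Lemma mk_rank y (j : fam y) : @rr_rank RP (mk j) = rr_rank y.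
Proof. by []. Qed.

Lemma sum_replicate (F : rr_sort RP -> nat) (Q : pred (rr_sort RP)) :
  \sum_(v | Q v) F v = \sum_y \sum_(j | Q (@mk y j)) F (@mk y j).
Proof.
rewrite big_mkcond /=; under [RHS]eq_bigr => y _ do rewrite big_mkcond /=.
rewrite (sig_big_dep xpredT (fun y j => true)
  (fun y (j : fam y) => if Q (mk j) then F (mk j) else 0)) /=.
by apply: eq_bigr => [[y j]].
Qed.

(** The ranks of a chain that lie in [I] are consecutive in it, and elements there must carry the
    same index. So one index is chosen, when the chain enters [I], and none if it starts inside. *)
Lemma chains_replicate (u : rr_sort RP) (l : seq nat) : path ltn (rr_rank u) l ->
  chR u l = chP (tag u) l * N ^ ((rr_rank u \notin ranks I) && meets l).
Proof.
elim: l u => [|s l IH] u; first by rewrite /= andbF.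
case: u => x i /andP[xs pl]; have {}xs : rr_rank x < s := xs.
rewrite -[LHS]/(\sum_(v | @rr_lt RP (@mk x i) v && (@rr_rank RP v == s)) chR v l).
rewrite sum_replicate -[chP _ _]/(\sum_(y | rr_lt x y && (rr_rank y == s)) chP y l).
rewrite big_distrl [RHS]big_mkcond /=.
apply: eq_bigr => y _.
have [/andP[xy /eqP ys]|no] := boolP (rr_lt x y && (rr_rank y == s)); last first.
  rewrite big_pred0 // => j; apply/negP=> /andP[/andP[xy _] ys].
  by rewrite [rr_lt x y]xy [rr_rank y == s]ys in no.
rewrite (eq_bigr (fun=> chP y l * N ^ ((s \notin ranks I) && meets l))); last first.
  by move=> j _; rewrite IH /= ?ys.
rewrite sum_nat_const (eq_card (B := [pred j : fam y |
    (rr_rank x \in ranks I) && (rr_rank y \in ranks I) ==> (i == j :> nat)])); last first.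
  move=> j; rewrite [RHS]inE.
  rewrite -[LHS]/(@rr_lt RP (@mk x i) (mk j) && (@rr_rank RP (mk j) == s)).
  by rewrite mk_lt mk_rank xy (introT eqP ys) andbT.
rewrite card_match; last by case/andP=> xI yI; rewrite yI; apply: leq_trans (ltn_ord i) _; rewrite xI.
rewrite ys mulnC -mulnA; congr (_ * _).
have [xI|xI] := boolP (rr_rank x \in ranks I); have [sI|sI] := boolP (s \in ranks I) => /=.
- by rewrite expn0.
(* The chain has just left [I]; by convexity it cannot enter it again. *)
- rewrite muln1; case ml : (meets l) => //; move/hasP: ml => [t tl tI].
  have st : s < t by apply: (allP (order_path_min ltn_trans pl)).
  by move/negP: sI; case; apply: rank_interval_convex xI tI; rewrite xs.
- by rewrite expn0 mul1n expn1.
- by rewrite muln1.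
Qed.

Lemma chains0_replicate (l : seq nat) : sorted ltn l ->
  chains0 (@rr_lt RP) (@rr_rank RP) l =
  chains0 (@rr_lt P) (@rr_rank P) l * N ^ (meets l).
Proof.
case: l => [|s l] // pl.
rewrite -[LHS]/(\sum_(v | @rr_rank RP v == s) chR v l).
rewrite sum_replicate [chains0 _ _ _]/= big_distrl [RHS]big_mkcond /=.
apply: eq_bigr => y _.
have [ys|no] := eqVneq (rr_rank y) s; last first.
  by rewrite big_pred0 // => j; apply: negbTE.
rewrite (eq_bigr (fun=> chP y l * N ^ ((s \notin ranks I) && meets l))); last first.
  by move=> j _; rewrite chains_replicate /= ?ys.
rewrite sum_nat_const mulnC -mulnA; congr (_ * _).
rewrite (eq_card (B := predT)); last by [].
rewrite card_ord ys; have [sI|sI] := boolP (s \in ranks I); last by rewrite muln1.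
by rewrite /= mul1n.
Qed.

End Replicate.

Lemma chains_chain_poset (m : nat) (x : 'I_m.+1) (l : seq nat) :
  path ltn x l -> all (fun s => s <= m) l ->
  chains (@rr_lt (chain_poset m)) (@rr_rank (chain_poset m)) x l = 1.
Proof.
elim: l x => //= s l IH x /andP[xs pl] /andP[sm al].
rewrite (big_pred1 (Ordinal (sm : s < m.+1))) => [|y]; first exact: IH.
rewrite -[RHS](inj_eq val_inj) /=.
by have [->|] := eqVneq (y : nat) s; rewrite ?andbF // xs.
Qed.

(** The chain poset has one chain for each rank set, and each interval met multiplies the number by
    [N]. *)
Lemma chains0_iter_replicate (n : nat) (Is : seq {set 'I_n}) (N : nat) (l : seq nat) :
  0 < N -> all (@is_rank_interval n) Is -> sorted ltn l ->
  all (fun s => s <= n.+1) l ->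
  let P := foldr (fun I P => replicate I N P) (chain_poset n.+1) Is in
  chains0 (@rr_lt P) (@rr_rank P) l =
  N ^ count (fun I => has (mem (ranks I)) l) Is.
Proof.
move=> N0 + sl al; elim: Is => [|I Is IH] /= => [_|/andP[iI iIs]].
  case: l sl al => //= s l pl /andP[sm al].
  rewrite (big_pred1 (Ordinal (sm : s < n.+2))) => [|y]; first exact: chains_chain_poset.
  by rewrite -[RHS](inj_eq val_inj).
by rewrite chains0_replicate // IH // expnD mulnC.
Qed.

Lemma iter_replicate_mono (n : nat) (Is : seq {set 'I_n}) (N : nat) :
  let P := foldr (fun I P => replicate I N P) (chain_poset n.+1) Is in
  forall x y : rr_sort P, rr_lt x y -> rr_rank x < rr_rank y.
Proof. by elim: Is => //= I Is IH [x i] [y j] /andP[/IH]. Qed.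

Lemma iter_replicate_flag (n : nat) (Is : {set {set 'I_n}}) (N : nat) (S : {set 'I_n}) :
  0 < N -> interval_system Is ->
  flag_number (@rr_lt (iter_replicate Is N)) (@rr_rank (iter_replicate Is N)) S =
  N ^ #|[set I in Is | ~~ [disjoint I & S]]%SET|.
Proof.
move=> N0 /andP[/forall_inP iI _]; rewrite flag_numberE; last exact: iter_replicate_mono.
rewrite chains0_iter_replicate //; last 3 first.
- by apply/allP=> I; rewrite mem_enum => /iI.
- exact: ranks_sorted.
- by apply/allP=> s /ranks_le/andP[_ /leq_trans ->].
congr (_ ^ _); rewrite cardE -size_filter; apply: perm_size; apply: uniq_perm.
- by rewrite filter_uniq ?enum_uniq.
- exact: enum_uniq.
move=> I; rewrite mem_filter !mem_enum inE andbC; congr (_ && _).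
apply/hasP/pred0Pn => [[s /mapP[i + ->]]|[i /andP[/= iI1 iS]]].
  by rewrite mem_enum => iS; rewrite /= mem_ranksS => iI1; exists i; rewrite /= iI1.
by exists i.+1; rewrite /= mem_ranksS.
Qed.

Section Limits.
Variable R : realType.
Local Open Scope ring_scope.
Local Open Scope classical_set_scope.

Lemma cvg_power_ratio (e k : nat) : (e <= k)%N ->
  (fun N : nat => (N.+1 ^ e)%:R / N.+1%:R ^+ k : R) @ \oo --> ((e == k)%:R : R).
Proof.
move=> ek; have -> : (fun N : nat => (N.+1 ^ e)%:R / N.+1%:R ^+ k : R) =
    (fun N => (N.+1%:R^-1) ^+ (k - e)).
  apply/funext => N; have N1 : N.+1%:R != 0 :> R by rewrite pnatr_eq0.
  have -> : N.+1%:R ^+ k = N.+1%:R ^+ (k - e) * N.+1%:R ^+ e :> R.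
    by rewrite -exprD subnK.
  by rewrite natrX invfM mulrCA mulfV ?expf_neq0 // mulr1 exprVn.
move: ek; rewrite leq_eqVlt => /orP[/eqP->|ek].
  by rewrite subnn eqxx; under eq_fun do rewrite expr0; exact: cvg_cst.
rewrite ltn_eqF //; have -> : (false%:R : R) = 0 by [].
have : (0 < k - e)%N by rewrite subn_gt0.
elim: (k - e)%N => // m IH _.
have h : (fun N => N.+1%:R^-1 : R) @ \oo --> (0 : R) by exact: cvg_harmonic.
case: m IH => [|m] IH; first by under eq_fun do rewrite expr1.
under eq_fun do rewrite exprS.
have := cvgM h (IH isT); rewrite mulr0; apply.
Qed.

(** The flag number is [N] to the number of intervals that [S] meets, so division by [N ^ #|Is|]
    keeps exactly the sets [S] that meet all of them. *)
Lemma limit_flagE (n : nat) (Is : {set {set 'I_n}}) (S : {set 'I_n}) :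
  interval_system Is ->
  limit_flag R Is S = [forall I in Is, ~~ [disjoint I & S]]%:R.
Proof.
move=> iIs; apply: cvg_lim => //.
set A := [set I in Is | ~~ [disjoint I & S]]%SET.
have AI : A \subset Is by apply/fintype.subsetP=> I; rewrite inE => /andP[].
have -> : [forall I in Is, ~~ [disjoint I & S]] = (#|A| == #|Is|).
  apply/forall_inP/eqP => [H|e I iI].
    by apply: eq_card => I; rewrite inE; case: (boolP (I \in Is)) => // /H.
  have /eqP AE : A == Is by rewrite eqEcard AI e /=.
  by move: iI; rewrite -AE inE => /andP[].
(* The shift keeps the limit and makes [N] positive, as [iter_replicate_flag] requires. *)
rewrite -cvg_shiftS /=.
under eq_fun do rewrite iter_replicate_flag //.
by apply: cvg_power_ratio; apply: subset_leq_card.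
Qed.

End Limits.

Local Open Scope ring_scope.

Local Open Scope classical_set_scope.

(** * Extreme rays and facets of a polyhedral cone *)

Lemma scalar_ker (R : realType) (V : vectType R) (l : {scalar V}) :
  exists K : {vspace V}, forall v, (v \in K) = (l v == 0).
Proof.
pose f : {linear V -> R^o} := HB.pack_for {linear V -> R^o} (l : V -> R^o)
  (GRing.isLinear.Build R V R^o *:%R (l : V -> R^o) (linearP l)).
by exists (lker (linfun f)) => v; rewrite memv_ker lfunE.
Qed.

Section DoubleDescription.
Variables (R : realType) (V : vectType R) (m n : nat).
Local Notation ray := (@ray R V).
Variables (g : nat -> V) (phi : nat -> {scalar V}) (U : V -> Prop) (C : set V).
Hypothesis C_gen : forall v, C v <->
  exists2 c : nat -> R, (forall j, 0 <= c j) & v = \sum_(j < m) c j *: g j.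
Hypothesis C_ineq : forall v, C v <-> U v /\ forall i, (i < n)%N -> 0 <= phi i v.
Hypothesis U_lin : forall a v w, U v -> U w -> U (a *: v + w).
Hypothesis m_gt1 : (1 < m)%N.
Hypothesis sep_g : forall j h, (j < m)%N -> (h < m)%N -> j != h ->
  exists i, [/\ (i < n)%N, phi i (g j) = 0 & phi i (g h) != 0].
Hypothesis sep_phi : forall i k, (i < n)%N -> (k < n)%N -> i != k ->
  exists j, [/\ (j < m)%N, phi i (g j) = 0 & phi k (g j) != 0].

Lemma C_g j : (j < m)%N -> C (g j).
Proof.
move=> jm; apply/C_gen; exists (fun k => (k == j)%:R) => [k|]; first exact: ler0n.
rewrite (bigD1 (Ordinal jm)) //= eqxx scale1r big1 ?addr0 // => k kj.
by rewrite (_ : (k == j :> nat) = false) ?scale0r //; apply: contraNF kj => /eqP kj; apply/eqP/val_inj.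
Qed.

Lemma C_lin a v w : 0 <= a -> C v -> C w -> C (a *: v + w).
Proof.
move=> a0 /C_gen[c c0 ->] /C_gen[e e0 ->]; apply/C_gen.
exists (fun j => a * c j + e j) => [j|]; first by rewrite addr_ge0 ?mulr_ge0.
by rewrite scaler_sumr -big_split; apply: eq_bigr => j _; rewrite scalerDl scalerA.
Qed.

Lemma C_0 : C 0.
Proof. by apply/C_gen; exists (fun=> 0) => //; rewrite big1 // => j _; rewrite scale0r. Qed.

Lemma C_scale a v : 0 <= a -> C v -> C (a *: v).
Proof. by move=> a0 Cv; rewrite -[_ *: v]addr0; apply: C_lin => //; apply: C_0. Qed.

Lemma phi_ge0 i v : (i < n)%N -> C v -> 0 <= phi i v.
Proof. by move=> ii /C_ineq[_]; apply. Qed.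

Lemma nonneg_on_gens (l : {scalar V}) :
  (forall j, (j < m)%N -> 0 <= l (g j)) -> forall v, C v -> 0 <= l v.
Proof.
move=> lg v /C_gen[c c0 ->]; rewrite linear_sum sumr_ge0 // => j _.
by rewrite linearZ mulr_ge0 // lg.
Qed.

Lemma g_neq0 j : (j < m)%N -> g j != 0.
Proof.
move=> jm; have [h hm hj] : exists2 h, (h < m)%N & h != j.
  by case: j jm => [|j] jm; [exists 1%N|exists 0%N; rewrite // ltnW].
have [i [_ _]] := sep_g hm jm hj; apply: contraNneq => ->.
by rewrite linear0.
Qed.

Lemma face_support (l : {scalar V}) (c : nat -> R) :
  (forall j, (j < m)%N -> 0 <= l (g j)) -> (forall j, 0 <= c j) ->
  l (\sum_(j < m) c j *: g j) = 0 -> forall j, (j < m)%N -> l (g j) != 0 -> c j = 0.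
Proof.
move=> lg c0; rewrite linear_sum => /eqP; rewrite psumr_eq0 => [/allP H j jm lj|j _]; last first.
  by rewrite linearZ mulr_ge0 // lg.
have := H (Ordinal jm) (mem_index_enum _); rewrite /= linearZ mulf_eq0 (negPf lj) orbF.
by move/eqP.
Qed.

(** Any other generator [g h] has a positive value under some inequality tight at [g j], by [sep_g];
    hence its coefficient in [x] is 0. *)
Lemma face_ray j x : (j < m)%N -> C x ->
  (forall i, (i < n)%N -> phi i (g j) = 0 -> phi i x = 0) -> ray (g j) x.
Proof.
move=> jm /C_gen[c c0 xE] px; exists (c j) => //; rewrite xE.
rewrite (bigD1 (Ordinal jm)) //= big1 ?addr0 // => h hj.
have jh : j != h by apply: contraNneq hj => e; apply/eqP/val_inj.
have [i [ii gj gh]] := sep_g jm (ltn_ord h) jh.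
rewrite (face_support (l := phi i) _ c0 _ (ltn_ord h) gh) ?scale0r //.
  by move=> k km; apply: phi_ge0 => //; apply: C_g.
by rewrite -xE px.
Qed.

Lemma ray_pos b v w : 0 < b -> v = b *: w -> ray v = ray w.
Proof.
move=> b0 ->; apply/seteqP; split=> u [t t0 ->].
  by exists (t * b); rewrite ?scalerA // mulr_ge0 // ltW.
exists (t / b); first by rewrite divr_ge0 // ltW.
by rewrite scalerA mulfVK // gt_eqF.
Qed.

Lemma ray_inj : {in `I_m &, injective (fun j => ray (g j))}.
Proof.
move=> j h; rewrite !inE /= => jm hm e; apply/eqP; apply: contraT => jh.
have [i [ii gj gh]] := sep_g jm hm jh.
have [t _ E] : ray (g j) (g h) by rewrite e; exists 1; rewrite ?scale1r.
by move: gh; rewrite E linearZ /= gj mulr0 eqxx.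
Qed.

Lemma extreme_raysE : @extreme_rays R V C = (fun j => ray (g j)) @` `I_m.
Proof.
apply/seteqP; split=> [r [v [v0 -> rC ext]]|_ [j /= jm <-]].
  have : C v by apply: rC; exists 1; rewrite ?scale1r.
  move=> /C_gen[c c0 vE].
  have [j cj] : exists j : 'I_m, c j != 0.
    apply/existsP; apply: contraNT v0 => /existsPn H; rewrite vE big1 // => j _.
    by have := H j; rewrite negbK => /eqP ->; rewrite scale0r.
  exists (j : nat) => //=.
  have cj0 : 0 < c j by rewrite lt0r cj c0.
  (* Extremality is applied to [v] written as one nonzero term plus all the others. *)
  have [a a0 aE] : ray v (c j *: g j).
    have := ext (c j *: g j) (v - c j *: g j); case.
    - by apply: C_scale => //; apply: C_g.
    - rewrite vE (bigD1 j) //= addrAC subrr add0r; apply/C_gen.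
      exists (fun h => if h == j :> nat then 0 else c h) => [h|]; first by case: ifP.
      rewrite [RHS](bigD1 j) //= eqxx scale0r add0r; apply: eq_bigr => h hj.
      by rewrite ifN //; apply: contraNneq hj => e; apply/eqP/val_inj.
    - by rewrite addrCA subrr addr0; exists 1; rewrite ?scale1r.
    by [].
  have a1 : 0 < a.
    rewrite lt0r a0 andbT; apply/eqP => a00; move: aE; rewrite a00 scale0r => /eqP.
    by rewrite scaler_eq0 (gt_eqF cj0) (negPf (g_neq0 (ltn_ord j))).
  apply/esym; apply: (@ray_pos (c j / a)); first by rewrite divr_gt0.
  by rewrite mulrC -scalerA aE scalerA mulVf ?gt_eqF // scale1r.
exists (g j); split; first exact: g_neq0.
- by [].
- by move=> w [t t0 ->]; apply: C_scale => //; apply: C_g.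
move=> x y Cx Cy [t t0 E]; split; apply: face_ray => // i ii gj.
  have := phi_ge0 ii Cx; have := phi_ge0 ii Cy.
  have : phi i x + phi i y = 0 by rewrite -linearD E linearZ /= gj mulr0.
  by lra.
have := phi_ge0 ii Cx; have := phi_ge0 ii Cy.
have : phi i x + phi i y = 0 by rewrite -linearD E linearZ /= gj mulr0.
by lra.
Qed.

Definition facet_of (i : nat) : set V := C `&` [set v | phi i v = 0].

(** A nonnegative form vanishes at a combination only if it vanishes at every generator with
    positive coefficient, so the generators on a face determine it. *)
Lemma same_zeros (l l' : {scalar V}) :
  (forall j, (j < m)%N -> 0 <= l (g j)) -> (forall j, (j < m)%N -> 0 <= l' (g j)) ->
  (forall j, (j < m)%N -> (l (g j) == 0) = (l' (g j) == 0)) ->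
  C `&` [set v | l v = 0] = C `&` [set v | l' v = 0].
Proof.
move=> l0 l'0 e.
have sub (f f' : {scalar V}) : (forall j, (j < m)%N -> 0 <= f (g j)) ->
    (forall j, (j < m)%N -> (f (g j) == 0) = (f' (g j) == 0)) ->
    C `&` [set v | f v = 0] `<=` C `&` [set v | f' v = 0].
  move=> f0 ff v [Cv /= fv]; split=> //=; have /C_gen[c c0 vE] := Cv.
  rewrite vE in fv *; rewrite linear_sum big1 // => j _; rewrite linearZ /=.
  have [fj|fj] := eqVneq (f' (g j)) 0; first by rewrite fj mulr0.
  by rewrite (face_support f0 c0 fv) ?mul0r // ff.
by apply/seteqP; split; apply: sub => // j jm; rewrite e.
Qed.

Lemma facet_gens (l l' : {scalar V}) j : (j < m)%N ->
  C `&` [set v | l v = 0] = C `&` [set v | l' v = 0] -> (l (g j) == 0) = (l' (g j) == 0).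
Proof.
move=> jm e; apply/eqP/eqP => lj.
  have : (C `&` [set v | l v = 0]) (g j) by split=> //; apply: C_g.
  by rewrite e => -[].
have : (C `&` [set v | l' v = 0]) (g j) by split=> //; apply: C_g.
by rewrite -e => -[].
Qed.

Lemma facet_inj : {in `I_n &, injective facet_of}.
Proof.
move=> i k; rewrite !inE /= => ii kk e; apply/eqP; apply: contraT => ik.
have [j [jm ij kj]] := sep_phi ii kk ik.
by move: kj; rewrite -(facet_gens jm e) ij eqxx.
Qed.

Variable D : nat.

Definition gens_on (i : nat) : seq V := [seq g j | j <- iota 0 m & phi i (g j) == 0].

Hypothesis dim_C : \dim <<[seq g j | j <- iota 0 m]>> = D.+1.
Hypothesis dim_face : forall i, (i < n)%N -> \dim <<gens_on i>> = D.

Lemma has_dim_span (X : set V) (e : seq V) :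
  (forall v, v \in e -> X v) -> (forall v, X v -> v \in <<e>>%VS) ->
  has_dim X (\dim <<e>>).
Proof.
move=> eX Xe; exists <<e>>%VS; split=> // W XW.
by apply/span_subvP => v /eX /XW.
Qed.

Lemma has_dim_uniq (X : set V) a b : has_dim X a -> has_dim X b -> a = b.
Proof.
move=> [W1 [X1 m1 <-]] [W2 [X2 m2 <-]]; congr (\dim _).
by apply/eqP; rewrite eqEsubv m1 // m2.
Qed.

Lemma C_has_dim : has_dim C D.+1.
Proof.
rewrite -dim_C; apply: has_dim_span => [v /mapP[j]|v /C_gen[c c0 ->]].
  by rewrite mem_iota add0n => jm ->; apply: C_g.
apply: memv_suml => j _; apply: memvZ; apply: memv_span.
by apply/mapP; exists (j : nat) => //; rewrite mem_iota add0n /=.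
Qed.

Lemma facet_has_dim i : (i < n)%N -> has_dim (facet_of i) D.
Proof.
move=> ii; rewrite -(dim_face ii); apply: has_dim_span => [v /mapP[j]|v [/C_gen[c c0 vE] /= pv]].
  rewrite mem_filter mem_iota add0n => /andP[/eqP pj jm] ->.
  by split=> //; apply: C_g.
rewrite vE; apply: memv_suml => j _.
have [pj|pj] := eqVneq (phi i (g j)) 0.
  apply: memvZ; apply: memv_span; apply/mapP; exists (j : nat) => //.
  by rewrite mem_filter pj eqxx mem_iota add0n /=.
rewrite vE in pv; rewrite (face_support (l := phi i) _ c0 pv (ltn_ord j) pj) ?scale0r ?mem0v //.
by move=> k km; apply: phi_ge0 => //; apply: C_g.
Qed.

Lemma U_0 : U 0. Proof. by have /C_ineq[] := C_0. Qed.

Lemma facet_determined (l : {scalar V}) (F : set V) :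
  determines_facet C l F -> exists2 i, (i < n)%N & F = facet_of i.
Proof.
move=> [l0 FE [k [Fk Ck]]].
have kD : k = D by have := has_dim_uniq Ck C_has_dim; case.
rewrite {}kD {Ck} in Fk.
(* If [F] lies in a known facet, both span the same space by equality of dimensions. As [l] vanishes
   on that space, the facet lies in [F] as well. *)
have [[i ii Fi]|no] := pselect (exists2 i, (i < n)%N & forall v, F v -> phi i v = 0).
  exists i => //; apply/seteqP; split=> v.
    by move=> Fv; split=> //=; [move: Fv; rewrite FE => -[]|exact: Fi].
  move=> [Cv pv]; rewrite FE; split=> //=.
  have [W [FW minW dW]] := Fk; have [W' [FW' minW' dW']] := facet_has_dim ii.
  have WW' : (W <= W')%VS.
    apply: minW => w Fw; apply: FW'; split=> //=; last exact: Fi.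
    by move: Fw; rewrite FE => -[].
  have eW : W = W' by apply/eqP; rewrite eqEdim WW' dW dW' leqnn.
  have vW : v \in W by rewrite eW; apply: FW'.
  have [K KE] := scalar_ker l; have : (W <= K)%VS.
    by apply: minW => w; rewrite FE KE => -[_ /= ->].
  by move=> /subvP/(_ v vW); rewrite KE => /eqP.
(* Otherwise each inequality is strict somewhere on [F]. The sum [q] of such points makes all of
   them strict, and still [l q = 0]. *)
have pt i : exists v, F v /\ ((i < n)%N -> 0 < phi i v).
  have [ii|ii] := ltnP i n; last first.
    by exists 0; split=> //; rewrite FE; split; [exact: C_0|rewrite /= linear0].
  have [[v Fv pv]|H] := pselect (exists2 v, F v & phi i v != 0).
    exists v; split=> // _; rewrite lt0r pv phi_ge0 //.
    by move: Fv; rewrite FE => -[].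
  case: no; exists i => // v Fv; apply/eqP; apply: contrapT => pv.
  by apply: H; exists v => //; apply/negP.
pose p i := projT1 (cid (pt i)).
have pF i : F (p i) by rewrite /p; case: cid => v [].
have pp i : (i < n)%N -> 0 < phi i (p i) by rewrite /p; case: cid => v [].
pose q := \sum_(i < n) p i.
have Cp i : C (p i) by have := pF i; rewrite FE => -[].
have lp i : l (p i) = 0 by have := pF i; rewrite FE => -[].
have Cq : C q.
  rewrite /q; elim/big_ind: _ => [|x y Cx Cy|i _]; [exact: C_0| |exact: Cp].
  by rewrite -[x]scale1r; apply: C_lin.
have lq : l q = 0 by rewrite /q linear_sum big1.
have qp i : (i < n)%N -> 0 < phi i q.
  move=> ii; rewrite /q linear_sum (bigD1 (Ordinal ii)) //= ltr_wpDr ?pp //.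
  by rewrite sumr_ge0 // => h _; apply: phi_ge0.
(* [b] bounds every ratio [phi i v / phi i q], so [(b + 1) *: q - v] stays in the cone, and
   [l q = 0] gives [l v <= 0]. Then [F] is the whole cone, against its dimension. *)
have CF v : C v -> F v.
  move=> Cv; rewrite FE; split=> //=; apply/eqP; rewrite eq_le l0 // andbT.
  pose b := \sum_(i < n) phi i v / phi i q.
  have b0 : 0 <= b.
    by apply: sumr_ge0 => i _; rewrite divr_ge0 ?phi_ge0.
  have : C ((b + 1) *: q - v).
    have [Uq _] := (C_ineq q).1 Cq; have [Uv _] := (C_ineq v).1 Cv.
    apply/C_ineq; split.
      rewrite addrC -scaleN1r; apply: U_lin => //.
      by rewrite -[_ *: q]addr0; apply: U_lin => //; apply: U_0.
    move=> i ii; rewrite linearB linearZ /= subr_ge0.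
    rewrite -ler_pdivrMr ?qp //; apply: ler_wpDr => //.
    rewrite /b (bigD1 (Ordinal ii)) //= ler_wpDr // sumr_ge0 // => h _.
    by rewrite divr_ge0 ?phi_ge0.
  by move/l0; rewrite linearB linearZ /= lq mulr0 sub0r oppr_ge0.
have FC : F = C by apply/seteqP; split=> [v|]; [rewrite FE => -[]|exact: CF].
by rewrite FC in Fk; have := has_dim_uniq Fk C_has_dim; clear; lia.
Qed.

Lemma facetsE : facets C = facet_of @` `I_n.
Proof.
apply/seteqP; split=> [F [l ll]|_ [i /= ii <-]].
  pose ls : {scalar V} := HB.pack_for {scalar V} l (GRing.isLinear.Build R V R _ l ll).
  by move=> /(@facet_determined ls)[i ii ->]; exists i.
exists (phi i); first exact: linearP.
by split; [by move=> v; apply: phi_ge0|by []|exists D; split; [exact: facet_has_dim|exact: C_has_dim]].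
Qed.

Lemma determines_facet_of (l : {scalar V}) i : (i < n)%N ->
  (forall j, (j < m)%N -> 0 <= l (g j)) ->
  (forall j, (j < m)%N -> (l (g j) == 0) = (phi i (g j) == 0)) ->
  determines_facet C l (facet_of i).
Proof.
move=> ii lg e; split; first exact: nonneg_on_gens.
  by apply: same_zeros => // j jm; [apply: phi_ge0 => //; apply: C_g|rewrite e].
by exists D; split; [exact: facet_has_dim|exact: C_has_dim].
Qed.

End DoubleDescription.

(** The form attached to the first vector vanishes on the span of the others but not at that
    vector. *)
Lemma free_triangular (R : realType) (V : vectType R) (I : eqType)
    (v : I -> V) (f : I -> {scalar V}) (t : seq I) :
  (forall p, p \in t -> f p (v p) != 0) ->
  pairwise (fun p q => f p (v q) == 0) t ->
  free [seq v p | p <- t].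
Proof.
elim: t => [|p t IH] nz; first by rewrite nil_free.
rewrite /= free_cons => /andP[/allP ps /IH ->]; last by move=> q qt; apply: nz; rewrite inE qt orbT.
rewrite andbT; apply: contra (nz p (mem_head _ _)) => pin.
have [K KE] := scalar_ker (f p); have : (<<[seq v q | q <- t]>> <= K)%VS.
  by apply/span_subvP => w /mapP[q qt ->]; rewrite KE; apply: ps.
by move=> /subvP/(_ _ pin); rewrite KE.
Qed.

(** * Validity of the inequalities *)

(** For [T] inside [V]: a factor [k] for each rank outside [V], and [k - 2] for each rank in [T].
    Inclusion-exclusion over the subsets of [T] turns the product into [2 ^ size] times the form of
    [FB T V], and at most one element of [T] in each maximal interval of [V] is what [steps_ok]
    demands. *)
Definition steps (T V : seq nat) : seq (bool * nat) :=
  [seq (k \notin V, k) | k <- iota 1 6 & (k \notin V) || (k \in T)].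

(** The coefficient of [L_q] once each flag number is replaced by its expansion [flE]. *)
Definition toL (c : comb) (q : seq nat) : Z :=
  sumZ [seq (p.1 * 2 ^ Z.of_nat (size p.2))%BZ | p <- c & disj p.2 q].

Definition ineq_ok (f : ineq) : bool :=
  match f with
  | FB T V => let st := steps T V in let c := unfold_steps st in
      [&& steps_ok 0 7 st, all (fun p => p.2 \in S6) c &
        all (fun q => Z.eqb (toL c q) (2 ^ Z.of_nat (size st) * lam f q)%BZ) E13]
  | FC i j k => (0 < i < j)%N && (j < k < 7)%N
  end.

Lemma ineqs_ok : all ineq_ok ineqs. Proof. by vm_compute. Qed.

Definition pivot_ok : bool :=
  all (fun t : seq nat => all (fun b => let pre := [seq k <- t | (k < b)%N] in
    let l := [seq k <- t | (b < k)%N] in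
    ((b \in t) && ((b.+1 \in t) || (b == 6))) ==> all (fun p => p.2 \in S6) (gds 7 pre l)) (iota 0 7)) S6.

Lemma pivots_ok : pivot_ok. Proof. by vm_compute. Qed.

Lemma gds_reduce : gds_ok. Proof. by vm_compute. Qed.

Lemma mem_zip1 (T1 T2 : eqType) (s : seq T1) (t : seq T2) p :
  p \in zip s t -> p.1 \in s.
Proof.
elim: s t => [|x s IH] [|y t] //=; rewrite !inE => /orP[/eqP->|/IH->]; rewrite ?eqxx ?orbT //.
Qed.

Lemma continuous_lincomb (R : realType) (V : topologicalType) (I : Type) (r : seq I)
    (P : pred I) (a : I -> R) (f : I -> V -> R) : (forall i, continuous (f i)) ->
  continuous (fun v => \sum_(i <- r | P i) a i * f i v).
Proof.
move=> fc; apply: (@continuous_big R I +%R 0 P _ V r (fun i v => a i * f i v)).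
  exact: add_continuous.
by move=> i _ v; apply: cvgMl_tmp; exact: fc.
Qed.

Definition ineq_nth (i : nat) : ineq := nth (FC 0 0 0) ineqs i.

Section Validity.
Variable R : realType.
Local Notation V0 := 'rV[R]_#|{set 'I_6}|.

Definition phi (f : ineq) (v : V0) : R := \sum_(q <- S6) zr R (lam f q) * Lq v q.

Lemma Lq_linear q : scalar (fun v : V0 => Lq v q).
Proof. by move=> a v w; rewrite /Lq linearP. Qed.

Lemma phi_linear f : scalar (phi f).
Proof.
move=> a v w; rewrite /phi /= mulr_sumr -big_split; apply: eq_bigr => q _.
by rewrite Lq_linear mulrDr mulrCA.
Qed.

HB.instance Definition _ f :=
  GRing.isLinear.Build R V0 R _ (phi f) (phi_linear f).

Definition odd_zero (v : V0) : Prop := forall q, q \in S6 -> q \notin E13 -> Lq v q = 0.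

Lemma E13_S6 : {subset E13 <= S6}.
Proof. by apply/allP; vm_compute. Qed.

Lemma E13_uniq : uniq E13. Proof. by vm_compute. Qed.

Lemma big_E13 (v : V0) (F : seq nat -> R) : odd_zero v ->
  (forall q, Lq v q = 0 -> F q = 0) ->
  \sum_(q <- S6) F q = \sum_(q <- E13) F q.
Proof.
move=> ov F0; rewrite (bigID (fun q => q \in E13)) /= [X in _ + X]big1_seq ?addr0; last first.
  by move=> q /andP[qE qS]; apply: F0; apply: ov.
rewrite -big_filter; apply: perm_big; apply: uniq_perm; rewrite ?filter_uniq ?S6_uniq ?E13_uniq //.
by move=> q; rewrite mem_filter; case: (boolP (q \in E13)) => // /E13_S6 ->.
Qed.

Lemma S6_12 : all (fun i => all (fun k =>
  ((0 < i < 7) ==> ([:: i] \in S6)) && ((0 < i < k) ==> ([:: i; k] \in S6)))%N (iota 0 7)) (iota 0 7).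
Proof. by vm_compute. Qed.

Lemma S6_1 i : (0 < i < 7)%N -> [:: i] \in S6.
Proof.
move=> i07; have im : i \in iota 0 7 by rewrite mem_iota; case/andP: i07.
by have /andP[/implyP H _] := allP (allP S6_12 i im) i im; apply: H.
Qed.

Lemma S6_2 i k : (0 < i < k)%N -> (k < 7)%N -> [:: i; k] \in S6.
Proof.
move=> ik k7; have km : k \in iota 0 7 by rewrite mem_iota.
have im : i \in iota 0 7 by rewrite mem_iota; case/andP: ik => _ /ltn_trans; apply.
by have /andP[_ /implyP H] := allP (allP S6_12 i im) k km; apply: H.
Qed.

Lemma phi_FC i j k (v : V0) : (0 < i < j)%N -> (j < k < 7)%N ->
  4 * phi (FC i j k) v =
  fl v [:: i; k] - 2 * fl v [:: i] - 2 * fl v [:: k] + 2 * fl v [:: j].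
Proof.
move=> /andP[i0 ij] /andP[jk k7].
have j7 := ltn_trans jk k7; have i7 := ltn_trans ij j7.
have j0 := ltn_trans i0 ij; have k0 := ltn_trans j0 jk.
have fE t : t \in S6 -> fl v t =
    2 ^+ size t * \sum_(q <- S6) zr R (if disj t q then 1 else 0)%BZ * Lq v q.
  move=> tS; rewrite flE // big_mkcond; congr (_ * _); apply: eq_bigr => q _.
  by case: ifP => _; rewrite ?zr1 ?zr0 ?mul1r ?mul0r.
rewrite !fE ?S6_1 ?i0 ?j0 ?k0 //; last by rewrite S6_2 // i0 (ltn_trans ij jk).
rewrite /phi /lam.
under eq_bigr => q _ do rewrite zrD !zrB !mulrDl !mulNr.
by rewrite !big_split /= !sumrN; ring.
Qed.

Section EulerianVector.
Variables (d : Order.disp_t) (P : finTBPOrderType d) (rho : P -> nat).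
Hypothesis rank : is_rank_function rho.
Hypothesis rank_top : rho \top%O = 7.
Hypothesis eul : is_Eulerian rho.

Let v : V0 := to_flag (fun S : {set 'I_6} =>
  (flag_number (fun x y : P => (x < y)%O) rho S)%:R).
Let h := flagsP R rho 7.

Lemma chains_rcons_top (x : P) (l : seq nat) : (rho x < 7)%N ->
  all (fun s => s < 7)%N l ->
  chains (fun x y : P => (x < y)%O) rho x (rcons l 7) =
  chains (fun x y : P => (x < y)%O) rho x l.
Proof.
elim: l x => [|s l IH] x x7 /=.
  move=> _; have := @chain_to_top R _ P rho 7 rank rank_top x x7.
  by move/eqP; rewrite pnatr_eq1 => /eqP.
case/andP=> s7 l7; apply: eq_bigr => y /andP[_ /eqP ys].
by apply: IH => //; rewrite ys.
Qed.

Lemma fl_flags t : t \in S6 -> fl v t = h t.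
Proof.
move=> tS; rewrite /fl /v to_flagK flag_numberE; last by move=> x y; apply: rank_lt.
rewrite ranks_rset // /h /flagsP chains_rcons_top; first last.
- by apply/allP=> s /(S6_sub tS) /andP[_]; rewrite ltnS.
- by rewrite (proj1 rank).
rewrite chains0_bot ?(proj1 rank) //.
by apply/negP=> /(S6_sub tS).
Qed.

Lemma ev_fl_flags (c : comb) : all (fun p => p.2 \in S6) c -> ev (fl v) c = ev h c.
Proof.
move=> /allP cS; apply: eq_big_seq => p /cS pS; congr (_ * _); exact: fl_flags.
Qed.

Lemma ev_dense (k : seq nat -> R) (c : comb) : all (fun p => p.2 \in S6) c ->
  ev k (zip (coefs c) S6) = ev k c.
Proof.
move=> cS; rewrite (ev_coef k S6_uniq cS) /ev /coefs -{2}[S6]map_id zip_map big_map.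
by [].
Qed.

Lemma ev_lcomb (k : seq nat -> R) a b (K : seq (seq nat)) (x y : seq Z) :
  size x = size K -> size y = size K ->
  ev k (zip (lcomb a b x y) K) = zr R a * ev k (zip x K) + zr R b * ev k (zip y K).
Proof.
rewrite /ev; elim: K x y => [|l K IH] [|c x] [|e y] //=.
  by rewrite !big_nil !mulr0 addr0.
move=> [sx] [sy]; rewrite !big_cons /= IH //= zrD !zrM.
by ring.
Qed.

Lemma pivotsP p : p \in pivots ->
  size p.2 = size S6 /\ ev h (zip p.2 S6) = 0.
Proof.
case/flattenP=> s /mapP[t tS ->]; lazy zeta.
set b := find (fun b => (b \in t) && ((b.+1 \in t) || (b == 6))) (iota 0 7).
case: ifP => // b7.
rewrite inE => /eqP ->; rewrite [(_, _).2]/(coefs _); split; first by rewrite /coefs size_map.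
rewrite ev_dense ?gds0 //.
have := allP pivots_ok t tS => /allP/(_ b); rewrite mem_iota => /(_ b7) /implyP; apply.
have := @nth_find _ 0%N (fun b => (b \in t) && ((b.+1 \in t) || (b == 6))) (iota 0 7).
by rewrite has_find size_iota => /(_ b7); rewrite nth_iota.
Qed.

Lemma ev_reduce (w : seq Z) : size w = size S6 ->
  ev h (zip (reduce w) S6) = ev h (zip w S6).
Proof.
rewrite /reduce; have : {subset pivots <= pivots} by [].
move: {1 3}pivots => ps; elim: ps w => [|p ps IH] w sub sw //=.
have [sp ep] := pivotsP (sub p (mem_head _ _)).
have sub' : {subset ps <= pivots} by move=> q qs; apply: sub; rewrite inE qs orbT.
case: ifP => _; first exact: IH.
rewrite IH //; last by rewrite size_map size_zip sw sp minnn.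
by rewrite ev_lcomb // ep mulr0 addr0 zr1 mul1r.
Qed.

Lemma Eulerian_odd_zero : odd_zero v.
Proof.
move=> q qS qE.
have cS : all (fun p => p.2 \in S6) (Lcomb q).
  by apply/allP=> p /mapP[t]; rewrite mem_filter => /andP[_ tS] ->.
have : 2 ^+ 6 * Lq v q = 0.
  rewrite -ev_Lcomb // ev_fl_flags // -ev_dense // -ev_reduce ?/coefs ?size_map //.
  have := allP gds_reduce q qS; rewrite (negPf qE) orFb => /allP z.
  apply: big1_seq => p /andP[_ pz].
  have /Z.eqb_eq -> : Zeq0 p.1.
    by apply: z; apply: mem_zip1 pz.
  by rewrite zr0 mul0r.
by move/eqP; rewrite mulf_eq0 expf_eq0 pnatr_eq0 /= => /eqP.
Qed.

Lemma ev_toL (w : V0) (c : comb) : all (fun p => p.2 \in S6) c ->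
  ev (fl w) c = \sum_(q <- S6) zr R (toL c q) * Lq w q.
Proof.
move=> /allP cS.
under [RHS]eq_bigr => q _ do rewrite /toL /sumZ zr_sum big_filter mulr_suml big_mkcond /=.
rewrite exchange_big /=; apply: eq_big_seq => p /cS pS.
rewrite flE // !mulr_sumr big_mkcond; apply: eq_bigr => q _; case: ifP => // _.
by rewrite zrM zrX mulrA.
Qed.

Lemma Eulerian_phi_ge0 i : (i < 23)%N -> 0 <= phi (ineq_nth i) v.
Proof.
move=> i23; have := (all_nthP (FC 0 0 0) ineqs_ok) i i23.
rewrite -/(ineq_nth i); case: (ineq_nth i) => [T W|a b c]; rewrite /ineq_ok; lazy zeta.
  set st := steps T W => /and3P[ok cS /allP e].
  have E : 2 ^+ size st * phi (FB T W) v = ev h (unfold_steps st).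
    rewrite -ev_fl_flags // ev_toL // (big_E13 Eulerian_odd_zero); last first.
      by move=> q ->; rewrite mulr0.
    rewrite /phi (big_E13 Eulerian_odd_zero); last by move=> q ->; rewrite mulr0.
    rewrite mulr_sumr; apply: eq_big_seq => q /e /Z.eqb_eq ->.
    by rewrite zrM zrX mulrA.
  have p0 : 0 < 2 ^+ size st :> R by rewrite exprn_gt0.
  rewrite -(pmulr_rge0 _ p0) E.
  exact: flags_expand_ge0.
case/andP=> ab bc.
rewrite -(pmulr_rge0 _ (ltr0Sn R 3)) phi_FC //.
case/andP: ab bc => a0 ab /andP[bc c7].
have b7 := ltn_trans bc c7; have a7 := ltn_trans ab b7.
have b0 := ltn_trans a0 ab; have c0 := ltn_trans b0 bc.
rewrite !fl_flags ?S6_1 ?a0 ?b0 ?c0 //; last by rewrite S6_2 // a0 (ltn_trans ab bc).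
exact: typeC_flags.
Qed.

End EulerianVector.

Definition Kcone (v : V0) : Prop :=
  odd_zero v /\ forall i, (i < 23)%N -> 0 <= phi (ineq_nth i) v.

Lemma flag_coord_continuous (S : {set 'I_6}) : continuous (fun v : V0 => flag_coord v S).
Proof. exact: coord_continuous. Qed.

Lemma Lq_continuous q : continuous (fun v : V0 => Lq v q).
Proof.
have -> : (fun v : V0 => Lq v q) = (fun v => \sum_(T : {set 'I_6} | ~: rset 6 q \subset T)
    ((-1) ^+ (6 - #|rset 6 q|) * (- 2^-1) ^+ #|T|) * flag_coord v T).
  apply/funext => v; rewrite /Lq /flag_L mulr_sumr.
  by apply: eq_bigr => T _; rewrite mulrA.
exact: (@continuous_lincomb R V0 _ _ _ _ _ flag_coord_continuous).
Qed.

Lemma phi_continuous f : continuous (phi f).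
Proof.
exact: (@continuous_lincomb R V0 _ S6 xpredT (fun q => zr R (lam f q))
  (fun q v => Lq v q) Lq_continuous).
Qed.

Lemma Eulerian_cone_Kcone : Eulerian_cone R 6 `<=` Kcone.
Proof.
have hull v : cone_hull (@Eulerian_flag_vectors R 6) v -> Kcone v.
  move=> [k [c [x [c0 Xx ->]]]]; split=> [q qS qE|i ii].
    rewrite /Lq linear_sum big1 // => j _; rewrite linearZ /=.
    have [d [P [rho [rk rt eu ->]]]] := Xx j.
    by rewrite -/(Lq _ q) (Eulerian_odd_zero rk rt eu qS qE) mulr0.
  rewrite linear_sum sumr_ge0 // => j _; rewrite linearZ mulr_ge0 //=.
  have [d [P [rho [rk rt eu ->]]]] := Xx j.
  exact: Eulerian_phi_ge0.
(* Every condition in [Kcone] is closed and so passes from the hull to its closure. *)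
have cl (D : set V0) : closed D -> cone_hull (@Eulerian_flag_vectors R 6) `<=` D ->
    Eulerian_cone R 6 `<=` D.
  by move=> cD /closure_subset; rewrite -((closure_id D).1 cD).
move=> v Cv; split=> [q qS qE|i ii].
  apply: (cl [set w | Lq w q = 0] _ _ v Cv) => [|w /hull[H _]]; last exact: H.
  by apply: (@preimage_closed _ _ (fun w => Lq w q) [set x | x = 0]) => [w _|];
    [exact: Lq_continuous|exact: closed_eq].
apply: (cl [set w | 0 <= phi (ineq_nth i) w] _ _ v Cv) => [|w /hull[_ H]]; last exact: H.
by apply: (@preimage_closed _ _ (phi (ineq_nth i)) [set x | 0 <= x]) => [w _|];
  [exact: phi_continuous|exact: closed_ge].
Qed.

End Validity.

(** * The generators *)

Definition sk_nth (j : nat) : skeleton := nth [::] skeletons j.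

Lemma skeletons_good : all good_skeleton skeletons.
Proof. by vm_compute. Qed.

Lemma paths_bound : all (fun sk => all (fun t =>
  all (fun e => e <= ncoords sk)%N (paths sk (0%N, [::]) t)) S6) skeletons.
Proof. by vm_compute. Qed.

Lemma sk_good (j : 'I_24) : good_skeleton (sk_nth j).
Proof. exact: (all_nthP [::] skeletons_good). Qed.

Definition slack (i j : nat) : Z := nth 0%BZ (nth [::] slacks j) i.

Definition Lval (j : nat) (q : seq nat) : Z := nth 0%BZ (nth [::] LL j) (index q S6).

Lemma LL_odd : all (fun j => all (fun q => (q \in E13) || Zeq0 (Lval j q)) S6) (iota 0 24).
Proof. by vm_compute. Qed.

Lemma phisE i : (i < 23)%N ->
  nth [::] phis i = [seq lam (ineq_nth i) q | q <- E13].
Proof. by move=> ii; rewrite (nth_map (FC 0 0 0)). Qed.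

Section Generators.
Variable R : realType.
Local Notation V0 := 'rV[R]_#|{set 'I_6}|.

Definition gvec (j : nat) : V0 := to_flag (fun S : {set 'I_6} =>
  2 ^+ #|S| * (half_count (sk_nth j) (ranks S))%:R).

Lemma Lq_half (h : seq nat -> nat) (v : V0) :
  (forall t, t \in S6 -> fl v t = 2 ^+ size t * (h t)%:R) ->
  forall q, q \in S6 -> Lq v q = zr R (LLof h q).
Proof.
move=> vh q qS; rewrite LqE // /LLof /sumZ zr_sum big_filter mulr_sumr.
rewrite big_seq_cond [RHS]big_seq_cond; apply: eq_bigr => t /andP[tS _].
rewrite vh // zrM zr_sgZ zr_nat exprD -!mulrA; congr (_ * _).
rewrite !mulrA; congr (_ * _); rewrite -exprMn mulNr mulVf ?pnatr_eq0 //.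
Qed.

Lemma fl_gvec j t : t \in S6 -> fl (gvec j) t = 2 ^+ size t * (half_count (sk_nth j) t)%:R.
Proof. by move=> tS; rewrite /fl /gvec to_flagK ranks_rset // card_rset. Qed.

Lemma Lq_gvec j q : (j < 24)%N -> q \in S6 -> Lq (gvec j) q = zr R (Lval j q).
Proof.
move=> jj qS; rewrite (Lq_half (@fl_gvec j)) // /Lval -LLE.
rewrite (nth_map [::]) // -/(sk_nth j) (nth_map [::]) ?index_mem // nth_index //.
congr (zr R _); rewrite /LLof; congr sumZ.
apply/eq_in_map => t; rewrite mem_filter => /andP[_ tS]; congr (_ * Z.of_nat _)%BZ.
have e1 : unzip1 [seq (t, half_count (sk_nth j) t) | t <- S6] = S6.
  by rewrite /unzip1 -map_comp; exact: map_id.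
have e2 : unzip2 [seq (t, half_count (sk_nth j) t) | t <- S6] =
    [seq half_count (sk_nth j) t | t <- S6] by rewrite /unzip2 -map_comp.
by rewrite e1 e2 (nth_map [::]) ?index_mem // nth_index.
Qed.

Lemma gvec_odd_zero j : (j < 24)%N -> odd_zero (gvec j).
Proof.
move=> jj q qS qE; rewrite Lq_gvec //.
have jm : j \in iota 0 24 by rewrite mem_iota.
have := allP (allP LL_odd j jm) q qS; rewrite (negPf qE) orFb => /Z.eqb_eq ->.
by rewrite zr0.
Qed.

Definition xv (v : V0) : 'rV[R]_13 := \row_i Lq v (nth [::] E13 i).

Lemma phi_lf i (v : V0) : (i < 23)%N -> odd_zero v ->
  phi (ineq_nth i) v = lf (nth [::] phis i) (xv v).
Proof.
move=> ii ov; rewrite /phi (big_E13 ov); last by move=> q ->; rewrite mulr0.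
rewrite phisE // /lf (big_nth [::]) big_mkord; apply: eq_bigr => k _.
by rewrite mxE (nth_map [::]).
Qed.

Lemma gens_nth j : (j < 24)%N -> nth [::] gens j = [seq Lval j q | q <- E13].
Proof. by move=> jj; rewrite -gensE (nth_map [::]). Qed.

Lemma xv_gvec j : (j < 24)%N -> xv (gvec j) = zv R (nth [::] gens j).
Proof.
move=> jj; apply/rowP=> k; rewrite !mxE gens_nth // (nth_map [::]) // Lq_gvec //.
by apply: E13_S6; apply: mem_nth.
Qed.

Lemma phi_gvec i j : (i < 23)%N -> (j < 24)%N ->
  phi (ineq_nth i) (gvec j) = zr R (slack i j).
Proof.
move=> ii jj; rewrite phi_lf //; last exact: gvec_odd_zero.
rewrite xv_gvec // lf_zv; first last.
- by apply/eqP; apply: (all_nthP [::] gens_dims).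
- by apply/eqP; apply: (all_nthP [::] phis_dims).
by rewrite /slack -slacksE (nth_map [::]) // (nth_map [::]).
Qed.

Lemma Kcone_comb v : Kcone v ->
  exists2 c : nat -> R, (forall j, 0 <= c j) & v = \sum_(j < 24) c j *: gvec j.
Proof.
move=> [ov pv].
have : cone (gen_by gens) (xv v).
  apply: dd_sound => l /(nthP [::])[i ii <-].
  by rewrite -phi_lf //; apply: pv.
move=> C; have : cone (fun w => exists2 j, (j < 24)%N & w = zv R (nth [::] gens j)) (xv v).
  apply: cone_sub C => w [s /(nthP [::])[j jj <-] ->]; apply: cone_gen.
  by exists j.
case/cone_sum=> c c0 xE; exists c => //; apply: Lq_inj => q qS.
rewrite {2}/Lq linear_sum /=.
have [qE|qE] := boolP (q \in E13); last first.
  rewrite ov // big1 // => j _; rewrite linearZ /= -/(Lq _ q).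
  by rewrite gvec_odd_zero // mulr0.
have /(nthP [::])[k kk kq] := qE.
have := congr1 (fun w : 'rV[R]_13 => w 0 (Ordinal kk)) xE.
rewrite mxE /= kq => ->; rewrite summxE; apply: eq_bigr => j _.
by rewrite linearZ /= -/(Lq _ q) -xv_gvec // !mxE /= kq.
Qed.

Lemma cvg_row (p : nat) (u : nat -> 'rV[R]_p) (v : 'rV[R]_p) :
  (forall i, (fun N => u N 0 i) @ \oo --> v 0 i) -> u @ \oo --> v.
Proof.
move=> uv; apply/cvg_ballP => e e0.
have : \forall N \near \oo, forall i, ball (v 0 i) e (u N 0 i).
  by apply: filter_forall => i; have /cvg_ballP := uv i; apply.
apply: filterS => N H; split=> // i j; rewrite ord1; exact: H.
Qed.

Definition fvec (j : 'I_24) (N : nat) : V0 := to_flag (fun S : {set 'I_6} =>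
  (flag_number (fun x y : skeleton_poset (sk_good j) N => (x < y)%O)
    (@elt_rank (sk_nth j) N) S)%:R).

Lemma fvec_Eulerian j N : @Eulerian_flag_vectors R 6 (fvec j N).
Proof.
exists _, (skeleton_poset (sk_good j) N), (@elt_rank (sk_nth j) N).
by split=> //; [exact: skel_rank|exact: skel_Eulerian].
Qed.

(** Each flag number is a polynomial in [N + 1], of degree at most the number of coordinates by
    [paths_bound]; the limit extracts the coefficient in that degree. *)
Lemma fvec_cvg (j : 'I_24) (S : {set 'I_6}) :
  (fun N => (N.+1%:R ^+ ncoords (sk_nth j))^-1 * flag_coord (fvec j N) S) @ \oo
    --> flag_coord (gvec j) S.
Proof.
rewrite /gvec to_flagK.
set k := ncoords _; set ps := paths (sk_nth j) (0%N, [::]) (ranks S).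
have -> : (fun N => (N.+1%:R ^+ k)^-1 * flag_coord (fvec j N) S) =
    (fun N => \sum_(e <- ps) 2 ^+ #|S| * ((N.+1 ^ e)%:R / N.+1%:R ^+ k) : R).
  apply/funext=> N; rewrite to_flagK skel_flag_number natrM natrX natr_sum.
  rewrite mulrCA -[RHS]mulr_sumr; congr (_ * _).
  by rewrite mulr_sumr; apply: eq_bigr => e _; rewrite mulrC.
have -> : 2 ^+ #|S| * (half_count (sk_nth j) (ranks S))%:R =
    \sum_(e <- ps) 2 ^+ #|S| * (e == k)%:R :> R.
  rewrite -mulr_sumr -natr_sum; congr (_ * _%:R).
  by rewrite /half_count -sum1_count big_mkcond; apply: eq_bigr => e _ /=; case: (e == k).
have psE : ps = [seq e <- ps | (e <= k)%N].
  apply/esym/all_filterP; have := all_nthP [::] paths_bound (nat_of_ord j) (ltn_ord j).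
  by move=> /allP/(_ _ (ranks_S6 S)).
rewrite psE big_filter; under eq_fun do rewrite big_filter.
apply: (@cvg_big R nat +%R 0 (fun e => e <= k)%N _ nat \oo ps
  (fun e N => 2 ^+ #|S| * ((N.+1 ^ e)%:R / N.+1%:R ^+ k))
  (fun e => 2 ^+ #|S| * (e == k)%:R)).
  exact: add_continuous.
by move=> e ek; apply: cvgMl_tmp; exact: cvg_power_ratio.
Qed.

Lemma comb_in_cone (c : nat -> R) : (forall j, 0 <= c j) ->
  Eulerian_cone R 6 (\sum_(j < 24) c j *: gvec j).
Proof.
move=> c0.
(* Finite Eulerian posets approximate all generators at once, each scaled by its own power of
   [N + 1]. *)
pose u N : V0 := \sum_(j < 24) (c j / N.+1%:R ^+ ncoords (sk_nth j)) *: fvec j N.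
have hu N : cone_hull (@Eulerian_flag_vectors R 6) (u N).
  exists 24, (fun j : 'I_24 => c j / N.+1%:R ^+ ncoords (sk_nth j)), (fun j => fvec j N).
  split=> // [j|j]; first by rewrite divr_ge0 // exprn_ge0.
  exact: fvec_Eulerian.
have cu : u @ \oo --> (\sum_(j < 24) c j *: gvec j : V0).
  apply: cvg_row => i.
  have -> : (fun N => u N 0 i) = (fun N => \sum_(j < 24) c j *
      ((N.+1%:R ^+ ncoords (sk_nth j))^-1 * flag_coord (fvec j N) (enum_val i))).
    apply/funext => N; rewrite /u summxE; apply: eq_bigr => j _.
    by rewrite mxE mulrA /flag_coord enum_valK.
  have -> : (\sum_(j < 24) c j *: gvec j : V0) 0 i =
      \sum_(j < 24) c j * flag_coord (gvec j) (enum_val i).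
    by rewrite summxE; apply: eq_bigr => j _; rewrite mxE /flag_coord enum_valK.
  apply: (@cvg_big R 'I_24 +%R 0 xpredT _ nat \oo _
    (fun j N => c j * ((N.+1%:R ^+ ncoords (sk_nth j))^-1 * flag_coord (fvec j N) (enum_val i)))
    (fun j => c j * flag_coord (gvec j) (enum_val i))).
    exact: add_continuous.
  by move=> j _; apply: cvgMl_tmp; exact: fvec_cvg.
apply: (closed_cvg _ (@closed_closure _ _) _ _ cu).
by apply: nearW => N; apply: subset_closure; apply: hu.
Qed.

(** The inclusions form a cycle: the Eulerian cone lies in [Kcone] by validity, [Kcone] in the span
    of the generators by double description, and that span in the Eulerian cone by limits. *)
Theorem Eulerian_coneP (v : V0) :
  [/\ Eulerian_cone R 6 v <-> Kcone v &
   Eulerian_cone R 6 v <-> exists2 c : nat -> R, (forall j, 0 <= c j) &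
     v = \sum_(j < 24) c j *: gvec j].
Proof.
split; split.
- exact: Eulerian_cone_Kcone.
- by case/Kcone_comb=> c c0 ->; apply: comb_in_cone.
- by move=> /Eulerian_cone_Kcone/Kcone_comb.
- by case=> c c0 ->; apply: comb_in_cone.
Qed.

End Generators.

(** * Extreme rays and facets of the cone *)

Definition vanish (i j : nat) : bool := Zeq0 (slack i j).

Lemma gens_separated : all (fun j => all (fun h => (j == h) ||
  has (fun i => vanish i j && ~~ vanish i h) (iota 0 23)) (iota 0 24)) (iota 0 24).
Proof. by vm_compute. Qed.

Lemma ineqs_separated : all (fun i => all (fun k => (i == k) ||
  has (fun j => vanish i j && ~~ vanish k j) (iota 0 24)) (iota 0 23)) (iota 0 23).
Proof. by vm_compute. Qed.

Definition zeros (i : nat) : seq nat := [seq j <- iota 0 24 | vanish i j].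

(* Pairs (j, i) of a generator and an inequality with triangular incidence: each
   step restricts to a proper face of s having as many generators as possible,
   and records a generator outside it. *)
Fixpoint face_chain (fuel : nat) (s : seq nat) : seq (nat * nat) :=
  if fuel is f.+1 then
    if s is [::] then [::] else
    let cnt i := count (vanish i) s in
    let i0 := foldr (fun i b => if (cnt i < size s)%N && ((cnt b == size s) || (cnt b < cnt i)%N)
                               then i else b) 0%N (iota 0 23) in
    (nth 0%N s (find (fun j => ~~ vanish i0 j) s), i0) ::
      face_chain f [seq j <- s | vanish i0 j]
  else [::].

Definition full_chain (i : nat) : seq (nat * nat) :=
  (find (fun j => ~~ vanish i j) (iota 0 24), i) :: face_chain 13 (zeros i).

(** One generator off the facet [i], followed by 12 on it. Triangular incidence makes the 13
    independent, which yields the dimensions of both the cone and the facet. *)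
Definition chain_ok (i : nat) (t : seq (nat * nat)) : bool :=
  [&& size t == 13%N, all (fun p => (p.1 < 24) && (p.2 < 23))%N t,
      all (fun p => ~~ vanish p.2 p.1) t,
      pairwise (fun p q => vanish p.2 q.1) t &
      ~~ vanish i (head (0, 0)%N t).1 && all (fun p => vanish i p.1) (behead t)].

Lemma chains_ok : all (fun i => chain_ok i (full_chain i)) (iota 0 23).
Proof. by vm_compute. Qed.

Section Geometry.
Variable R : realType.
Local Notation V0 := 'rV[R]_#|{set 'I_6}|.
Local Notation g := (@gvec R).
Let ph (i : nat) : {scalar V0} := phi (ineq_nth i).
Local Notation C := (Eulerian_cone R 6).

Lemma vanishE i j : (i < 23)%N -> (j < 24)%N -> (ph i (g j) == 0) = vanish i j.
Proof. by move=> ii jj; rewrite /ph /= phi_gvec // zr_eq0. Qed.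

Lemma in_iota0 m k : (k \in iota 0 m) = (k < m)%N.
Proof. by rewrite mem_iota add0n. Qed.

Lemma Eulerian_cone_gen v : C v <-> exists2 c : nat -> R, (forall j, 0 <= c j) &
   v = \sum_(j < 24) c j *: g j.
Proof. by have [] := Eulerian_coneP v. Qed.

Lemma Eulerian_cone_ineq v : C v <-> odd_zero v /\ forall i, (i < 23)%N -> 0 <= ph i v.
Proof. by have [] := Eulerian_coneP v. Qed.

Lemma odd_zero_lin a (v w : V0) : odd_zero v -> odd_zero w -> odd_zero (a *: v + w).
Proof. by move=> ov ow q qS qE; rewrite Lq_linear ov ?ow ?mulr0 ?addr0. Qed.

Lemma sep_g j h : (j < 24)%N -> (h < 24)%N -> j != h ->
  exists i, [/\ (i < 23)%N, ph i (g j) = 0 & ph i (g h) != 0].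
Proof.
move=> jj hh jh.
have := allP (allP gens_separated j _) h; rewrite !in_iota0 (negPf jh) => /(_ jj hh) /hasP[i].
rewrite in_iota0 => ii /andP[ij ih]; exists i; split=> //; last by rewrite vanishE.
by apply/eqP; rewrite vanishE.
Qed.

Lemma sep_ph i k : (i < 23)%N -> (k < 23)%N -> i != k ->
  exists j, [/\ (j < 24)%N, ph i (g j) = 0 & ph k (g j) != 0].
Proof.
move=> ii kk ik.
have := allP (allP ineqs_separated i _) k; rewrite !in_iota0 (negPf ik) => /(_ ii kk) /hasP[j].
rewrite in_iota0 => jj /andP[ij kj]; exists j; split=> //; last by rewrite vanishE.
by apply/eqP; rewrite vanishE.
Qed.

(** By [flE], these are the flag vectors with a single nonzero L-coordinate [L_q = 1]. *)
Definition basis13 : seq V0 :=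
  [seq to_flag (fun S : {set 'I_6} => 2 ^+ #|S| * (disj (ranks S) q)%:R) | q <- E13].

Lemma odd_zero_span v : odd_zero v -> v \in <<basis13>>%VS.
Proof.
move=> ov.
have -> : v = \sum_(q <- E13) Lq v q *:
    to_flag (fun S : {set 'I_6} => 2 ^+ #|S| * (disj (ranks S) q)%:R).
  apply/rowP=> i; set S := enum_val i.
  have -> : v 0 i = fl v (ranks S) by rewrite /fl rset_ranks /flag_coord enum_valK.
  rewrite flE ?ranks_S6 // size_ranks big_mkcond (big_E13 ov); last first.
    by move=> q ->; case: ifP.
  rewrite mulr_sumr summxE; apply: eq_bigr => q _; rewrite !mxE -/S mulrCA.
  by congr (_ * _); case: (disj _ _); rewrite ?mulr1 ?mulr0.
rewrite big_seq; apply: memv_suml => q qE; apply: memvZ; apply: memv_span.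
by apply/mapP; exists q.
Qed.

Let G := [seq g j | j <- iota 0 24].

Lemma dim_G_le : (\dim <<G>> <= 13)%N.
Proof.
apply: leq_trans (_ : \dim <<basis13>> <= _)%N; last by apply: leq_trans (dim_span _) _; rewrite size_map.
apply: dimvS; apply/span_subvP => v /mapP[j]; rewrite in_iota0 => jj ->.
by apply: odd_zero_span; apply: gvec_odd_zero.
Qed.

Lemma chain_free i t : chain_ok i t -> free [seq g p.1 | p <- t].
Proof.
case/and5P=> _ /allP bd /allP nz pw _.
apply: (@free_triangular R V0 _ (fun p => g p.1) (fun p => ph p.2)) => [p pt|].
  by have /andP[p1 p2] := bd p pt; rewrite vanishE ?nz.
rewrite (@eq_in_pairwise _ (mem t) _ (fun p q => vanish p.2 q.1) _ t (allss t)) // => p q pt qt; have /andP[_ p2] := bd p pt; have /andP[q1 _] := bd q qt.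
exact: vanishE.
Qed.

Lemma exists_chain i : (i < 23)%N -> exists t, chain_ok i t.
Proof. by move=> ii; exists (full_chain i); apply: (allP chains_ok); rewrite in_iota0. Qed.

Lemma dim_G : \dim <<G>> = 13%N.
Proof.
apply/eqP; rewrite eqn_leq dim_G_le /=.
have [t tok] := exists_chain (isT : 0 < 23)%N.
have /and5P[/eqP s13 /allP bd _ _ _] := tok.
apply: leq_trans (_ : \dim <<[seq g p.1 | p <- t]>> <= _)%N.
  by have /eqP -> := chain_free tok; rewrite size_map s13.
apply: dimvS; apply/span_subvP => _ /mapP[p pt ->]; apply: memv_span.
by have /andP[p1 _] := bd p pt; apply: (map_f g); rewrite in_iota0.
Qed.

Lemma dim_face i : (i < 23)%N -> \dim <<gens_on 24 g ph i>> = 12%N.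
Proof.
move=> ii; have [[//|p0 t] tok] := exists_chain ii.
have := chain_free tok; rewrite map_cons free_cons => /andP[_ /eqP fr].
have /and5P[/eqP [s12] /allP bd _ _ /andP[nz /allP vz]] := tok.
rewrite size_map s12 in fr.
have le : (12 <= \dim <<gens_on 24 g ph i>>)%N.
  apply: leq_trans (_ : \dim <<[seq g p.1 | p <- t]>> <= _)%N; first by rewrite fr.
  apply: dimvS; apply/span_subvP => _ /mapP[p pt ->]; apply: memv_span.
  have /andP[p1 _] := bd p (mem_behead (pt : p \in behead (p0 :: t))).
  rewrite /gens_on; apply: (map_f g); rewrite mem_filter in_iota0 p1 andbT vanishE //.
  exact: vz.
(* In dimension 13 the facet would span the generator [p0.1], at which the inequality does not
   vanish. *)
apply/eqP; rewrite eqn_leq le andbT leqNgt; apply/negP => h.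
have sub : (<<gens_on 24 g ph i>> <= <<G>>)%VS.
  apply/span_subvP => v; rewrite /gens_on => /mapP[j]; rewrite mem_filter => /andP[_ jj] ->.
  exact: memv_span (map_f g jj).
have e : <<gens_on 24 g ph i>>%VS = <<G>>%VS by apply/eqP; rewrite eqEdim sub dim_G.
have /andP[p1 _] := bd p0 (mem_head _ _).
have gG : g p0.1 \in <<gens_on 24 g ph i>>%VS.
  by rewrite e; apply: memv_span; apply: (map_f g); rewrite in_iota0.
have [K KE] := scalar_ker (ph i).
have gK : (<<gens_on 24 g ph i>> <= K)%VS.
  apply/span_subvP => v; rewrite /gens_on => /mapP[j]; rewrite mem_filter => /andP[/eqP z _] ->.
  by rewrite KE z.
by have := subvP gK _ gG; rewrite KE vanishE // (negPf nz).
Qed.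

Definition face (i : nat) : set V0 := facet_of ph C i.

Lemma extreme_raysE24 :
  @extreme_rays R V0 C = (fun j => @ray R V0 (g j)) @` `I_24.
Proof. exact: (extreme_raysE Eulerian_cone_gen Eulerian_cone_ineq isT sep_g). Qed.

Lemma ray_inj24 : {in `I_24 &, injective (fun j => @ray R V0 (g j))}.
Proof. exact: (ray_inj sep_g). Qed.

Lemma facetsE23 : facets C = face @` `I_23.
Proof. exact: (facetsE Eulerian_cone_gen Eulerian_cone_ineq odd_zero_lin dim_G dim_face). Qed.

Lemma face_inj : {in `I_23 &, injective face}.
Proof. exact: (facet_inj Eulerian_cone_gen sep_ph). Qed.

Lemma face_determined (l : {scalar V0}) i : (i < 23)%N ->
  (forall j, (j < 24)%N -> 0 <= l (g j)) ->
  (forall j, (j < 24)%N -> (l (g j) == 0) = vanish i j) ->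
  determines_facet C l (face i).
Proof.
move=> ii lg e; apply: (determines_facet_of Eulerian_cone_gen Eulerian_cone_ineq dim_G dim_face) => //.
by move=> j jj; rewrite vanishE // e.
Qed.

Lemma face_zeros (l : {scalar V0}) i j : (i < 23)%N -> (j < 24)%N ->
  determines_facet C l (face i) -> (l (g j) == 0) = vanish i j.
Proof.
move=> ii jj [_ e _]; rewrite -vanishE //.
exact: (facet_gens Eulerian_cone_gen jj (esym e)).
Qed.

End Geometry.

Local Close Scope classical_set_scope.

Local Close Scope ring_scope.

(** * Facets of types (A), (B) and (C) *)

Definition itv_seq (a b : nat) : seq nat := [seq k <- iota 1 6 | a <= k <= b].

Definition ranks_itv (m : seq nat) (a b : nat) : seq nat := [seq k <- m | a <= k <= b].

Definition max_itvb (S : pred nat) (a b : nat) : bool :=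
  [&& a <= b, all S (iota a (b.+1 - a)), ~~ S b.+1 & (a == 0) || ~~ S a.-1].

Lemma max_itvP S a b : reflect (max_itv S a b) (max_itvb S a b).
Proof.
apply: (iffP and4P) => -[ab].
  move=> /allP H Sb Sa; split=> // [k /andP[ak kb]|c ca].
    by apply: H; rewrite mem_iota ak /=; lia.
  by move: Sa; rewrite -ca.
move=> H Sb Sa; split=> //.
  by apply/allP=> k; rewrite mem_iota => kk; apply: H; lia.
by case: a {ab H} Sa => // a /(_ a erefl).
Qed.

(* Here and below a conditional replaces a boolean connective where eager
   evaluation of the second argument would be too costly. *)
Definition all_itv (S : pred nat) (P : nat -> nat -> bool) : bool :=
  all (fun a => all (fun b => if max_itvb S a b then P a b else true) (iota 0 8)) (iota 0 8).

Lemma all_itvP (S : pred nat) (P : nat -> nat -> bool) (Q : nat -> nat -> Prop) :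
  (forall k, S k -> k <= 7) ->
  (forall a b, max_itv S a b -> reflect (Q a b) (P a b)) ->
  reflect (forall a b, max_itv S a b -> Q a b) (all_itv S P).
Proof.
move=> S7 PQ; apply: (iffP allP) => [H a b ab|H a _].
  have [le inS _ _] := ab; have b7 : b <= 7 by apply/S7/inS; rewrite le leqnn.
  have ai : a \in iota 0 8 by rewrite mem_iota add0n ltnS; apply: leq_trans b7.
  have bi : b \in iota 0 8 by rewrite mem_iota add0n ltnS.
  by have := allP (H a ai) b bi; rewrite (introT (max_itvP _ _ _) ab) => /(PQ _ _ ab).
by apply/allP=> b _; case: ifP => // /max_itvP ab; apply/(PQ _ _ ab); apply: H.
Qed.

Definition admb (m w : seq nat) : bool :=
  if ~~ inclb m w then false else
  [&& all_itv (mem w) (fun a b => 2 <= b - a + 1),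
      all_itv [pred k | (k <= 7) && (k \notin w)] (fun a b => b - a + 1 <= 3) &
      all_itv (mem w) (fun a b => let x := ranks_itv m a b in
        [&& (x == [::]) || (x == itv_seq a a.+1) || (x == itv_seq b.-1 b),
            (a \notin m) ==> ((a == 1) || (1 < a) && (a - 2 \in m)) &
            (b \notin m) ==> ((b == 6) || (b + 2 \in m))])].

Definition typeBb (m w : seq nat) : bool :=
  if ~~ inclb m w then false else all_itv (mem w) (fun a b => size (ranks_itv m a b) <= 1).

Lemma ranks_inj n : injective (@ranks n).
Proof. by move=> S T e; rewrite -[S]rset_ranks e rset_ranks. Qed.

Lemma ranks_setI n (S T : {set 'I_n}) :
  ranks (S :&: T)%SET = [seq k <- ranks S | k \in ranks T].
Proof.
rewrite ranksE [ranks S]ranksE -filter_predI; apply: eq_in_filter => k kn.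
rewrite /= andbC !mem_ranks; apply/exists_inP/andP => [[i]|].
  by rewrite inE => /andP[iS iT] e; split; apply/exists_inP; exists i.
case=> /exists_inP[i iT e] /exists_inP[j jS]; move/eqP: (e) => ->.
by rewrite eqSS => /eqP/val_inj ij; exists i; rewrite // inE iT ij.
Qed.

Lemma ranks_nat_itv a b : ranks (nat_itv 6 a b) = itv_seq a b.
Proof.
rewrite ranksE; apply: eq_in_filter => k; rewrite mem_iota => /andP[k0 k7].
case: k k0 k7 => // k _ k7; rewrite add1n ltnS in k7.
by rewrite (mem_ranksS (nat_itv 6 a b) (Ordinal k7)) inE.
Qed.

Lemma ranks_setI_itv (M : {set 'I_6}) a b :
  ranks (M :&: nat_itv 6 a b)%SET = ranks_itv (ranks M) a b.
Proof.
rewrite ranks_setI ranks_nat_itv; apply: eq_in_filter => k /ranks_le/andP[k0 k6].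
by rewrite mem_filter mem_iota k0 add1n ltnS k6 !andbT.
Qed.

Lemma eq_ranksP n (S T : {set 'I_n}) : reflect (S = T) (ranks S == ranks T).
Proof. by apply: (iffP eqP) => [/ranks_inj|->]. Qed.

Lemma ranks0 n : ranks (finset.set0 : {set 'I_n}) = [::].
Proof. by rewrite /ranks enum_set0. Qed.

Lemma ranks_sub (S T : {set 'I_6}) : (S \subset T) = inclb (ranks S) (ranks T).
Proof. by rewrite -sub_rset ?ranks_S6 // !rset_ranks. Qed.

Lemma admissible_itvP (M : {set 'I_6}) a b : b <= 7 -> reflect
  [/\ [\/ M :&: nat_itv 6 a b = finset.set0,
          M :&: nat_itv 6 a b = nat_itv 6 a a.+1 |
          M :&: nat_itv 6 a b = nat_itv 6 b.-1 b],
      a \notin ranks M -> a = 1 \/ (exists2 m, m \in ranks M & a = m + 2) &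
      b \notin ranks M -> b = 6 \/ (b + 2) \in ranks M]
  (let x := ranks_itv (ranks M) a b in
   [&& (x == [::]) || (x == itv_seq a a.+1) || (x == itv_seq b.-1 b),
       (a \notin ranks M) ==> ((a == 1) || (1 < a) && (a - 2 \in ranks M)) &
       (b \notin ranks M) ==> ((b == 6) || (b + 2 \in ranks M))]).
Proof.
move=> b7; rewrite -!ranks_setI_itv -!ranks_nat_itv -(ranks0 6).
apply: (iffP and3P) => -[c1 c2 c3]; split.
- by case/orP: c1 => [/orP[]|] /eq_ranksP ->; [apply: Or31|apply: Or32|apply: Or33].
- move=> am; have := implyP c2 am => /orP[/eqP|/andP[a1 am2]]; [by left|right].
  by exists (a - 2); rewrite ?subnK.
- by move=> bm; have := implyP c3 bm => /orP[/eqP|]; [left|right].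
- by case: c1 => ->; rewrite eqxx ?orbT.
- by apply/implyP=> /c2[->//|[m mM ->]]; rewrite addnK mM addn2 orbT.
- by apply/implyP=> /c3[->//|->]; rewrite orbT.
Qed.

Lemma admissibleP (M V : {set 'I_6}) :
  reflect (admissible M V) (admb (ranks M) (ranks V)).
Proof.
have V7 (k : nat) : k \in ranks V -> k <= 7 by move/ranks_le/andP=> [_ /leqW].
have N7 k : [pred k | (k <= 7) && (k \notin ranks V)] k -> k <= 7 by case/andP.
have P2 := @all_itvP (mem (ranks V)) _ _ V7 (fun a b _ => @idP (2 <= b - a + 1)).
have P3 := @all_itvP _ _ _ N7 (fun a b _ => @idP (b - a + 1 <= 3)).
have P4 := @all_itvP (mem (ranks V)) _ _ V7 (fun a b (ab : max_itv _ a b) =>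
  @admissible_itvP M a b (let: And4 le inS _ _ := ab in V7 b (inS b (introT andP (conj le (leqnn b)))))).
rewrite /admb -ranks_sub; case: ifP => [/negP MV|/negbFE MV].
  by apply: (iffP idP) => // -[].
by apply: (iffP and3P) => [[/P2 H2 /P3 H3 /P4 H4]|[_ /P2 H2 /P3 H3 /P4 H4]]; split.
Qed.

Lemma typeBP (T V : {set 'I_6}) : reflect
  (T \subset V /\ forall a b, max_itv [pred k | k \in ranks V] a b ->
     #|nat_itv 6 a b :&: T| <= 1)
  (typeBb (ranks T) (ranks V)).
Proof.
have V7 (k : nat) : k \in ranks V -> k <= 7 by move/ranks_le/andP=> [_ /leqW].
have PB a b : max_itv (mem (ranks V)) a b ->
    reflect (#|nat_itv 6 a b :&: T| <= 1) (size (ranks_itv (ranks T) a b) <= 1).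
  by move=> _; rewrite finset.setIC -ranks_setI_itv size_ranks; apply: idP.
have P := all_itvP V7 PB.
rewrite /typeBb -ranks_sub; case: ifP => [/negP TV|/negbFE TV].
  by apply: (iffP idP) => // -[].
by apply: (iffP P) => [|[]].
Qed.

Definition intervalZ (m w : seq nat) (j : nat) : Z :=
  sumZ [seq Lval j q | q <- S6 & inclb m q && inclb q w].

(** The value 24 of [find] means that no generator tells the form and the inequality [i] apart by
    its zeros. *)
Definition same_face (m w : seq nat) (i : nat) : bool :=
  find (fun j => Zeq0 (intervalZ m w j) != vanish i j) (iota 0 24) == 24.

(* Indices in [ineqs] of the facets of types (A), (B) but not (A), and (C). *)
Definition facesA : seq nat := [:: 1; 5; 6; 7; 9; 10; 11; 13; 14; 15; 16; 17; 18; 21; 22].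
Definition facesB : seq nat := [:: 2; 8; 12; 20].
Definition facesC : seq nat := [:: 0; 3; 4; 19].

(** [V] is that of the entry [FB T V] in [ineqs]; each element of [T] is an end of a maximal
    interval of [V], and [M] adds its neighbour there. *)
Definition witnessA (i : nat) : seq nat * seq nat :=
  nth ([::], [::]) [:: ([::4;5],[::1;2;3;4;5]); ([::1;2],[::1;2;4;5;6]);
    ([::2;3],[::2;3;4;5;6]); ([::5;6],[::1;2;3;5;6]); ([::2;3],[::2;3;5;6]);
    ([::3;4],[::1;2;3;4]); ([::1;2;5;6],[::1;2;5;6]); ([::1;2;4;5],[::1;2;4;5]);
    ([::3;4],[::3;4;5;6]); ([::5;6],[::1;2;3;4;5;6]); ([::4;5],[::1;2;4;5]);
    ([::3;4],[::3;4]); ([::],[::1;2;3;4;5;6]); ([::1;2],[::1;2;3;4;5;6]);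
    ([::2;3;5;6],[::2;3;5;6])] (index i facesA).

Definition witness_ok (m w : seq nat) (e i : nat) : bool :=
  [&& m \in S6, w \in S6, same_face m w i &
      all (fun j => Z.leb 0 (sgZ e * intervalZ m w j)) (iota 0 24)].

Lemma witnessA_ok : all (fun i => let: (m, w) := witnessA i in
  admb m w && witness_ok m w (size m %/ 2) i) facesA.
Proof. by vm_compute. Qed.

Lemma witnessB_ok : all (fun i => if ineq_nth i is FB m w then
  typeBb m w && witness_ok m w (size m) i else false) facesB.
Proof. by vm_compute. Qed.

(** This exhaustive check makes the count of facets of type (A) an equality; [typeB_faces] does the
    same for type (B). *)
Lemma typeA_faces : all (fun m => all (fun w => if admb m w then
  all (fun i => ~~ same_face m w i) (facesB ++ facesC) else true) S6) S6.
Proof. by vm_compute. Qed.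

Lemma typeB_faces : all (fun m => all (fun w => if typeBb m w then
  all (fun i => ~~ same_face m w i) facesC else true) S6) S6.
Proof. by vm_compute. Qed.

Lemma faces_split : all (fun i => (i \in facesA) || (i \in facesB ++ facesC)) (iota 0 23).
Proof. by vm_compute. Qed.

Lemma facesC_ok : all (fun i => if ineq_nth i is FC a b c then (0 < a < b) && (b < c < 7) else false) facesC.
Proof. by vm_compute. Qed.

(** * Even interval systems *)

Definition pair_itv (p : nat * nat) : seq nat := itv_seq p.1 p.2.

Definition is_itvb (t : seq nat) : bool :=
  (t != [::]) && all (fun i => all (fun k => all (fun j =>
    (i <= j <= k) ==> (j \in t)) (iota 1 6)) t) t.

Definition even_meet (s t : seq nat) : bool := ~~ odd (size [seq k <- s | k \in t]).

Lemma even_itvs_all : all (fun t => is_itvb t && even_meet t t ==>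
  (t \in map pair_itv even_itvs)) S6.
Proof. by vm_compute. Qed.

Lemma even_itvs_ok : all (fun p => is_itvb (pair_itv p) && (pair_itv p \in S6)) even_itvs.
Proof. by vm_compute. Qed.

Lemma itv_compat_all : all (fun p => all (fun q =>
  [&& p != q, ~~ inclb (pair_itv p) (pair_itv q), ~~ inclb (pair_itv q) (pair_itv p) &
      even_meet (pair_itv p) (pair_itv q)] ==> itv_compat p q) even_itvs) even_itvs.
Proof. by vm_compute. Qed.

Lemma pair_itv_inj : all (fun p => all (fun q =>
  (pair_itv p == pair_itv q) ==> (p == q)) even_itvs) even_itvs.
Proof. by vm_compute. Qed.

Lemma systems_ok : all (fun L => all (fun p => (p \in even_itvs) && all (fun q =>
    (inclb (pair_itv p) (pair_itv q) ==> (pair_itv p == pair_itv q)) &&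
    even_meet (pair_itv p) (pair_itv q)) L) L) (systems even_itvs).
Proof. by vm_compute. Qed.

Lemma systems_half_count : all (fun j => all (fun t =>
    half_count (sk_nth j) t == nat_of_bool (all (fun p => ~~ disj t (pair_itv p))
      (nth [::] (systems even_itvs) j))) S6) (iota 0 20).
Proof. by vm_compute. Qed.

Lemma size_systems : size (systems even_itvs) = 20.
Proof. by vm_compute. Qed.

Lemma mem_systems (a : pred (nat * nat)) (s : seq (nat * nat)) :
  pairwise itv_compat [seq p <- s | a p] -> [seq p <- s | a p] \in systems s.
Proof.
elim: s => //= p s IH; case: ifP => _ /=; last by move=> /IH; rewrite mem_cat orbC => ->.
case/andP=> pc /IH H; rewrite mem_cat; apply/orP; left.
by apply/mapP; exists [seq q <- s | a q] => //; rewrite mem_filter pc.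
Qed.

Lemma is_itvP (I : {set 'I_6}) : is_rank_interval I = is_itvb (ranks I).
Proof.
congr (_ && _).
  by rewrite -(inj_eq (@ranks_inj 6)) ranks0.
apply/forall_inP/allP => [H x /mapP[i + ->]|H i iI].
  rewrite mem_enum => iI; apply/allP=> y /mapP[k + ->]; rewrite mem_enum => kI.
  apply/allP=> j; rewrite mem_iota => /andP[j1 j7]; apply/implyP=> ijk.
  have j6 : j.-1 < 6 by case: j j1 j7 ijk.
  have /forallP/(_ (Ordinal j6))/implyP jI := forall_inP (H i iI) k kI.
  rewrite -[j]prednK //; have /= -> // := mem_ranksS I (Ordinal j6).
  by apply: jI; rewrite /=; move: ijk; rewrite -{1 2}[j]prednK.
apply/forall_inP=> k kI; apply/forallP=> j; apply/implyP=> ijk.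
have ii : i.+1 \in ranks I by rewrite mem_ranksS.
have kk : k.+1 \in ranks I by rewrite mem_ranksS.
have jj : j.+1 \in iota 1 6 by rewrite mem_iota /= add1n ltnS ltn_ord.
by have /implyP := allP (allP (H _ ii) _ kk) _ jj; rewrite mem_ranksS; apply.
Qed.

Lemma even_meetP (I J : {set 'I_6}) : ~~ odd #|I :&: J| = even_meet (ranks I) (ranks J).
Proof. by rewrite /even_meet -ranks_setI size_ranks. Qed.

Section Limits.
Variable R : realType.
Local Open Scope ring_scope.

(** Up to the factor [2 ^+ #|S|], both sides say whether [S] meets every interval of the system. *)
Lemma doubled_limitE (Is : {set {set 'I_6}}) (L : seq (nat * nat)) :
  L \in systems even_itvs -> interval_system Is ->
  (forall I, (I \in Is) = (ranks I \in map pair_itv L)) ->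
  doubled_limit_flag_vector R Is = gvec R (index L (systems even_itvs)).
Proof.
move=> LS iIs IsL; apply/rowP=> k; rewrite !mxE; set S := enum_val k; congr (_ * _).
have jL : (index L (systems even_itvs) < 20)%N by rewrite -size_systems index_mem.
have := allP systems_half_count (index L (systems even_itvs)).
rewrite mem_iota add0n => /(_ jL)/allP/(_ _ (ranks_S6 S))/eqP ->.
rewrite nth_index // limit_flagE //; congr ((nat_of_bool _)%:R).
apply/forall_inP/allP => [H p pL|H I].
  have := allP systems_ok L LS => /allP/(_ p pL)/andP[pe _].
  have /andP[_ pS] := allP even_itvs_ok p pe.
  have := H (rset 6 (pair_itv p)); rewrite IsL ranks_rset // => /(_ (map_f _ pL)).
  by rewrite -{1}[S]rset_ranks disj_rset.
rewrite IsL => /mapP[p pL e]; rewrite -[I]rset_ranks -[S]rset_ranks disj_rset ?ranks_S6 //.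
by rewrite e; apply: H.
Qed.

Lemma system_of_list L : L \in systems even_itvs ->
  even_interval_system [set I : {set 'I_6} | ranks I \in map pair_itv L]%SET.
Proof.
move=> LS; have LP := allP systems_ok L LS.
apply/andP; split; first (apply/andP; split).
- apply/forall_inP=> I; rewrite inE => /mapP[p pL e]; rewrite is_itvP e.
  have /andP[pe _] := allP LP p pL.
  by have /andP[] := allP even_itvs_ok p pe.
- apply/forall_inP=> I; rewrite inE => /mapP[p pL ep]; apply/forall_inP=> J.
  rewrite inE => /mapP[q qL eq]; rewrite ranks_sub; apply/implyP; rewrite ep eq => pq.
  have /andP[_ /allP/(_ q qL)/andP[/implyP/(_ pq)/eqP e _]] := allP LP p pL.
  by apply/eqP; apply: ranks_inj; rewrite ep eq.
apply/forall_inP=> I; rewrite inE => /mapP[p pL ep]; apply/forall_inP=> J.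
rewrite inE => /mapP[q qL eq]; rewrite even_meetP ep eq.
by have /andP[_ /allP/(_ q qL)/andP[_]] := allP LP p pL.
Qed.

(** [systems] only produces sublists of [even_itvs] in its order, hence the presentation of the
    system as a filter of that list. *)
Lemma list_of_system (Is : {set {set 'I_6}}) : even_interval_system Is ->
  exists2 L, L \in systems even_itvs & forall I, (I \in Is) = (ranks I \in map pair_itv L).
Proof.
case/andP=> /andP[/forall_inP itv /forall_inP incomp] /forall_inP ev.
pose a p := rset 6 (pair_itv p) \in Is.
have rk p : p \in even_itvs -> ranks (rset 6 (pair_itv p)) = pair_itv p.
  by move=> pe; rewrite ranks_rset //; have /andP[] := allP even_itvs_ok p pe.
exists [seq p <- even_itvs | a p]; last first.
  move=> I; apply/idP/mapP => [iI|[p]]; last first.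
    by rewrite mem_filter /a => /andP[pI _] e; rewrite -[I]rset_ranks e.
  have := allP even_itvs_all (ranks I) (ranks_S6 I).
  rewrite -is_itvP itv // -even_meetP (forall_inP (ev I iI)) // => /mapP[p pe e].
  by exists p => //; rewrite mem_filter pe /a -e rset_ranks iI.
apply: mem_systems; have : uniq [seq p <- even_itvs | a p] by apply: filter_uniq.
rewrite uniq_pairwise; apply: (sub_in_pairwise _ (allss _)) => p q.
rewrite ![_ \in mem _]mem_filter => /andP[pI pe] /andP[qI qe] pq.
have /implyP H := allP (allP itv_compat_all p pe) q qe; apply: H.
have subE x y : x \in even_itvs -> y \in even_itvs ->
    inclb (pair_itv x) (pair_itv y) = (rset 6 (pair_itv x) \subset rset 6 (pair_itv y)).
  by move=> xe ye; rewrite ranks_sub !rk.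
have meet : even_meet (pair_itv p) (pair_itv q).
  by rewrite -(rk p pe) -(rk q qe) -even_meetP (forall_inP (ev _ pI)).
have {}pq : p != q := pq.
have ne : rset 6 (pair_itv p) != rset 6 (pair_itv q).
  apply: contraNneq pq => e; have /implyP H := allP (allP pair_itv_inj p pe) q qe; apply: H.
  by rewrite -(rk p pe) -(rk q qe) e.
rewrite pq meet andbT !subE //=; apply/andP; split; apply/negP=> sub; case/eqP: ne.
  by apply/eqP; apply: implyP (forall_inP (incomp _ pI) _ qI) sub.
by apply/esym/eqP; apply: implyP (forall_inP (incomp _ qI) _ pI) sub.
Qed.

End Limits.

Local Open Scope classical_set_scope.
Local Open Scope card_scope.
Local Open Scope ring_scope.

Lemma systems_uniq : uniq (systems even_itvs).
Proof. by vm_compute. Qed.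

Lemma zrZ_sum (R : numDomainType) (T : Type) (s : seq T) (F : T -> Z) (P : pred T) :
  \sum_(q <- s | P q) zr R (F q) = zr R (sumZ [seq F q | q <- s & P q]).
Proof. by rewrite /sumZ zr_sum big_filter. Qed.

Section Final.
Variable R : realType.
Local Notation V0 := 'rV[R]_#|{set 'I_6}|.
Local Notation g := (@gvec R).
Local Notation C := (Eulerian_cone R 6).
Local Notation face := (@face R).

Lemma Eulerian_cone_fg : finitely_generated C.
Proof.
exists [seq g j | j <- iota 0 24]; apply/seteqP; split=> v.
  move=> /Eulerian_cone_gen[c c0 ->]; exists 24, (fun j => c j), (fun j => g j); split=> // j.
  by apply/mapP; exists (nat_of_ord j); rewrite ?mem_iota ?ltn_ord.
move=> [k [c [x [c0 xg ->]]]].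
have C0 := C_0 (@Eulerian_cone_gen R).
elim/big_ind: _ => [//|u w Cu Cw|i _].
  by rewrite -[u]scale1r; apply: (C_lin (@Eulerian_cone_gen R)).
apply: (C_scale (@Eulerian_cone_gen R)) => //.
have /mapP[j] := xg i; rewrite mem_iota add0n => /= j24 ->.
exact: (C_g (@Eulerian_cone_gen R)).
Qed.

Lemma doubled_limit_raysE :
  doubled_limit_rays R 6 = (fun j => @ray R V0 (g j)) @` `I_20.
Proof.
apply/seteqP; split=> [_ [Is ev ->]|_ [j /= j20 <-]].
  have [L LS IsL] := list_of_system ev; have /andP[iIs _] := ev.
  have lt : (index L (systems even_itvs) < 20)%N by rewrite -size_systems index_mem.
  exists (index L (systems even_itvs)); first exact: lt.
  by rewrite (doubled_limitE R LS iIs IsL).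
have LS : nth [::] (systems even_itvs) j \in systems even_itvs.
  by apply: mem_nth; rewrite size_systems.
have ev := system_of_list LS; have /andP[iIs _] := ev.
exists [set I : {set 'I_6} | ranks I \in map pair_itv (nth [::] (systems even_itvs) j)]%SET => //.
rewrite (doubled_limitE R LS iIs) ?index_uniq ?size_systems ?systems_uniq // => I.
by rewrite inE.
Qed.

Lemma card_faces (s : seq nat) : uniq s -> {subset s <= iota 0 23} ->
  face @` [set` s] #= `I_(size s).
Proof.
move=> us sub.
have -> : face @` [set` s] = (fun k => face (nth 0%N s k)) @` `I_(size s).
  apply/seteqP; split=> [_ [i /= /(nthP 0%N)[k ks <-] <-]|_ [k /= ks <-]].
    by exists k.
  by exists (nth 0%N s k) => //=; apply: mem_nth.
apply: inj_card_eq => k h; rewrite !inE /= => ks hs /face_inj e.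
apply/eqP; rewrite -(nth_uniq 0%N ks hs us) e // inE /=.
  by have := sub _ (mem_nth 0%N ks); rewrite in_iota0.
by have := sub _ (mem_nth 0%N hs); rewrite in_iota0.
Qed.

Definition Lform (c : R) (M W : {set 'I_6}) (v : V0) : R :=
  c * \sum_(Q : {set 'I_6} | (M \subset Q) && (Q \subset W)) flag_L Q v.

Lemma Lform_linear c M W : scalar (Lform c M W).
Proof.
move=> a v w; rewrite /Lform [X in _ = X + _]mulrCA -mulrDr; congr (_ * _).
by rewrite mulr_sumr -big_split; apply: eq_bigr => Q _; rewrite linearP.
Qed.

HB.instance Definition _ c M W :=
  GRing.isLinear.Build R V0 R _ (Lform c M W) (Lform_linear c M W).

Lemma Lform_gvec c M W j : (j < 24)%N ->
  Lform c M W (g j) = c * zr R (intervalZ (ranks M) (ranks W) j).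
Proof.
move=> jj; rewrite /Lform big_S6; congr (_ * _).
rewrite /intervalZ -zrZ_sum big_seq_cond [RHS]big_seq_cond; apply: eq_big => [q|q /andP[qS _]].
  case: (boolP (q \in S6)) => //= qS.
  by rewrite !ranks_sub ranks_rset.
exact: Lq_gvec.
Qed.

(** A face determines which generators lie on it, and the sign in front of the form does not affect
    its zeros. *)
Lemma not_face_of_form k M W i : (i < 23)%N ->
  determines_facet C (Lform ((-1) ^+ k) M W) (face i) -> same_face (ranks M) (ranks W) i.
Proof.
move=> ii df; apply: contraT => sf.
have : has (fun j => Zeq0 (intervalZ (ranks M) (ranks W) j) != vanish i j) (iota 0 24).
  by rewrite has_find ltn_neqAle find_size andbT.
case/hasP=> j; rewrite in_iota0 => jj; case/negP; apply/eqP.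
rewrite -(face_zeros ii jj df) /= Lform_gvec // mulf_eq0 signr_eq0 orFb.
by rewrite zr_eq0.
Qed.

Lemma face_of_form (m w : seq nat) k i : (i < 23)%N -> witness_ok m w k i ->
  determines_facet C (Lform ((-1) ^+ k) (rset 6 m) (rset 6 w)) (face i).
Proof.
move=> ii /and4P[mS wS sf /allP nn]; apply: face_determined => // j jj /=.
  rewrite Lform_gvec // -zr_sgZ -zrM zr_ge0 !ranks_rset //.
  by apply: nn; rewrite in_iota0.
rewrite Lform_gvec // mulf_eq0 signr_eq0 orFb zr_eq0 !ranks_rset //.
have : ~~ has (fun j => Zeq0 (intervalZ m w j) != vanish i j) (iota 0 24).
  by rewrite has_find -leqNgt (eqP sf).
by move/hasPn/(_ j); rewrite in_iota0 negbK => /(_ jj)/eqP.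
Qed.

Lemma facesB_lt i : i \in facesB -> (i < 23)%N.
Proof. by move: i; apply/allP. Qed.

Lemma facesA_lt i : i \in facesA -> (i < 23)%N.
Proof. by move: i; apply/allP. Qed.

Lemma facesC_lt i : i \in facesC -> (i < 23)%N.
Proof. by move: i; apply/allP. Qed.

Lemma typeA_scalar (l : V0 -> R) : typeA l -> scalar l.
Proof. by move=> [M [W [_ ->]]]; exact: (Lform_linear _ M W). Qed.

Lemma typeB_scalar (l : V0 -> R) : typeB l -> scalar l.
Proof. by move=> [M [W [_ _ ->]]]; exact: (Lform_linear _ M W). Qed.

Lemma flag_coord_linear S : scalar (fun v : V0 => flag_coord v S).
Proof. by move=> a v w; rewrite /flag_coord !mxE. Qed.

Lemma typeC_scalar (l : V0 -> R) : typeC l -> scalar l.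
Proof.
move=> [i [j [k [_ ->]]]] a v w /=; rewrite !flag_coord_linear; ring.
Qed.

Lemma facets_from_sub (Q : (V0 -> R) -> Prop) : (forall l, Q l -> scalar l) ->
  facets_from C Q `<=` facets C.
Proof. by move=> Qs F [l Ql lF]; exists l => //; apply: Qs. Qed.

Lemma facets_face F : facets C F -> exists2 i, (i < 23)%N & F = face i.
Proof. by rewrite facetsE23 => -[i /= ii <-]; exists i. Qed.

Lemma typeA_facet i : i \in facesA -> facets_from C (@typeA R 6) (face i).
Proof.
move=> iA; have := allP witnessA_ok i iA; case: (witnessA i) => m w /andP[ad ok].
have /and4P[mS wS _ _] := ok.
exists (Lform ((-1) ^+ (size m %/ 2)) (rset 6 m) (rset 6 w)).
  exists (rset 6 m), (rset 6 w); split; first by apply/admissibleP; rewrite !ranks_rset.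
  by rewrite card_rset.
by apply: face_of_form => //; apply: facesA_lt.
Qed.

Lemma typeB_facet i : i \in facesB -> facets_from C (@typeB R 6) (face i).
Proof.
move=> iB; have := allP witnessB_ok i iB; case: (ineq_nth i) => // m w /andP[ad ok].
have /and4P[mS wS _ _] := ok.
exists (Lform ((-1) ^+ size m) (rset 6 m) (rset 6 w)).
  have [sub le] : rset 6 m \subset rset 6 w /\ forall a b,
      max_itv [pred k | k \in ranks (rset 6 w)] a b -> (#|nat_itv 6 a b :&: rset 6 m| <= 1)%N.
    by apply/typeBP; rewrite !ranks_rset.
  by exists (rset 6 m), (rset 6 w); split=> //; rewrite card_rset.
by apply: face_of_form => //; apply: facesB_lt.
Qed.

Lemma typeC_facet i : i \in facesC -> facets_from C (@typeC R 6) (face i).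
Proof.
move=> iC; have := allP facesC_ok i iC; have i23 := facesC_lt iC.
case e : (ineq_nth i) => [//|a b c] /andP[ab bc].
have [a0 a1] := andP ab; have [b1 c7] := andP bc.
have b0 := ltn_trans a0 a1; have c0 := ltn_trans b0 b1.
have b7 := ltn_trans b1 c7; have a7 := ltn_trans a1 b7.
have pr k : (0 < k)%N -> (k < 7)%N -> (k.-1 < 6)%N by case: k.
have oE k (k0 : (0 < k)%N) (k7 : (k < 7)%N) (x : 'I_6) :
    (x == Ordinal (pr k k0 k7)) = (x.+1 == k).
  by rewrite -(inj_eq val_inj) /= -[in RHS](prednK k0) eqSS.
have rs k (k0 : (0 < k)%N) (k7 : (k < 7)%N) : rset 6 [:: k] = [set Ordinal (pr k k0 k7)]%SET.
  by apply/setP=> x; rewrite !inE oE.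
pose l (v : V0) := 4 * phi (FC a b c) v.
exists l.
  exists (Ordinal (pr a a0 a7)), (Ordinal (pr b b0 b7)), (Ordinal (pr c c0 c7)).
  split; first by rewrite /= -(ltnS a.-1.+1) -(ltnS b.-1.+1) !prednK // a1 b1.
  apply/funext => v; rewrite /l phi_FC // /fl (rs a a0 a7) (rs b b0 b7) (rs c c0 c7).
  by congr (flag_coord v _ - _ - _ + _); apply/setP=> x; rewrite !inE !oE.
have ll : scalar l by move=> r v w; rewrite /l phi_linear mulrDr mulrCA.
pose ls : {scalar V0} := HB.pack_for {scalar V0} l (GRing.isLinear.Build R V0 R _ l ll).
apply: (@face_determined R ls) => // j jj; rewrite /= /l -e phi_gvec //.
  rewrite mulr_ge0 // -phi_gvec //; apply: (phi_ge0 (@Eulerian_cone_ineq R)) => //.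
  exact: (C_g (@Eulerian_cone_gen R)).
by rewrite mulf_eq0 pnatr_eq0 zr_eq0.
Qed.

Lemma typeA_not i : (i < 23)%N -> facets_from C (@typeA R 6) (face i) -> i \in facesA.
Proof.
move=> ii [l [M [W [/admissibleP ad ->]]]] /(not_face_of_form ii) sf.
have := allP faces_split i; rewrite in_iota0 => /(_ ii)/orP[//|iBC].
have := allP (allP typeA_faces _ (ranks_S6 M)) _ (ranks_S6 W); rewrite ad => /allP/(_ i iBC).
by rewrite sf.
Qed.

Lemma typeB_not i : i \in facesC -> ~ facets_from C (@typeB R 6) (face i).
Proof.
move=> iC [l [M [W [MW le ->]]]] /(not_face_of_form (facesC_lt iC)) sf.
have tb : typeBb (ranks M) (ranks W) by apply/typeBP.
have := allP (allP typeB_faces _ (ranks_S6 M)) _ (ranks_S6 W); rewrite tb => /allP/(_ i iC).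
by rewrite sf.
Qed.

Lemma disjoint_faces : all (fun i => i \notin facesA) (facesB ++ facesC).
Proof. by []. Qed.

End Final.

Theorem theorem4p8 (R : realType) :
  let C := Eulerian_cone R 6 in
  let A := facets_from C (@typeA R 6) in
  let B := facets_from C (@typeB R 6) in
  let D := facets_from C (@typeC R 6) in
  [/\ finitely_generated C,
      extreme_rays C #= `I_24,
      doubled_limit_rays R 6 `<=` extreme_rays C &
      doubled_limit_rays R 6 #= `I_20]
  /\
  [/\ facets C #= `I_23,
      [/\ A `<=` facets C, B `<=` facets C & D `<=` facets C],
      A #= `I_15,
      B `\` A #= `I_4 &
      facets C `\` (A `|` B) #= `I_4 /\ facets C `\` (A `|` B) `<=` D].
Proof.
move=> C A B D.
have AC : A `<=` facets C := facets_from_sub (@typeA_scalar R).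
have BC : B `<=` facets C := facets_from_sub (@typeB_scalar R).
have DC : D `<=` facets C := facets_from_sub (@typeC_scalar R).
have nA i : i \in facesB ++ facesC -> i \notin facesA := allP disjoint_faces i.
(* The three types are now matched with disjoint lists of indices, so that counting facets amounts
   to counting indices. *)
have AE : A = @face R @` [set` facesA].
  apply/seteqP; split=> [F FA|_ [i iA <-]]; last exact: typeA_facet.
  have [i ii e] := facets_face (AC _ FA); exists i => //.
  by apply: (@typeA_not R i ii); rewrite -e.
have BE : B `\` A = @face R @` [set` facesB].
  apply/seteqP; split=> [F [FB FA]|_ [i iB <-]].
    have [i ii e] := facets_face (BC _ FB); exists i => //=.
    have := allP faces_split i; rewrite in_iota0 => /(_ ii)/orP[iA|].
      by case: FA; rewrite e; apply: typeA_facet.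
    by rewrite mem_cat => /orP[//|iC]; case: (@typeB_not R i iC); rewrite -e.
  split; first exact: typeB_facet.
  move=> /(@typeA_not R i (facesB_lt iB)); apply/negP; apply: nA.
  by rewrite mem_cat (iB : i \in facesB).
have CE : facets C `\` (A `|` B) = @face R @` [set` facesC].
  apply/seteqP; split=> [F [FC FAB]|_ [i iC <-]].
    have [i ii e] := facets_face FC; exists i => //=.
    have := allP faces_split i; rewrite in_iota0 => /(_ ii)/orP[iA|].
      by case: FAB; left; rewrite e; apply: typeA_facet.
    rewrite mem_cat => /orP[iB|//].
    by case: FAB; right; rewrite e; apply: typeB_facet.
  split; first by rewrite /C facetsE23; exists i => //; apply: facesC_lt.
  case=> [/(@typeA_not R i (facesC_lt iC))|]; last exact: typeB_not.
  by apply/negP; apply: nA; rewrite mem_cat (iC : i \in facesC) orbT.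
split; split=> //.
- exact: Eulerian_cone_fg.
- by rewrite /C extreme_raysE24; apply: inj_card_eq; exact: ray_inj24.
- rewrite /C extreme_raysE24 doubled_limit_raysE => _ [j /= j20 <-].
  by exists j => //=; apply: leq_trans j20 _.
- rewrite doubled_limit_raysE; apply: inj_card_eq => i j; rewrite !inE /= => i20 j20.
  by apply: ray_inj24; rewrite inE /=; [apply: leq_trans i20 _|apply: leq_trans j20 _].
- by rewrite /C facetsE23; apply: inj_card_eq; exact: face_inj.
- by rewrite AE; apply: (@card_faces R facesA) => // i /facesA_lt; rewrite in_iota0.
- by rewrite BE; apply: (@card_faces R facesB) => // i /facesB_lt; rewrite in_iota0.
split.
  by rewrite CE; apply: (@card_faces R facesC) => // i /facesC_lt; rewrite in_iota0.
by rewrite CE => _ [i iC <-]; apply: typeC_facet.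
Qed.
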